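(* Let $\Gamma$ be an infinite, locally finite tree with root $0$, equipped with a random environment as described in the context, whose common law is that of a random variable $A$ with $0<A<\infty$ a.s. Let $$p:=\min_{0\le x\le 1}\mathbf{E}[A^x].$$ (1) If $p\cdot \mathrm{br}\,\Gamma>1$, then the random walk in random environment (RWRE) is a.s. transient, the electrical network with conductances $C_\sigma$ has positive conductance (from $0$ to infinity) a.s., and the capacitated network with capacities $C_\sigma$ admits flow (to infinity) a.s. (2) If $p\cdot \mathrm{br}\,\Gamma<1$, then the RWRE is a.s. recurrent, the electrical network has zero conductance a.s., and the capacitated network admits no flow a.s. More generally, these conclusions hold whenever $\inf_{\Pi}\sum_{\sigma\in\Pi}p^{|\sigma|}=0$, where the infimum is over all cutsets $\Pi$ of $\Gamma$. (3) If $p\cdot\limsup_{n\to\infty}M_n^{1/n}<1$, where $M_n:=\mathrm{card}\{\sigma\in\Gamma: |\sigma|=n\}$, then the RWRE is a.s. positive recurrent. More generally, this conclusion holds whenever $\sum_{\sigma\in\Gamma}p^{|\sigma|}<\infty$.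
   Context: Tree notation. $\Gamma$ is identified with its vertex set. $|\sigma|$ is the number of edges on the shortest path from the root $0$ to $\sigma$. Write $\sigma\le\tau$ if $\sigma$ lies on the shortest path from $0$ to $\tau$, $\sigma<\tau$ if $\sigma\le\tau$ and $\sigma\neq\tau$, and $\sigma\to\tau$ if $\sigma\le\tau$ and $|\tau|=|\sigma|+1$. For $\sigma\ne 0$, $\overleftarrow{\sigma}$ is the vertex with $\overleftarrow{\sigma}\to\sigma$, and $e(\sigma)$ is the edge from $\overleftarrow{\sigma}$ to $\sigma$. A cutset $\Pi$ is a finite set of vertices not including $0$ such that every infinite path from $0$ (going through no vertex more than once) intersects $\Pi$ and such that there is no pair $\sigma,\tau\in\Pi$ with $\sigma<\tau$. The branching number of $\Gamma$ is $$\mathrm{br}\,\Gamma:=\inf\Big\{\lambda>0:\ \inf_{\Pi}\sum_{\sigma\in\Pi}\lambda^{-|\sigma|}=0\Big\},$$ the inner infimum being over all cutsets. Random environment. A random walk on $\Gamma$ is a Markov chain on the vertices whose allowable transitions are exactly those between neighboring vertices; all these transition probabilities are nonzero. In a random environment the transition probabilities are random variables; the vectors of transition probabilities out of distinct vertices are independent (transition probabilities out of the same vertex may be dependent). For $|\sigma|\ge2$, let $A_\sigma$ be the transition probability from $\overleftarrow{\sigma}$ to $\sigma$ divided by the transition probability from $\overleftarrow{\sigma}$ to its own predecessor $\overleftarrow{\overleftarrow{\sigma}}$. It is assumed that all but finitely many of the $A_\sigma$ are identically distributed; $A$ denotes a random variable with this common distribution. For $|\sigma|=1$, choose further i.i.d.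 random variables $A_\sigma$ with the law of $A$, independent of the rest. For $\sigma\ne0$ set $C_\sigma:=\prod_{0<\tau\le\sigma}A_\tau$. The RWRE is a.s. transient (recurrent, positive recurrent) if, for almost every realization of the environment, the Markov chain with those transition probabilities is transient (recurrent, positive recurrent). The electrical network is $\Gamma$ with conductance $C_\sigma$ along the edge $e(\sigma)$; its conductance is the effective conductance from $0$ to infinity. The capacitated network is $\Gamma$ with capacity $C_\sigma$ through $e(\sigma)$; it admits flow if there is a function $\theta\ge0$ on the vertices $\sigma\neq0$, not identically zero, with $\theta(\sigma)\le C_\sigma$ and $\theta(\sigma)=\sum_{\tau:\sigma\to\tau}\theta(\tau)$ for all $\sigma\ne0$. *)

(* Defs.v *)
From HB Require Import structures.
From mathcomp Require Import all_boot all_order all_algebra finmap.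
From mathcomp Require Import all_classical all_reals all_analysis.
Set Implicit Arguments.
Unset Strict Implicit.
Unset Printing Implicit Defensive.
Import Order.TTheory GRing.Theory Num.Theory.
Import numFieldNormedType.Exports.
Local Open Scope classical_set_scope.
Local Open Scope ring_scope.


(* The graph with vertex set [V] and adjacency relation [adj]; a path from [x]
   is given by the sequence [p] of its vertices other than the initial [x]. *)
Definition is_tree (V : choiceType) (adj : rel V) : Prop :=
  [/\ symmetric adj, irreflexive adj &
      forall x y : V, exists! p : seq V,
        [/\ path adj x p, last x p = y & uniq (x :: p)]].

Definition locally_finite_graph (V : choiceType) (adj : rel V) : Prop :=
  forall x : V, finite_set [set y | adj x y].

(* The shortest path from [o] to [s], without its initial vertex [o]. *)
Definition spath (V : choiceType) (adj : rel V) (o s : V) : seq V :=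
  xget [::] [set p | [/\ path adj o p, last o p = s &
    forall p', path adj o p' -> last o p' = s -> (size p <= size p')%N]].

Definition depth (V : choiceType) (adj : rel V) (o s : V) : nat :=
  size (spath adj o s).

Definition tle (V : choiceType) (adj : rel V) (o s t : V) : bool :=
  s \in o :: spath adj o t.

Definition tlt (V : choiceType) (adj : rel V) (o s t : V) : bool :=
  tle adj o s t && (s != t).

Definition child (V : choiceType) (adj : rel V) (o s t : V) : bool :=
  tle adj o s t && (depth adj o t == (depth adj o s).+1).

(* Meaningful for [s != o] only. *)
Definition parent (V : choiceType) (adj : rel V) (o s : V) : V :=
  xget o [set t | child adj o t s].

Definition cutset (V : choiceType) (adj : rel V) (o : V) (Pi : set V) : Prop :=
  [/\ finite_set Pi, ~ Pi o,
      forall x : nat -> V, x 0%N = o -> (forall n, adj (x n) (x n.+1)) ->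
        injective x -> exists n, Pi (x n) &
      forall s t, Pi s -> Pi t -> ~~ tlt adj o s t].

Definition cutset_inf (R : realType) (V : choiceType) (adj : rel V) (o : V)
    (x : R) : \bar R :=
  ereal_inf [set (\sum_(s \in Pi) x ^+ depth adj o s)%:E
            | Pi in [set Pi : set V | cutset adj o Pi]].

(* The value is [+oo] when no [lam] qualifies. *)
Definition branching_number (R : realType) (V : choiceType) (adj : rel V)
    (o : V) : \bar R :=
  ereal_inf [set lam%:E
            | lam in [set lam : R | 0 < lam /\ cutset_inf adj o lam^-1 = 0%E]].

Definition level_card (V : choiceType) (adj : rel V) (o : V) (n : nat) : nat :=
  #|` fset_set [set s | depth adj o s = n] |%fset.


(* For the chain [X] with transition probabilities [q] started at [x],
   the probability of [X_1 = y_1, ..., X_n = y_n], where [p = [y_1; ...; y_n]]. *)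
Fixpoint path_prob (R : realType) (V : choiceType) (q : V -> V -> R) (x : V)
    (p : seq V) : R :=
  if p is y :: p' then q x y * path_prob q y p' else 1.

(* Trajectories that first return to [x] at time n are the [rcons p x], with
   [p] of size n - 1 avoiding [x]. *)
Definition return_prob (R : realType) (V : choiceType) (q : V -> V -> R)
    (x : V) : \bar R :=
  (\esum_(p in [set p : seq V | x \notin p]) (path_prob q x (rcons p x))%:E)%E.

(* The expectation of the first return time on the event that it is finite. *)
Definition mean_return_time (R : realType) (V : choiceType) (q : V -> V -> R)
    (x : V) : \bar R :=
  (\esum_(p in [set p : seq V | x \notin p])
     ((size (rcons p x))%:R * path_prob q x (rcons p x))%:E)%E.

Definition transient (R : realType) (V : choiceType) (q : V -> V -> R) : Prop :=
  forall x, (return_prob q x < 1)%E.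

Definition recurrent (R : realType) (V : choiceType) (q : V -> V -> R) : Prop :=
  forall x, return_prob q x = 1%E.

Definition positive_recurrent (R : realType) (V : choiceType)
    (q : V -> V -> R) : Prop :=
  recurrent q /\ forall x, (mean_return_time q x < +oo)%E.

Definition tree_walk (R : realType) (V : choiceType) (adj : rel V)
    (q : V -> V -> R) : Prop :=
  [/\ forall s t, adj s t -> 0 < q s t,
      forall s t, ~~ adj s t -> q s t = 0 &
      forall s, \sum_(t \in [set t | adj s t]) q s t = 1].


Definition same_law d (T : measurableType d) (R : realType)
    (P : probability T R) (X Y : T -> R) : Prop :=
  forall B : set R, measurable B -> P (X @^-1` B) = P (Y @^-1` B).

Definition sigma_gen d (T : measurableType d) (R : realType) (I : Type)
    (D : set I) (X : I -> T -> R) : set (set T) :=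
  <<s [set E | exists i (B : set R),
        [/\ D i, measurable B & E = X i @^-1` B]] >>.

(* Mutual independence of the classes of events [G i], for [i] in [D]. *)
Definition independent_family d (T : measurableType d) (R : realType)
    (P : probability T R) (I : choiceType) (D : set I)
    (G : I -> set (set T)) : Prop :=
  forall (s : seq I) (E : I -> set T), uniq s ->
    (forall i, i \in s -> D i /\ G i (E i)) ->
    P (\bigcap_(i in [set` s]) E i) = (\prod_(i <- s) P (E i))%E.

Definition independent_classes d (T : measurableType d) (R : realType)
    (P : probability T R) (G H : set (set T)) : Prop :=
  forall E F, G E -> H F -> P (E `&` F) = (P E * P F)%E.

(* The variables A_s: a ratio of transition probabilities if |s| >= 2, and the
   auxiliary variable [a s] if |s| = 1. The value at the root is irrelevant. *)
Definition env_ratio (R : realType) (T : Type) (V : choiceType) (adj : rel V)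
    (o : V) (q : V -> V -> T -> R) (a : V -> T -> R) (s : V) (w : T) : R :=
  let u := parent adj o s in
  if (2 <= depth adj o s)%N then q u s w / q u (parent adj o u) w else a s w.

(* C_s; the sequence [spath adj o s] lists the t with 0 < t <= s. *)
Definition env_conductance (R : realType) (T : Type) (V : choiceType)
    (adj : rel V) (o : V) (q : V -> V -> T -> R) (a : V -> T -> R) (w : T)
    (s : V) : R :=
  \prod_(t <- spath adj o s) env_ratio adj o q a t w.

(* [q s t] is the transition probability from [s] to [t]. *)
Definition random_environment d (T : measurableType d) (R : realType)
    (P : probability T R) (V : choiceType) (adj : rel V) (o : V)
    (q : V -> V -> {RV P >-> R}) (a : V -> {RV P >-> R})
    (A : {RV P >-> R}) : Prop :=
  let lvl1 := [set s | depth adj o s = 1%N] in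
  [/\ {ae P, forall w, tree_walk adj (fun s t => q s t w)},
      independent_family P [set: V]
        (fun s => sigma_gen [set: V] (fun t => q s t : T -> R)),
      finite_set [set s | (2 <= depth adj o s)%N /\
        ~ same_law P (env_ratio adj o (fun u v => q u v) (fun u => a u) s) A],
      (forall s, lvl1 s -> same_law P (a s) A) /\
      independent_family P lvl1
        (fun s => sigma_gen [set s] (fun t => a t : T -> R)) &
      independent_classes P
        (sigma_gen [set: V * V] (fun st => q st.1 st.2 : T -> R))
        (sigma_gen lvl1 (fun s => a s : T -> R))].

(* The infimum is attained, as x |-> E[A^x] is lower semicontinuous on [0, 1],
   and it lies in [0, 1], as E[A^0] = 1. *)
Definition min_moment d (T : measurableType d) (R : realType)
    (P : probability T R) (A : {RV P >-> R}) : R :=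
  fine (ereal_inf [set 'E_P[(fun w => A w `^ x)%R]%E
                  | x in [set x : R | 0 <= x <= 1]]).

(* Below, [C s] is the weight of the edge between [parent s] and [s]. *)

(* The voltage when [o] is held at potential 1 and all vertices at distance
   [n.+1] from [o] are held at potential 0. *)
Definition unit_voltage (R : realType) (V : choiceType) (adj : rel V) (o : V)
    (C : V -> R) (n : nat) (v : V -> R) : Prop :=
  [/\ v o = 1,
      forall s, depth adj o s = n.+1 -> v s = 0 &
      forall s, (0 < depth adj o s <= n)%N ->
        C s * (v (parent adj o s) - v s) =
        \sum_(t \in [set t | child adj o s t]) C t * (v s - v t)].

Definition current_from_root (R : realType) (V : choiceType) (adj : rel V)
    (o : V) (C : V -> R) (v : V -> R) : R :=
  \sum_(t \in [set t | child adj o o t]) C t * (v o - v t).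

(* The effective conductance from [o] to infinity is the limit of the effective
   conductances from [o] to the vertices at distance n. *)
Definition is_effective_conductance (R : realType) (V : choiceType)
    (adj : rel V) (o : V) (C : V -> R) (g : R) : Prop :=
  exists v : nat -> V -> R, (forall n, unit_voltage adj o C n (v n)) /\
    (fun n => current_from_root adj o C (v n)) @ \oo --> g.

Definition positive_conductance (R : realType) (V : choiceType) (adj : rel V)
    (o : V) (C : V -> R) : Prop :=
  exists2 g : R, 0 < g & is_effective_conductance adj o C g.

Definition zero_conductance (R : realType) (V : choiceType) (adj : rel V)
    (o : V) (C : V -> R) : Prop :=
  is_effective_conductance adj o C 0.

Definition admits_flow (R : realType) (V : choiceType) (adj : rel V) (o : V)
    (C : V -> R) : Prop :=
  exists th : V -> R,
    [/\ forall s, s != o -> 0 <= th s <= C s,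
        exists2 s, s != o & th s != 0 &
        forall s, s != o -> th s = \sum_(t \in [set t | child adj o s t]) th t].

(* Main.v *)
Require Import Defs.
From HB Require Import structures.
From mathcomp Require Import all_boot all_order all_algebra finmap.
From mathcomp Require Import all_classical all_reals all_analysis.
From mathcomp Require Import measurable_realfun ring lra zify.
Set Implicit Arguments.
Unset Strict Implicit.
Unset Printing Implicit Defensive.
Import Order.TTheory GRing.Theory Num.Theory.
Import numFieldNormedType.Exports.
Local Open Scope classical_set_scope.
Local Open Scope ring_scope.

(* At a minimizer x of E[A^x] on [0, 1] one has E[C_s^x] <= K p^|s|, up to a
   random factor coming from the finitely many irregular edges.  Cutsets with
   small sum of p^|s| therefore have, almost surely, small sum of C_s^x, hence of
   C_s, as c <= c^x whenever c^x < 1.  So there is no flow; a positive effective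
   conductance would produce one (the unit voltage flow is bounded by C), and
   zero conductance means recurrence.  If p^|s| is summable then so is C_s, and
   the reversible measure of the walk is finite.

   For transience, pick 1/p < lam < br.  By Cramer's argument there is a class of
   words of K rounded values of A, all with the same product B, whose probability
   r satisfies r min(1, B) lam^K > 1.  By max-flow min-cut there is a flow of
   positive strength c bounded by lam^-|s|; restrict it to the vertices all of
   whose ancestral blocks of K edges spell words of the class, and divide by r^n.
   The result has mean strength c, and since two vertices are independent below
   their last common block, its variance and its energy are bounded uniformly in
   n, the variance being small when the blocks start far from the root.
   Thomson's principle then bounds the effective conductances from below with
   probability close to 1. *)

(** * Rooted trees *)

(** Ratios at siblings come from one transition vector and may be dependent, so independence is
    available only for edges with distinct parents. This suffices: the edges of one path have
    distinct parents, and if two paths have different ancestors at some level, the edges of one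
    below this level share no parent with edges of the other.

    Energy divides by C, so surviving paths need a lower bound on C that holds surely. Fixing the
    product B of the rounded-down ratios of a block gives it: after i blocks, C is at least a random
    constant times min(1, B)^i. The variance series then has ratio lam^-K / r and the energy series
    this ratio divided by min(1, B); the condition on the word class says that the latter is below
    1. With a finite alphabet the number of letter-count types is polynomial in the word length, so
    picking the best type replaces a change of measure.

    No zero-one law is used: the exceptional probability is made as small as desired by starting the
    blocks deep, where the flow through each vertex is small. The flows are built on finitely many
    levels only, since conductance bounds for infinitely many levels suffice. *)

Section Tree.
Variables (V : choiceType) (adj : rel V) (o : V).
Hypothesis (Htree : is_tree adj) (Hlf : locally_finite_graph adj).

Notation sp := (spath adj o).
Notation par := (parent adj o).
Notation dep := (depth adj o).
Notation chd := (child adj o).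

(** Shortening any walk from [o] to [s] yields the unique simple path [p], so no walk is shorter
    than [p]. A shortest walk contains all vertices of [p] and is no longer, hence it repeats no
    vertex. *)
Lemma spath_spec s : [/\ path adj o (sp s), last o (sp s) = s & uniq (o :: sp s)].
Proof.
case: Htree => _ _ /(_ o s)[p [[pp pl pu] puniq]].
have minp p' : path adj o p' -> last o p' = s -> (size p <= size p')%N.
  move=> p'p p'l; case/shortenP: p'p p'l => q qp qu qs ql.
  by rewrite (puniq q) //; apply: uniq_leq_size => //; case/andP: qu.
have [qp ql qmin] : [set p | [/\ path adj o p, last o p = s &
    forall p', path adj o p' -> last o p' = s -> (size p <= size p')%N]] (sp s).
  by apply: (@xgetI _ _ _ p).
split => //.
have : uniq (o :: sp s); last by [].
apply: (@leq_size_uniq _ (o :: p)) => //=; last by rewrite ltnS; apply: qmin.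
move=> x; rewrite !inE => /orP[->//|xp].
case/shortenP: (qp) ql => q qp' qu qs ql.
by rewrite qs ?orbT//; rewrite -(puniq q).
Qed.

Lemma spath_uniq s p : path adj o p -> last o p = s -> uniq (o :: p) -> p = sp s.
Proof.
move=> pp pl pu; case: Htree => _ _ /(_ o s)[q [_ quniq]].
have [h1 h2 h3] := spath_spec s.
by rewrite -(quniq p)// -(quniq (sp s)).
Qed.

Lemma spath_root : sp o = [::].
Proof. by apply/esym/spath_uniq. Qed.

Lemma depth_root : dep o = 0%N.
Proof. by rewrite /depth spath_root. Qed.

Lemma depth_eq0 s : (dep s == 0%N) = (s == o).
Proof.
apply/eqP/eqP => [/size0nil e|->]; last exact: depth_root.
by have [_ <- _] := spath_spec s; rewrite e.
Qed.

Lemma spath_prefix s t : t \in o :: sp s -> exists p, sp s = sp t ++ p.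
Proof.
have [pp pl pu] := spath_spec s => ts.
case/splitPl: ts pp pl pu => p1 p2 l1.
rewrite cat_path => /andP[h1 _] _; rewrite -cat_cons cat_uniq => /andP[h2 _].
by exists p2; rewrite -(spath_uniq (s := t) h1).
Qed.

Lemma childP s t : reflect (sp t = rcons (sp s) t) (chd s t).
Proof.
apply: (iffP andP) => [[st /eqP d]|e].
  have [p e] := spath_prefix st.
  move: d; rewrite /depth e size_cat -addn1 => /eqP; rewrite eqn_add2l.
  case: p e => [|x [|]]// e _; rewrite -cats1; congr (_ ++ [:: _]).
  by have [_ + _] := spath_spec t; rewrite e last_cat.
split; last by rewrite /depth e size_rcons.
rewrite /tle e; have [_ l _] := spath_spec s.
by have := mem_last o (sp s); rewrite l !inE mem_rcons inE => /orP[->//|->]; rewrite !orbT.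
Qed.

Lemma spath_parent s : s != o -> sp s = rcons (sp (par s)) s.
Proof.
move=> so; have [pp pl pu] := spath_spec s.
case/lastP e : (sp s) pp pl pu => [|p x]; first by move=> _ /esym/eqP; rewrite (negbTE so).
rewrite rcons_path last_rcons => /andP[pp px] xs; subst x.
rewrite -rcons_cons rcons_uniq => /andP[_ pu].
have pe : p = sp (last o p) by apply: spath_uniq.
have c : chd (last o p) s by apply/childP; rewrite e {1}pe.
have : chd (par s) s by apply: (@xgetI _ o [set t | chd t s] _ c).
by move/childP; rewrite e.
Qed.

Lemma depth_parentS s : s != o -> dep s = (dep (par s)).+1.
Proof. by move=> so; rewrite /depth (spath_parent so) size_rcons. Qed.

Lemma childE s t : chd s t = (t != o) && (par t == s).
Proof.
apply/childP/andP => [e|[to /eqP <-]]; last exact: spath_parent.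
have to : t != o.
  by apply/eqP => te; move: e; rewrite te spath_root; case: (sp s).
split=> //; have := spath_parent to; rewrite e => /rcons_inj[e'].
have [_ l _] := spath_spec (par t); have [_ l' _] := spath_spec s.
by rewrite -l -e' l'.
Qed.

Lemma parent_root : par o = o.
Proof.
by rewrite /parent xgetPN// => t /=; rewrite childE eqxx.
Qed.

Lemma depth_parent s : dep (par s) = (dep s).-1.
Proof.
have [->|so] := eqVneq s o; first by rewrite parent_root depth_root.
by rewrite (depth_parentS so).
Qed.

Lemma depth_anc k s : dep (iter k par s) = (dep s - k)%N.
Proof. by elim: k => [|k IH]; rewrite ?subn0//= depth_parent IH subnS. Qed.

Lemma adj_sym : symmetric adj. Proof. by case: Htree. Qed.

Lemma adj_parent s : s != o -> adj (par s) s.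
Proof.
move=> so; have [+ _ _] := spath_spec s.
rewrite (spath_parent so) rcons_path => /andP[_].
by have [_ -> _] := spath_spec (par s).
Qed.

(** If [t] is off the path to [s], appending [t] to that path stays simple. If [t] is on it, then
    [s] is not on the path to [t], and appending [s] to the latter gives the path to [s]. *)
Lemma adjE s t : adj s t = chd s t || chd t s.
Proof.
apply/idP/orP => [st|]; last first.
  by case; rewrite childE => /andP[h /eqP <-]; rewrite 1?adj_sym ?adj_parent // adj_sym adj_parent.
have [ps ls us] := spath_spec s; have [pt lt ut] := spath_spec t.
have [ts|ts] := boolP (t \in o :: sp s); last first.
  left; apply/childP/esym/spath_uniq; rewrite ?last_rcons//.
    by rewrite rcons_path ps ls.
  by rewrite -rcons_cons rcons_uniq ts.
right; apply/childP/esym/spath_uniq; rewrite ?last_rcons//.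
  by rewrite rcons_path pt lt adj_sym.
rewrite -rcons_cons rcons_uniq ut andbT.
have [p e] := spath_prefix ts.
apply/negP => st'; move: us; rewrite e -cat_cons cat_uniq => /and3P[_ /hasPn hp _].
case: p e hp => [|x p] e hp.
  have e' : s = t by rewrite -ls -lt e cats0.
  by move: st; rewrite e'; case: Htree => _ /(_ t) ->.
have : s \in x :: p by rewrite -ls e last_cat /= mem_last.
by move/hp; rewrite st'.
Qed.

Definition ch (s : V) : seq V := fset_set [set t | chd s t].

Lemma finite_children s : finite_set [set t | chd s t].
Proof.
by apply: (sub_finite_set _ (Hlf s)) => t /= c; rewrite adjE c.
Qed.

Lemma mem_ch s t : (t \in ch s) = chd s t.
Proof.
rewrite /ch in_fset_set; last exact: finite_children.
by apply/idP/idP => [/set_mem|h]; last exact/mem_set.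
Qed.

Lemma ch_uniq s : uniq (ch s).
Proof. exact: fset_uniq. Qed.

Lemma fsum_ch (M : nmodType) (s : V) (f : V -> M) :
  \sum_(t \in [set t | chd s t]) f t = \sum_(t <- ch s) f t.
Proof. by rewrite fsbig_finite//; exact: finite_children. Qed.

Lemma ch_neq_root s t : t \in ch s -> t != o.
Proof. by rewrite mem_ch childE => /andP[]. Qed.

Lemma ch_parent s t : t \in ch s -> par t = s.
Proof. by rewrite mem_ch childE => /andP[_ /eqP]. Qed.

Lemma ch_depth s t : t \in ch s -> dep t = (dep s).+1.
Proof.
by move=> ts; rewrite depth_parentS ?(ch_neq_root ts)// (ch_parent ts).
Qed.

Lemma in_ch_parent s : s != o -> s \in ch (par s).
Proof. by move=> so; rewrite mem_ch childE so eqxx. Qed.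

Lemma fsum_adj (M : nmodType) (s : V) (f : V -> M) :
  \sum_(t \in [set t | adj s t]) f t =
  (if s == o then 0 else f (par s)) + \sum_(t <- ch s) f t.
Proof.
have -> : [set t | adj s t] = [set` (if s == o then [::] else [:: par s]) ++ ch s].
  have e t : adj s t = (t \in (if s == o then [::] else [:: par s]) ++ ch s).
    rewrite adjE mem_cat mem_ch [chd t s]childE orbC.
    by case: (eqVneq s o) => //= _; rewrite inE eq_sym.
  by apply/seteqP; split => t /=; rewrite e.
rewrite -fsbig_seq ?big_cat/=.
  by case: eqP; rewrite ?big_nil ?big_cons ?big_nil ?addr0.
rewrite cat_uniq ch_uniq andbT; apply/andP; split; first by case: eqP.
apply/hasPn => t tc; apply/negP; case: (eqVneq s o) => //= so; rewrite inE => /eqP tp.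
by move: (ch_depth tc); rewrite tp depth_parent; lia.
Qed.

Fixpoint lev (n : nat) : seq V :=
  if n is n'.+1 then flatten (map ch (lev n')) else [:: o].

Lemma mem_lev n s : (s \in lev n) = (dep s == n).
Proof.
elim: n s => [|n IH] s /=; first by rewrite inE depth_eq0.
apply/flatten_mapP/eqP => [[t]|e].
  by rewrite IH => /eqP <- /ch_depth.
have so : s != o by rewrite -depth_eq0 e.
exists (par s); last exact: in_ch_parent.
by rewrite IH depth_parent e.
Qed.

Lemma lev_uniq n : uniq (lev n).
Proof.
elim: n => //= n IH; elim: (lev n) IH => //= s l IHl /andP[sl ul].
rewrite cat_uniq ch_uniq IHl// andbT /=.
apply/hasPn => t /flatten_mapP[s' s'l ts']; apply/negP => ts.
by move: sl; rewrite -(ch_parent ts) (ch_parent ts') s'l.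
Qed.

Lemma sum_lev (M : nmodType) n (f : V -> M) :
  \sum_(t <- lev n.+1) f t = \sum_(s <- lev n) \sum_(t <- ch s) f t.
Proof. by rewrite /= big_flatten big_map. Qed.

(** A step up would return to the vertex just left, which injectivity forbids. *)
Lemma ray_child (x : nat -> V) : x 0%N = o -> (forall n, adj (x n) (x n.+1)) ->
  injective x -> forall n, x n.+1 \in ch (x n).
Proof.
move=> x0 xa xi n; rewrite mem_ch; elim: n => [|n IH].
  by have := xa 0%N; rewrite adjE => /orP[//|]; rewrite x0 childE eqxx.
have := xa n.+1; rewrite adjE => /orP[//|].
move: IH; rewrite !childE => /andP[_ /eqP e] /andP[_ /eqP e'].
by have /xi/eqP := etrans (esym e) e'; rewrite -[X in X == _]addn0 -addn2 eqn_add2l.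
Qed.

Lemma child_ray (x : nat -> V) : x 0%N = o -> (forall n, x n.+1 \in ch (x n)) ->
  (forall n, adj (x n) (x n.+1)) /\ injective x.
Proof.
move=> x0 xc; split => [n|]; first by rewrite adjE -mem_ch xc.
have xd n : dep (x n) = n.
  by elim: n => [|n IH]; rewrite ?x0 ?depth_root// (ch_depth (xc n)) IH.
by move=> m n e; rewrite -(xd m) e xd.
Qed.

Lemma anc_lev k n s : s \in lev (k + n) -> iter k par s \in lev n.
Proof. by rewrite !mem_lev depth_anc => /eqP ->; rewrite addKn. Qed.

Lemma spath_mem_neq_root s t : t \in sp s -> t != o.
Proof.
move=> ts; apply/eqP => e; have [_ _ /=] := spath_spec s.
by rewrite e in ts; rewrite ts.
Qed.

Lemma spath_self s : s != o -> s \in sp s.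
Proof. by move=> so; rewrite (spath_parent so) mem_rcons mem_head. Qed.

Lemma mem_spath_parent s t : s != o -> (t \in sp s) = (t == s) || (t \in sp (par s)).
Proof. by move=> so; rewrite (spath_parent so) mem_rcons inE. Qed.

Lemma spath_mem_depth s t : t \in sp s -> (dep t <= dep s)%N.
Proof.
move=> ts; have [|p e] := @spath_prefix s t; first by rewrite inE ts orbT.
by rewrite /depth e size_cat leq_addr.
Qed.

Lemma spath_mem_anc s t : t \in sp s -> t = iter (dep s - dep t) par s.
Proof.
elim/ltn_ind: {s}(dep s) {-2}s (erefl (dep s)) => n IH s sn ts.
have so : s != o by apply/eqP => e; move: ts; rewrite e spath_root.
move: ts; rewrite mem_spath_parent// => /orP[/eqP ->|ts]; first by rewrite sn subnn.
have := depth_parentS so => e; rewrite sn in e.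
have := IH (dep (par s)) _ _ erefl ts; rewrite e leqnn => /(_ isT) {1}->.
by rewrite sn e subSn ?iterSr// spath_mem_depth.
Qed.

Fixpoint tball (n : nat) : seq V := if n is n'.+1 then tball n' ++ lev n else lev 0.

Lemma mem_ball n s : (s \in tball n) = (dep s <= n)%N.
Proof.
elim: n => [|n IH]; first by rewrite -[tball 0]/(lev 0) mem_lev leqn0.
by rewrite -[tball n.+1]/(tball n ++ lev n.+1) mem_cat IH mem_lev [RHS]leq_eqVlt orbC.
Qed.

Lemma ball_uniq n : uniq (tball n).
Proof.
elim: n => //= n IH; rewrite cat_uniq IH (lev_uniq n.+1) andbT/=.
by apply/hasPn => s; rewrite (mem_lev n.+1) mem_ball => /eqP ->; rewrite ltnn.
Qed.

Lemma sum_ball (M : nmodType) n (f : V -> M) :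
  \sum_(s <- tball n) f s = \sum_(0 <= i < n.+1) \sum_(s <- lev i) f s.
Proof.
elim: n => [|n IH]; first by rewrite big_nat1.
by rewrite -[tball n.+1]/(tball n ++ lev n.+1) big_cat IH [RHS]big_nat_recr.
Qed.

Lemma depth_adj s t : adj s t -> (dep t <= (dep s).+1)%N.
Proof.
rewrite adjE => /orP[]; rewrite -mem_ch => /ch_depth ->//.
by rewrite ltnW// ltnW.
Qed.

End Tree.

(** * Effective conductance and Thomson's principle *)

(** Cauchy-Schwarz without square roots: [2xy] is at most [af + be] because its square is at most
    [4(ae)(bf)]. *)
Lemma cauchy_schwarz2 (R : realFieldType) (x y a b e f : R) :
  0 <= a -> 0 <= b -> 0 <= e -> 0 <= f -> x ^+ 2 <= a * e -> y ^+ 2 <= b * f ->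
  (x + y) ^+ 2 <= (a + b) * (e + f).
Proof.
move=> a0 b0 e0 f0 xa yb.
suff : 2 * (x * y) <= a * f + b * e by move: xa yb; rewrite !expr2; lra.
rewrite leNgt; apply/negP => h.
have k0 : 0 <= a * f + b * e by rewrite addr_ge0 ?mulr_ge0.
have : (a * f + b * e) ^+ 2 < (2 * (x * y)) ^+ 2 by rewrite ltrXn2r ?nnegrE// (le_trans k0)// ltW.
have : x ^+ 2 * y ^+ 2 <= (a * e) * (b * f) by rewrite ler_pM ?sqr_ge0.
have : 0 <= (a * f - b * e) ^+ 2 by exact: sqr_ge0.
rewrite !expr2; lra.
Qed.

Lemma cauchy_schwarz_sum (R : realFieldType) (I : eqType) (r : seq I) (x a e : I -> R) :
  (forall i, i \in r -> [/\ 0 <= a i, 0 <= e i & x i ^+ 2 <= a i * e i]) ->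
  (\sum_(i <- r) x i) ^+ 2 <= (\sum_(i <- r) a i) * (\sum_(i <- r) e i).
Proof.
elim: r => [|i r IH] h; first by rewrite !big_nil expr2 mulr0.
have [a0 e0 xae] := h i (mem_head _ _).
have h' j : j \in r -> [/\ 0 <= a j, 0 <= e j & x j ^+ 2 <= a j * e j].
  by move=> jr; apply: h; rewrite inE jr orbT.
rewrite !big_cons; apply: cauchy_schwarz2 => //; last exact: IH.
  by rewrite big_seq sumr_ge0// => j /h' [].
by rewrite big_seq sumr_ge0// => j /h' [].
Qed.

Lemma cvg_sum_seq (R : realType) (I : Type) (r : seq I) (f : I -> nat -> R) (a : I -> R) :
  (forall i, f i @ \oo --> a i) ->
  (fun n => \sum_(i <- r) f i n) @ \oo --> \sum_(i <- r) a i.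
Proof.
move=> fa; elim: r => [|i r IH].
  by rewrite big_nil; under eq_fun do rewrite big_nil; exact: cvg_cst.
by rewrite big_cons; under eq_fun do rewrite big_cons; exact: cvgD.
Qed.

Section Network.
Variables (R : realType) (V : choiceType) (adj : rel V) (o : V).
Hypothesis (Htree : is_tree adj) (Hlf : locally_finite_graph adj).
Variable C : V -> R.
Hypothesis C_gt0 : forall s, s != o -> 0 < C s.

Notation sp := (spath adj o).
Notation par := (parent adj o).
Notation dep := (depth adj o).
Notation ch := (ch adj o).
Notation lev := (lev adj o).

(* Effective conductance from [parent s] through [s] to the vertices [m] levels
   below [s]. *)
Fixpoint branch_cond (m : nat) (s : V) : R :=
  if m is m'.+1 then
    let S := \sum_(t <- ch s) branch_cond m' t in C s * S / (C s + S)
  else C s.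

Definition out_cond m s : R := \sum_(t <- ch s) branch_cond m t.

Lemma branch_condS m s :
  branch_cond m.+1 s = C s * out_cond m s / (C s + out_cond m s).
Proof. by []. Qed.

Lemma branch_cond_ge0 m s : s != o -> 0 <= branch_cond m s.
Proof.
elim: m s => [|m IH] s so; first exact/ltW/C_gt0.
have S0 : 0 <= out_cond m s.
  by rewrite /out_cond big_seq sumr_ge0// => t /(ch_neq_root Htree Hlf); apply: IH.
by rewrite branch_condS divr_ge0 ?mulr_ge0 ?addr_ge0// ltW// C_gt0.
Qed.

Lemma out_cond_ge0 m s : 0 <= out_cond m s.
Proof.
by rewrite /out_cond big_seq sumr_ge0// => t /(ch_neq_root Htree Hlf); apply: branch_cond_ge0.
Qed.

Lemma out_cond_gt0 m s : s != o -> 0 < C s + out_cond m s.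
Proof. by move=> so; rewrite ltr_pwDl ?C_gt0// out_cond_ge0. Qed.

Lemma branch_cond_le m s : s != o -> branch_cond m s <= C s.
Proof.
case: m => [|m] so//; rewrite branch_condS ler_pdivrMr ?out_cond_gt0//.
by rewrite ler_wpM2l ?(ltW (C_gt0 so))// lerDr ltW// C_gt0.
Qed.

Lemma out_cond_le_of m n s :
  (forall t, t != o -> branch_cond m t <= branch_cond n t) -> out_cond m s <= out_cond n s.
Proof.
move=> h; rewrite /out_cond big_seq [leRHS]big_seq ler_sum// => t.
by move=> /(ch_neq_root Htree Hlf)/h.
Qed.

Lemma branch_cond_le_succ m s : s != o -> branch_cond m.+1 s <= branch_cond m s.
Proof.
elim: m s => [|m IH] s so; first exact: branch_cond_le.
have h : out_cond m.+1 s <= out_cond m s by exact: out_cond_le_of.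
rewrite (branch_condS m.+1) (branch_condS m).
rewrite ler_pdivrMr ?out_cond_gt0// mulrAC ler_pdivlMr ?out_cond_gt0//.
have : 0 <= C s * C s * (out_cond m s - out_cond m.+1 s).
  by rewrite !mulr_ge0 ?subr_ge0 ?(ltW (C_gt0 so)).
lra.
Qed.

Lemma out_cond_le_succ m s : out_cond m.+1 s <= out_cond m s.
Proof. by apply: out_cond_le_of => t; exact: branch_cond_le_succ. Qed.

(** Voltage-divider rule: the edge above [t], in series with the conductance below [t], leaves this
    fraction of the potential of the parent. *)
Definition volt n s : R :=
  if (dep s <= n)%N then \prod_(t <- sp s) (C t / (C t + out_cond (n - dep t) t)) else 0.

Lemma volt_root n : volt n o = 1.
Proof. by rewrite /volt depth_root// spath_root// big_nil. Qed.

Lemma volt_parent n s : s != o -> (dep s <= n)%N ->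
  volt n s = volt n (par s) * (C s / (C s + out_cond (n - dep s) s)).
Proof.
move=> so sn; rewrite /volt sn depth_parent// (leq_trans (leq_pred _) sn).
by rewrite (spath_parent Htree so) -cats1 big_cat big_seq1.
Qed.

Lemma ratio01 m s : s != o -> 0 <= C s / (C s + out_cond m s) <= 1.
Proof.
move=> so; rewrite divr_ge0 ?(ltW (C_gt0 so)) ?(ltW (out_cond_gt0 _ _))//=.
by rewrite ler_pdivrMr ?out_cond_gt0// mul1r lerDl out_cond_ge0.
Qed.

Lemma volt_ge0 n s : 0 <= volt n s.
Proof.
rewrite /volt; case: ifP => // _; rewrite big_seq prodr_ge0// => t.
by move=> /(spath_mem_neq_root Htree)/(ratio01 (n - dep t))/andP[].
Qed.

Lemma volt_le_parent n s : volt n s <= volt n (par s).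
Proof.
have [->|so] := eqVneq s o; first by rewrite parent_root.
have [sn|sn] := leqP (dep s) n; last by rewrite {1}/volt leqNgt sn volt_ge0.
by rewrite volt_parent// ler_piMr ?volt_ge0//; case/andP: (ratio01 (n - dep s) so).
Qed.

Lemma volt_le1 n s : volt n s <= 1.
Proof.
elim: {s}(dep s) {-2}s (erefl (dep s)) => [|k IH] s e.
  by move/eqP: e; rewrite depth_eq0// => /eqP ->; rewrite volt_root.
by apply: (le_trans (volt_le_parent n s)); apply: IH; rewrite depth_parent// e.
Qed.

Lemma volt_current n s : s != o -> (dep s <= n.+1)%N ->
  C s * (volt n (par s) - volt n s) = volt n (par s) * branch_cond (n.+1 - dep s) s.
Proof.
move=> so; rewrite leq_eqVlt => /orP[/eqP e|sn].
  rewrite e subnn /= [volt n s]/volt e ltnn subr0 mulrC //.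
rewrite ltnS in sn; rewrite subSn// branch_condS (volt_parent so sn).
have := out_cond_gt0 (n - dep s) so.
by move: (volt _ _) (C s) (out_cond _ _) => v c S cS; field; rewrite gt_eqF.
Qed.

Lemma volt_out n s : s != o -> (dep s <= n)%N ->
  volt n s * out_cond (n - dep s) s = volt n (par s) * branch_cond (n.+1 - dep s) s.
Proof.
move=> so sn; rewrite subSn// branch_condS (volt_parent so sn).
have := out_cond_gt0 (n - dep s) so.
by move: (volt _ _) (C s) (out_cond _ _) => v c S cS; field; rewrite gt_eqF.
Qed.

Lemma volt_harmonic n s : s != o -> (dep s <= n)%N ->
  C s * (volt n (par s) - volt n s) = \sum_(t <- ch s) C t * (volt n s - volt n t).
Proof.
move=> so sn; rewrite volt_current//; last exact: leqW.
rewrite -volt_out// /out_cond mulr_sumr; apply: eq_big_seq => t ts.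
have to := ch_neq_root Htree Hlf ts; have tp := ch_parent Htree Hlf ts.
have td := ch_depth Htree Hlf ts.
rewrite -[in RHS]tp volt_current ?td//; by rewrite subSS tp.
Qed.

Lemma volt_unit n : unit_voltage adj o C n (volt n).
Proof.
split; first exact: volt_root.
  by move=> s e; rewrite /volt e ltnn.
move=> s /andP[s0 sn]; rewrite fsum_ch//; apply: volt_harmonic => //.
by rewrite -(depth_eq0 _ Htree) -lt0n.
Qed.

Lemma volt_current_root n : current_from_root adj o C (volt n) = out_cond n o.
Proof.
rewrite /current_from_root fsum_ch// /out_cond; apply: eq_big_seq => t ts.
have to := ch_neq_root Htree Hlf ts; have tp := ch_parent Htree Hlf ts.
have := ch_depth Htree Hlf ts; rewrite depth_root// => td.
by have := volt_current (n := n) to; rewrite td tp volt_root mul1r subn1 => ->.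
Qed.

(** Moving the grounded level away lowers every conductance below a vertex, hence raises every
    factor of the voltage. *)
Lemma volt_le_succ n s : volt n s <= volt n.+1 s.
Proof.
elim: {s}(dep s) {-2}s (erefl (dep s)) => [|k IH] s e.
  by move/eqP: e; rewrite depth_eq0// => /eqP ->; rewrite !volt_root.
have so : s != o by rewrite -(depth_eq0 _ Htree) e.
have [sn|sn] := leqP (dep s) n; last by rewrite {1}/volt leqNgt sn volt_ge0.
rewrite (volt_parent so sn) (volt_parent so (leqW sn)).
have /andP[h _] := ratio01 (n - dep s) so.
apply: ler_pM; rewrite ?volt_ge0//; first by apply: IH; rewrite depth_parent// e.
rewrite ler_wpM2l ?(ltW (C_gt0 so))// lef_pV2 ?posrE ?out_cond_gt0//.
by rewrite lerD2l subSn// out_cond_le_succ.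
Qed.

Lemma volt_le m n s : (m <= n)%N -> volt m s <= volt n s.
Proof. by move=> mn; apply: (homo_leq (f := volt^~ s) (r := <=%R)) => // [?|?]; [exact: le_trans|exact: volt_le_succ]. Qed.

Definition voltage s : R := limn (volt^~ s).

Lemma voltage_cvg s : volt^~ s @ \oo --> voltage s.
Proof.
apply: nondecreasing_is_cvgn; first by move=> m n; exact: volt_le.
by exists 1 => _ [n _ <-]; exact: volt_le1.
Qed.

Lemma voltage_root : voltage o = 1.
Proof.
apply/cvg_lim => //; rewrite (_ : volt^~ o = cst 1); first exact: cvg_cst.
by apply/funext => n; exact: volt_root.
Qed.

Lemma voltage_ge0 s : 0 <= voltage s.
Proof.
by apply: limr_ge; [apply/cvg_ex; eexists; exact: voltage_cvg|near=> n; exact: volt_ge0].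
Unshelve. all: by end_near. Qed.

Lemma voltage_le1 s : voltage s <= 1.
Proof.
by apply: limr_le; [apply/cvg_ex; eexists; exact: voltage_cvg|near=> n; exact: volt_le1].
Unshelve. all: by end_near. Qed.

Lemma voltage_le_parent s : voltage s <= voltage (par s).
Proof.
apply: ler_lim; first by apply/cvg_ex; eexists; exact: voltage_cvg.
  by apply/cvg_ex; eexists; exact: voltage_cvg.
by near=> n; exact: volt_le_parent.
Unshelve. all: by end_near. Qed.

Lemma voltage_harmonic s : s != o ->
  C s * (voltage (par s) - voltage s) = \sum_(t <- ch s) C t * (voltage s - voltage t).
Proof.
move=> so.
have h1 : (fun n => C s * (volt n (par s) - volt n s)) @ \oo -->
    C s * (voltage (par s) - voltage s).
  by apply: cvgMl_tmp; apply: cvgB; exact: voltage_cvg.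
have h2 : (fun n => \sum_(t <- ch s) C t * (volt n s - volt n t)) @ \oo -->
    \sum_(t <- ch s) C t * (voltage s - voltage t).
  apply: cvg_sum_seq => t.
  by apply: cvgMl_tmp; apply: cvgB; exact: voltage_cvg.
apply: (cvg_unique (@norm_hausdorff _ _) h1); apply: (cvg_trans _ h2); apply: near_eq_cvg.
by near=> n; rewrite volt_harmonic//; near: n; exact: nbhs_infty_ge.
Unshelve. all: by end_near. Qed.

Lemma conductance_cvg :
  out_cond^~ o @ \oo --> \sum_(t <- ch o) C t * (1 - voltage t).
Proof.
rewrite (_ : out_cond^~ o = fun n => \sum_(t <- ch o) C t * (1 - volt n t)).
  apply: cvg_sum_seq => t.
  by apply: cvgMl_tmp; apply: cvgB; [exact: cvg_cst|exact: voltage_cvg].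
apply/funext => n; rewrite -volt_current_root /current_from_root fsum_ch//.
by rewrite volt_root.
Qed.

Lemma effective_conductance :
  is_effective_conductance adj o C (\sum_(t <- ch o) C t * (1 - voltage t)).
Proof.
exists volt; split; first exact: volt_unit.
by under eq_fun do rewrite volt_current_root; exact: conductance_cvg.
Qed.

Lemma voltage1_zero_conductance : (forall s, voltage s = 1) -> zero_conductance adj o C.
Proof.
move=> h; have := effective_conductance; rewrite big1// => t _.
by rewrite h subrr mulr0.
Qed.

(** The limiting current is a flow. It respects the capacities since a voltage drop along an edge is
    at most 1, and it is nonzero since otherwise the voltage would be 1 everywhere. *)
Lemma voltage1_or_flow : (exists s, voltage s < 1) -> admits_flow adj o C.
Proof.
move=> [s s1]; exists (fun t => C t * (voltage (par t) - voltage t)); split.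
- move=> t to; have C0 := C_gt0 to; apply/andP; split.
    by rewrite mulr_ge0 ?(ltW C0)// subr_ge0 voltage_le_parent.
  rewrite ger_pMr//; have := voltage_ge0 t; have := voltage_le1 (par t); lra.
- apply: contrapT => h.
  have {}h t : voltage t = voltage (par t).
    have [->|to] := eqVneq t o; first by rewrite parent_root.
    apply: contrapT => /eqP tp; apply: h; exists t => //.
    by apply: mulf_neq0; [rewrite gt_eqF ?C_gt0|rewrite subr_eq0 eq_sym; exact: tp].
  suff e t : voltage t = 1 by rewrite e ltxx in s1.
  elim: {t}(dep t) {-2}t (erefl (dep t)) => [|k IH] t e.
    by move/eqP: e; rewrite depth_eq0// => /eqP ->; rewrite voltage_root.
  by rewrite h; apply: IH; rewrite depth_parent// e.
- move=> t to; rewrite fsum_ch// voltage_harmonic//; apply: eq_big_seq => u ut.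
  by rewrite (ch_parent Htree Hlf ut).
Qed.

(** The conductances converge, so a bound along infinitely many [n] passes to the limit; the
    probabilistic estimate provides just such a subsequence. *)
Lemma positive_conductance_of_frequently (d : R) : 0 < d ->
  (forall m, exists2 n, (m <= n)%N & d <= out_cond n o) ->
  positive_conductance adj o C /\ exists s, voltage s < 1.
Proof.
move=> d0 h; set g := \sum_(t <- ch o) C t * (1 - voltage t).
have dg : d <= g.
  rewrite leNgt; apply/negP => gd.
  have [m _ hm] := cvgr_lt g conductance_cvg _ gd.
   have [n mn dn] := h m.
  by have := hm n mn; rewrite /= ltNge dn.
split; first by exists g; [exact: lt_le_trans dg|exact: effective_conductance].
apply: contrapT => hv; move: dg; rewrite leNgt => /negP; apply.
rewrite /g big1// => t _; have [t1|t1] := ltP (voltage t) 1.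
  by exfalso; apply: hv; exists t.
by have -> : voltage t = 1; [apply/le_anti; rewrite voltage_le1|rewrite subrr mulr0].
Qed.

Section Thomson.
Variables (N : nat) (th : V -> R).
Hypothesis th_flow : forall s, (dep s < N)%N -> th s = \sum_(t <- ch s) th t.

Fixpoint branch_energy (m : nat) (s : V) : R :=
  th s ^+ 2 / C s + if m is m'.+1 then \sum_(t <- ch s) branch_energy m' t else 0.

Lemma branch_energy_ge0 m s : s != o -> 0 <= branch_energy m s.
Proof.
elim: m s => [|m IH] s so /=; rewrite addr_ge0 ?divr_ge0 ?sqr_ge0 ?(ltW (C_gt0 so))//.
by rewrite big_seq sumr_ge0// => t /(ch_neq_root Htree Hlf); exact: IH.
Qed.

(** Induction from the bottom: parallel branches combine by Cauchy-Schwarz, and the edge above [s]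
    adds [1 / C s] to the resistance and [th s ^+ 2 / C s] to the energy. *)
Lemma branch_thomson m s : s != o -> (dep s + m = N)%N ->
  th s ^+ 2 <= branch_cond m s * branch_energy m s.
Proof.
elim: m s => [|m IH] s so e.
  by rewrite /= addr0 mulrC divfK// gt_eqF// C_gt0.
have h : th s ^+ 2 <= out_cond m s * \sum_(t <- ch s) branch_energy m t.
  rewrite th_flow; last by rewrite -e addnS ltnS leq_addr.
  apply: cauchy_schwarz_sum => t ts; have to := ch_neq_root Htree Hlf ts.
  rewrite branch_cond_ge0// branch_energy_ge0//; split=> //; apply: IH => //.
  by rewrite (ch_depth Htree Hlf ts) -e addSnnS.
rewrite branch_condS [branch_energy _ _]/=.
move: h (out_cond_gt0 m so) (out_cond_ge0 m s) (C_gt0 so).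
move: (th s) (out_cond _ _) (C s) (bigop _ _ _) => x S c E h cS S0 c0.
have -> : c * S / (c + S) * (x ^+ 2 / c + E) = (S * x ^+ 2 + c * (S * E)) / (c + S).
  by field; rewrite !gt_eqF.
rewrite ler_pdivlMr// mulrDr addrC mulrC lerD2l mulrC ler_wpM2l//; exact: ltW.
Qed.

Lemma branch_energy_levels m l : \sum_(s <- lev l) branch_energy m s =
  \sum_(l <= j < l + m.+1) \sum_(s <- lev j) th s ^+ 2 / C s.
Proof.
elim: m l => [|m IH] l /=.
  by rewrite addn1 big_nat1; apply: eq_bigr => s _; rewrite addr0.
rewrite big_split/= -(sum_lev _ _ l (branch_energy m)) IH addSnnS.
by rewrite [in RHS]big_ltn// addnS ltnS leq_addr.
Qed.

Lemma thomson n : N = n.+1 -> th o ^+ 2 <= out_cond n o *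
  \sum_(1 <= j < n.+2) \sum_(s <- lev j) th s ^+ 2 / C s.
Proof.
move=> Nn; rewrite -[n.+2]add1n -branch_energy_levels th_flow ?depth_root ?Nn//.
rewrite sum_lev big_seq1; apply: cauchy_schwarz_sum => t ts.
have to := ch_neq_root Htree Hlf ts.
rewrite branch_cond_ge0// branch_energy_ge0//; split=> //; apply: branch_thomson => //.
by rewrite (ch_depth Htree Hlf ts) depth_root// Nn add1n.
Qed.

End Thomson.

End Network.

(** * Recurrence, transience and return times *)

Lemma seq_argmax (R : realDomainType) (T : eqType) (f : T -> R) (r : seq T) :
  r != [::] -> exists2 m, m \in r & forall s, s \in r -> f s <= f m.
Proof.
elim: r => // x [|y r] IH _; first by exists x => [|s]; rewrite ?mem_head// inE => /eqP ->.
have [//|m mr hm] := IH; have [xm|mx] := leP (f x) (f m).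
  exists m; first by rewrite inE mr orbT.
  by move=> s; rewrite inE => /orP[/eqP ->//|/hm].
exists x; first exact: mem_head.
by move=> s; rewrite inE => /orP[/eqP ->//|/hm h]; apply: (le_trans h); exact: ltW.
Qed.

Section Chain.
Variables (R : realType) (V : choiceType) (adj : rel V) (o : V).
Hypothesis (Htree : is_tree adj) (Hlf : locally_finite_graph adj).
Variable q : V -> V -> R.
Hypothesis Hq : tree_walk adj q.

Notation par := (parent adj o).
Notation dep := (depth adj o).
Notation ch := (ch adj o).
Notation lev := (lev adj o).
Notation tball := (tball adj o).

Definition nb (s : V) : seq V := fset_set [set t | adj s t].

Lemma mem_nb s t : (t \in nb s) = adj s t.
Proof.
rewrite /nb in_fset_set; last exact: Hlf.
by apply/idP/idP => [/set_mem|h]; last exact/mem_set.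
Qed.

Lemma nb_uniq s : uniq (nb s). Proof. exact: fset_uniq. Qed.

Lemma q_gt0 s t : t \in nb s -> 0 < q s t.
Proof. by rewrite mem_nb; case: Hq => h _ _ /h. Qed.

Lemma q_ge0 s t : 0 <= q s t.
Proof.
have [/q_gt0/ltW//|] := boolP (t \in nb s).
by rewrite mem_nb; case: Hq => _ h _ /h ->.
Qed.

Lemma q_eq0 s t : t \notin nb s -> q s t = 0.
Proof. by rewrite mem_nb; case: Hq => _ h _ /h ->. Qed.

Lemma sum_q s : \sum_(t <- nb s) q s t = 1.
Proof. by case: Hq => _ _ /(_ s); rewrite fsbig_finite. Qed.

Lemma sum_nb (M : nmodType) s (f : V -> M) : \sum_(t <- nb s) f t =
  (if s == o then 0 else f (par s)) + \sum_(t <- ch s) f t.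
Proof. by rewrite -fsum_adj// fsbig_finite. Qed.

Lemma sum_nb_superset (r : seq V) (P : pred V) s (f : V -> R) :
  uniq r -> {subset nb s <= r} ->
  \sum_(t <- nb s | P t) q s t * f t = \sum_(t <- r | P t) q s t * f t.
Proof.
move=> ur sr; rewrite [RHS](bigID (mem (nb s)))/= [X in _ = _ + X]big1 ?addr0.
  rewrite -[LHS]big_filter -[RHS]big_filter; apply: perm_big.
  apply: uniq_perm; rewrite ?filter_uniq ?nb_uniq// => t.
  by rewrite !mem_filter; case: (boolP (t \in nb s)) => [/sr ->|_]; rewrite ?andbT ?andbF.
by move=> t /andP[_ /q_eq0 ->]; rewrite mul0r.
Qed.

Lemma sum_q_le1 (r : seq V) s : uniq r -> \sum_(t <- r) q s t <= 1.
Proof.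
move=> ur; rewrite -(sum_q s) (bigID (mem (nb s)))/= [X in _ + X]big1 ?addr0; last first.
  by move=> t; exact: q_eq0.
rewrite [leRHS](bigID (mem r))/= -[X in X <= _]big_filter -[X in _ <= X + _]big_filter.
rewrite (perm_big [seq t <- nb s | t \in r]).
  by rewrite lerDl sumr_ge0// => t _; exact: q_ge0.
by apply: uniq_perm; rewrite ?filter_uniq ?nb_uniq// => t; rewrite !mem_filter andbC.
Qed.

(** Maximum principle: the weights are positive and sum to 1, so an average that reaches the upper
    bound leaves no value below it. *)
Lemma avg_extremal s (g : V -> R) M : (forall t, t \in nb s -> g t <= M) ->
  M <= \sum_(t <- nb s) q s t * g t -> forall t, t \in nb s -> g t = M.
Proof.
move=> gM h t ts; apply/eqP; rewrite eq_le gM//= leNgt; apply/negP => lt.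
move: h; rewrite leNgt => /negP; apply.
rewrite -[ltRHS]mul1r -(sum_q s) mulr_suml.
rewrite (bigD1_seq t)//= ?nb_uniq// [ltRHS](bigD1_seq t)//= ?nb_uniq//.
apply: ltr_leD; first by rewrite ltr_pM2l// q_gt0.
rewrite big_seq_cond [leRHS]big_seq_cond ler_sum// => u /andP[us _].
by rewrite ler_wpM2l ?q_ge0 ?gM.
Qed.

(** Propagation out of [y] is not demanded, so harmonicity may fail at the target. *)
Lemma connected_propagate (Q : V -> Prop) x y :
  Q x -> (forall s, Q s -> forall t, t \in nb s -> s != y -> Q t) -> Q y.
Proof.
move=> Qx h; case: Htree => _ _ /(_ x y)[p [[pp pl _] _]].
elim: p x Qx pp pl => [|z p IH] x Qx /=; first by move=> _ <-.
move=> /andP[xz pp] pl; have [->//|xy] := eqVneq y x.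
by apply: (IH z) => //; apply: (h x) => //; rewrite ?mem_nb// eq_sym.
Qed.

Section FixedTarget.
Variable x : V.

(* [surv n s] is the probability that the chain started at [s] does not visit
   [x] at times 1, ..., n; [first_visit n s] that it first does at time n.+1. *)
Fixpoint surv (n : nat) (s : V) : R :=
  if n is n'.+1 then \sum_(t <- nb s | t != x) q s t * surv n' t else 1.

Fixpoint first_visit (n : nat) (s : V) : R :=
  if n is n'.+1 then \sum_(t <- nb s | t != x) q s t * first_visit n' t else q s x.

Lemma first_visitE n s : first_visit n s = surv n s - surv n.+1 s.
Proof.
elim: n s => [|n IH] s; last first.
  rewrite [first_visit _ _]/= [surv n.+1 s]/= [surv n.+2 s]/= -sumrB.
  by apply: eq_bigr => t _; rewrite IH mulrBr.
rewrite /= -[X in X - _](sum_q s); under [X in _ - X]eq_bigr do rewrite mulr1.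
have [xs|xs] := boolP (x \in nb s).
  by rewrite (bigD1_seq x)//= ?nb_uniq// addrK.
rewrite q_eq0// [X in _ - X]big_seq_cond [X in X - _]big_seq_cond.
rewrite (eq_bigl (fun i => (i \in nb s) && (i != x))) ?subrr// => t.
by rewrite andbT; case: eqVneq => [->|_]; rewrite ?(negbTE xs) ?andbT.
Qed.

Lemma surv_ge0 n s : 0 <= surv n s.
Proof.
by elim: n s => [|n IH] s //=; rewrite sumr_ge0// => t _; rewrite mulr_ge0// q_ge0.
Qed.

Lemma first_visit_ge0 n s : 0 <= first_visit n s.
Proof.
elim: n s => [|n IH] s /=; first exact: q_ge0.
by rewrite sumr_ge0// => t _; rewrite mulr_ge0// q_ge0.
Qed.

Lemma surv_le_succ n s : surv n.+1 s <= surv n s.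
Proof. by rewrite -subr_ge0 -first_visitE first_visit_ge0. Qed.

Lemma surv_le m n s : (m <= n)%N -> surv n s <= surv m s.
Proof.
move=> mn; apply: (homo_leq (f := surv^~ s) (r := fun a b => b <= a)) => //.
  by move=> a b c ab bc; exact: le_trans ab.
by move=> k; exact: surv_le_succ.
Qed.

Lemma surv_le1 n s : surv n s <= 1.
Proof. exact: (surv_le s (leq0n n)). Qed.

Definition escape s : R := limn (surv^~ s).

Lemma escape_cvg s : surv^~ s @ \oo --> escape s.
Proof.
apply: nonincreasing_is_cvgn; first by move=> m n; exact: surv_le.
by exists 0 => _ [n _ <-]; exact: surv_ge0.
Qed.

Lemma escape_ge0 s : 0 <= escape s.
Proof.
by apply: limr_ge; [apply/cvg_ex; eexists; exact: escape_cvg|near=> n; exact: surv_ge0].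
Unshelve. all: by end_near. Qed.

Lemma escape_le1 s : escape s <= 1.
Proof.
by apply: limr_le; [apply/cvg_ex; eexists; exact: escape_cvg|near=> n; exact: surv_le1].
Unshelve. all: by end_near. Qed.

(** A first step to [x] counts as a return. The value 0 at [x] makes the one-step formula hold at
    every vertex, [x] included. *)
Definition killed_escape s : R := if s == x then 0 else escape s.

Lemma escape_harmonic s : escape s = \sum_(t <- nb s) q s t * killed_escape t.
Proof.
rewrite (bigID (fun t => t != x))/= [X in _ + X]big1 ?addr0; last first.
  by move=> t; rewrite /killed_escape negbK => ->; rewrite mulr0.
have -> : \sum_(t <- nb s | t != x) q s t * killed_escape t =
    \sum_(t <- [seq t <- nb s | t != x]) q s t * escape t.
  by rewrite big_filter; apply: eq_bigr => t; rewrite /killed_escape => /negbTE ->.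
have h : (fun n => surv n.+1 s) @ \oo -->
    \sum_(t <- [seq t <- nb s | t != x]) q s t * escape t.
  rewrite [X in X @ _ --> _](_ : _ =
      (fun n => \sum_(t <- [seq t <- nb s | t != x]) q s t * surv n t)).
    by apply: cvg_sum_seq => t; apply: cvgMl_tmp; exact: escape_cvg.
  by apply/funext => n; rewrite big_filter.
have h' : surv^~ s @ \oo --> escape s by exact: escape_cvg.
rewrite -cvg_shiftS in h'.
exact: (cvg_unique (@norm_hausdorff _ _) h' h).
Qed.

Fixpoint first_paths (n : nat) (s : V) : seq (seq V) :=
  if n is n'.+1 then [seq t :: p | t <- [seq t <- nb s | t != x], p <- first_paths n' t]
  else [:: [::]].

Lemma mem_first_paths n s p :
  (p \in first_paths n s) = [&& x \notin p, size p == n & path adj s p].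
Proof.
elim: n s p => [|n IH] s p; first by rewrite inE; case: p => [|t p] //=; rewrite andbF.
case: p => [|t p]; first by apply/allpairsPdep => -[? [? []]].
apply/allpairsPdep/idP => [[t' [p' []]]|].
  rewrite mem_filter mem_nb => /andP[tx st]; rewrite IH => /and3P[h1 h2 h3] [-> ->].
  by rewrite inE negb_or eq_sym tx h1 /= eqSS h2 st.
rewrite inE negb_or eqSS /= => /and3P[/andP[tx xp] sp /andP[st pp]].
by exists t, p; rewrite mem_filter mem_nb eq_sym tx st IH xp sp pp.
Qed.

Lemma first_paths_uniq n s : uniq (first_paths n s).
Proof.
elim: n s => [|n IH] s //; apply: allpairs_uniq_dep.
- by rewrite filter_uniq// nb_uniq.
- by move=> t _; exact: IH.
- by move=> [a b] [c d] _ _ /= [-> ->].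
Qed.

Lemma sum_first_paths n s :
  \sum_(p <- first_paths n s) path_prob q s (rcons p x) = first_visit n s.
Proof.
elim: n s => [|n IH] s; first by rewrite big_seq1 /= mulr1.
rewrite /= big_allpairs_dep big_filter; apply: eq_bigr => t _.
by rewrite -IH mulr_sumr.
Qed.

Lemma path_prob_ge0 s p : 0 <= path_prob q s p.
Proof. by elim: p s => [|t p IH] s //=; rewrite mulr_ge0// q_ge0. Qed.

Lemma path_prob_eq0 s p : ~~ path adj s p -> path_prob q s (rcons p x) = 0.
Proof.
elim: p s => [|t p IH] s //=; rewrite negb_and => /orP[|/IH ->]; last exact: mulr0.
by rewrite -mem_nb => /q_eq0 ->; rewrite mul0r.
Qed.

(** The weight [G] covers two cases: constant 1 for the return probability and [n.+1] for the mean
    return time. *)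
Lemma esum_first_passage (G : nat -> R) s : (forall n, 0 <= G n) ->
  (\esum_(p in [set p : seq V | x \notin p])
     (G (size p) * path_prob q s (rcons p x))%:E =
   \sum_(0 <= n <oo) (G n * first_visit n s)%:E)%E.
Proof.
move=> G0.
have -> : [set p : seq V | x \notin p] =
    \bigcup_n [set p : seq V | x \notin p /\ size p = n].
  by apply/seteqP; split => [p /= h|p [n _ []//]]; exists (size p).
rewrite nneseries_sum_bigcup; first last.
- by move=> p; rewrite lee_fin mulr_ge0// path_prob_ge0.
- by move=> i j _ _ [p [[_ <-] [_ <-]]].
apply: eq_eseriesr => n _.
(* Sequences that are not walks of the graph have probability 0; the remaining ones of length [n]
   form a finite list. *)
rewrite (esumID [set` first_paths n s]); last first.
  by move=> p _; rewrite lee_fin mulr_ge0// path_prob_ge0.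
rewrite [X in (_ + X)%E]esum1 ?adde0; last first.
  move=> p [[xp /eqP sp]] /= /negP; rewrite mem_first_paths xp sp /= => h.
  by rewrite path_prob_eq0// mulr0.
have -> : [set p : seq V | x \notin p /\ size p = n] `&` [set` first_paths n s] =
    [set` first_paths n s].
  apply/seteqP; split=> [p []//|p /= h]; split => //=.
  by move: h; rewrite mem_first_paths => /and3P[-> /eqP].
rewrite esum_fset; [|exact: finite_seq|]; last first.
  by move=> p _; rewrite lee_fin mulr_ge0// path_prob_ge0.
rewrite -fsbig_seq ?first_paths_uniq// sumEFin; congr EFin.
rewrite -sum_first_paths mulr_sumr; apply: eq_big_seq => p.
by rewrite mem_first_paths => /and3P[_ /eqP -> _].
Qed.

Lemma sum_first_visit n s : \sum_(0 <= k < n) first_visit k s = 1 - surv n s.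
Proof.
elim: n => [|n IH]; first by rewrite big_nil subrr.
by rewrite big_nat_recr// IH first_visitE -[LHS]/(_ + _); lra.
Qed.

Lemma return_probE : return_prob q x = (1 - escape x)%:E.
Proof.
rewrite /return_prob; under eq_esum do rewrite -[path_prob _ _ _]mul1r.
rewrite (@esum_first_passage (fun=> 1))//.
apply/cvg_lim => //.
rewrite [X in X @ _ --> _](_ : _ = (fun n => (1 - surv n x)%:E)).
  by apply: cvg_EFin; [near=> n; rewrite //|]; apply: cvgB; [exact: cvg_cst|exact: escape_cvg].
apply/funext => n; rewrite sumEFin -sum_first_visit.
by congr EFin; apply: eq_bigr => k _; rewrite mul1r.
Unshelve. all: by end_near. Qed.

(** Summation by parts turns the mean of the return time into the sum of its tails. *)
Lemma mean_return_time_finite M :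
  (forall n, \sum_(0 <= k < n) surv k x <= M) -> (mean_return_time q x < +oo)%E.
Proof.
move=> h; rewrite /mean_return_time; under eq_esum do rewrite size_rcons.
rewrite (@esum_first_passage (fun n => n.+1%:R))//.
apply: (@le_lt_trans _ _ M%:E); last exact: ltry.
apply: lime_le.
  apply: is_cvg_nneseries => n _ _; rewrite lee_fin mulr_ge0// first_visit_ge0//.
near=> n; rewrite sumEFin lee_fin.
apply: (le_trans _ (h n)).
have -> : \sum_(0 <= k < n) k.+1%:R * first_visit k x =
    \sum_(0 <= k < n) surv k x - n%:R * surv n x.
  elim: (n) => [|m IH]; first by rewrite !big_nil mul0r subrr.
  by rewrite !big_nat_recr// IH first_visitE -natr1 -[LHS]/(_ + _) -[X in _ = X - _]/(_ + _); lra.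
by rewrite lerBlDr lerDl mulr_ge0// surv_ge0.
Unshelve. all: by end_near. Qed.

End FixedTarget.

(** The escape probability killed at [x] is bounded, harmonic off [x] and 0 at [x]. Comparison with
    [1 - h n], which tends to 0, shows that it attains its maximum in a finite ball; the maximum
    principle carries this value to [x], so it is 0. *)
Lemma recurrent_of_voltages (h : nat -> V -> R) :
  (forall n s, 0 <= h n s <= 1) ->
  (forall n s, dep s = n.+1 -> h n s = 0) ->
  (forall n s, (0 < dep s <= n)%N -> h n s = \sum_(t <- nb s) q s t * h n t) ->
  (forall s, h^~ s @ \oo --> (1 : R)) -> recurrent q.
Proof.
move=> h01 hbd hharm hlim x; rewrite return_probE; congr EFin.
pose u := killed_escape x.
have u0 s : 0 <= u s by rewrite /u /killed_escape; case: ifP => // _; exact: escape_ge0.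
have u1 s : u s <= 1 by rewrite /u /killed_escape; case: ifP => // _; exact: escape_le1.
have uharm s : s != x -> u s = \sum_(t <- nb s) q s t * u t.
  by move=> sx; rewrite -escape_harmonic /u /killed_escape (negbTE sx).
have ux : u x = 0 by rewrite /u /killed_escape eqxx.
suff uz s : u s = 0 by rewrite escape_harmonic big1 ?subr0// => t _; rewrite -/u uz mulr0.
set N := dep x.
have xB : x \in tball N by rewrite mem_ball.
have [|m mB um] := @seq_argmax _ _ u (tball N); first by apply/eqP => e; rewrite e in xB.
(* [D] is nonpositive on the ball of radius [N], where [u <= u m], and at depth [n.+1], where [h n]
   vanishes and [u <= 1]. In between it is harmonic, so a positive maximum would pass to the parent,
   and so on up into the ball. *)
have key n y : (N <= n)%N -> (dep y <= n.+1)%N -> u y <= u m + (1 - h n y).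
  move=> Nn yn; pose D t := u t - u m - 1 + h n t.
  suff : D y <= 0 by rewrite /D; lra.
  have yB : y \in tball n.+1 by rewrite mem_ball.
  have [|z zB hz] := @seq_argmax _ _ D (tball n.+1); first by apply/eqP => e; rewrite e in yB.
  apply: (le_trans (hz _ yB)); rewrite leNgt; apply/negP => Dz.
  elim: {z}(dep z) {-2}z (erefl (dep z)) zB hz Dz => [|k IH] z zk zB hz Dz.
    have := um z; rewrite mem_ball// zk => /(_ isT) h1.
    by move: Dz; rewrite /D; have /andP[_] := h01 n z; lra.
  have zN : (N < dep z)%N.
    rewrite ltnNge; apply/negP => zN; have := um z; rewrite mem_ball// => /(_ zN) h1.
    by move: Dz; rewrite /D; have /andP[_] := h01 n z; lra.
  have zn : (dep z <= n)%N.
    move: zB; rewrite mem_ball// leq_eqVlt => /orP[/eqP e|//].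
    by move: Dz; rewrite /D hbd//; have := u1 z; have := u0 m; lra.
  have zo : z != o by rewrite -(depth_eq0 _ Htree) zk.
  have zx : z != x by apply/eqP => e; rewrite e ltnn in zN.
  have Dharm : D z <= \sum_(t <- nb z) q z t * D t.
    rewrite /D; under eq_bigr do rewrite mulrDr mulrBr mulrBr.
    rewrite big_split/= !sumrB -uharm// -hharm//; last by rewrite zn zk.
    by rewrite -!mulr_suml sum_q !mul1r.
  have nbB t : t \in nb z -> t \in tball n.+1.
    by rewrite mem_nb mem_ball// => /(depth_adj o Htree Hlf) h1; apply: (leq_trans h1); rewrite ltnS.
  have Dp : D (par z) = D z.
    apply: (avg_extremal _ Dharm); last by rewrite mem_nb adj_sym// adj_parent.
    by move=> t /nbB/hz.
  apply: (IH (par z)); rewrite ?Dp//; first by rewrite depth_parent// zk.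
  by rewrite nbB// mem_nb adj_sym// adj_parent.
have umax s' : u s' <= u m.
  have : (fun n => u m + (1 - h n s')) @ \oo --> u m.
    rewrite -[X in _ --> X]addr0 -[X in _ + X](subrr 1).
    by apply: cvgD; [exact: cvg_cst|apply: cvgB; [exact: cvg_cst|exact: hlim]].
  move=> hc; rewrite -(cvg_lim _ hc)//; apply: limr_ge; first by apply/cvg_ex; eexists; exact: hc.
  near=> n; apply: key; near: n; first exact: nbhs_infty_ge.
  by exists (dep s') => // n /= hn; exact: leqW.
apply/le_anti; rewrite u0 andbT (le_trans (umax s))// -ux.
suff -> : u x = u m by [].
apply: (@connected_propagate (fun t => u t = u m) m x) => // y ym t ty yx.
by apply: (avg_extremal (s := y)) => [t' _||//]; rewrite -?uharm ?ym.
Unshelve. all: by end_near. Qed.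

(** If [x] were recurrent, stopping at the first visit to [x] would give [h >= h x] everywhere, and
    a superharmonic function that attains its minimum is constant. *)
Lemma transient_of_superharmonic (h : V -> R) x1 x2 :
  (forall s, 0 <= h s) ->
  (forall s, \sum_(t <- nb s) q s t * h t <= h s) ->
  h x1 != h x2 -> transient q.
Proof.
move=> h0 hsup h12 x; rewrite return_probE lte_fin ltrBlDr ltrDl lt_neqAle escape_ge0 andbT.
apply/eqP => /esym ex.
have e0 s : escape x s = 0.
  apply: (@connected_propagate (fun t => escape x t = 0) x s) => // y ey t ty _.
  have := @avg_extremal y (fun t => - killed_escape x t) 0.
  move=> /(_ _ _ t ty); rewrite /killed_escape; case: (eqVneq t x) => [->//|tx].
  move=> /(_ _ _)/eqP; rewrite oppr_eq0 => hh; apply/eqP/hh.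
    by move=> t' _; rewrite oppr_le0; case: ifP => // _; exact: escape_ge0.
  by under eq_bigr do rewrite mulrN; rewrite sumrN -escape_harmonic ey oppr0.
(* Here [1 - surv x n s] is the probability of visiting [x] at some time from 1 to [n]. *)
have hn n s : h x * (1 - surv x n s) <= h s.
  elim: n s => [|n IH] s; first by rewrite subrr mulr0.
  apply: le_trans (hsup s).
  rewrite -[X in X - _](sum_q s) /= mulrBr mulr_sumr mulr_sumr -sumrN.
  rewrite [X in _ + X]big_mkcond -big_split/= ler_sum// => t _.
  case: eqVneq => [->|tx] /=; first by rewrite addr0 mulrC.
  have := IH t; have := q_ge0 s t => a b.
  have := ler_wpM2l a b; lra.
have hx s : h x <= h s.
  have hc : (fun n => h x * (1 - surv x n s)) @ \oo --> h x * (1 - 0).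
    by apply: cvgMl_tmp; apply: cvgB; [exact: cvg_cst|rewrite -(e0 s); exact: escape_cvg].
  rewrite -[leLHS]mulr1 -[X in _ * X]subr0 -(cvg_lim _ hc)//.
  by apply: limr_le; [apply/cvg_ex; eexists; exact: hc|near=> n; exact: hn].
have hc s : h s = h x.
  apply: (@connected_propagate (fun t => h t = h x) x s) => // y ey t ty _.
  have := @avg_extremal y (fun t => - h t) (- h x).
  move=> /(_ _ _ t ty) h'; apply: oppr_inj; apply: h'.
    by move=> t' _; rewrite lerN2.
  by under eq_bigr do rewrite mulrN; rewrite sumrN lerN2 -ey.
by rewrite !hc eqxx in h12.
Unshelve. all: by end_near. Qed.

(** By reversibility, [S m n.+1] together with the contribution of [x] fits into [S m.+1 n].
    Iterating, the tails of the return time weighted by [pi x] sum, from the second one on, to at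
    most the total mass of [pi]. *)
Lemma mean_return_finite (pi : V -> R) M :
  (forall s, 0 < pi s) -> (forall s t, adj s t -> pi s * q s t = pi t * q t s) ->
  (forall n, \sum_(s <- tball n) pi s <= M) ->
  forall x, (mean_return_time q x < +oo)%E.
Proof.
move=> pi0 hrev hM x.
pose S m n := \sum_(s <- tball m | s != x) pi s * surv x n s.
have hrev' s t : pi s * q s t = pi t * q t s.
  have [/hrev//|st] := boolP (adj s t).
  by rewrite !q_eq0 ?mulr0// mem_nb// adj_sym.
(* The ball grows by one level because a step of the walk may leave it. *)
have step m n : (dep x <= m)%N -> S m n.+1 + pi x * surv x n.+1 x <= S m.+1 n.
  move=> xm.
  have -> : S m n.+1 + pi x * surv x n.+1 x = \sum_(s <- tball m) pi s * surv x n.+1 s.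
    by rewrite [RHS](bigD1_seq x) ?ball_uniq ?mem_ball//= addrC.
  have -> : \sum_(s <- tball m) pi s * surv x n.+1 s =
      \sum_(s <- tball m) \sum_(t <- tball m.+1 | t != x) pi s * (q s t * surv x n t).
    apply: eq_big_seq => s sm; rewrite -mulr_sumr /= (@sum_nb_superset (tball m.+1))//.
      exact: ball_uniq.
    move=> t; rewrite mem_nb mem_ball// => /(depth_adj o Htree Hlf)/leq_trans; apply.
    by rewrite ltnS -(mem_ball o Htree Hlf).
  rewrite exchange_big/= ler_sum// => t _.
  under eq_bigr do rewrite mulrA hrev' mulrAC.
  rewrite -mulr_sumr -[leRHS]mulr1 ler_wpM2l ?sum_q_le1 ?ball_uniq//.
  by rewrite mulr_ge0 ?surv_ge0// ltW.
have tot n m : (dep x <= m)%N ->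
    pi x * (\sum_(0 <= k < n) surv x k.+1 x) + S m n <= S (m + n)%N 0%N.
  elim: n m => [|n IH] m xm; first by rewrite big_nil mulr0 add0r addn0.
  have := IH m.+1 (leqW xm); rewrite addSnnS; apply: le_trans.
  rewrite big_nat_recr//= mulrDr -addrA lerD2l addrC; exact: step.
apply: (@mean_return_time_finite _ (1 + M / pi x)) => -[|n].
  rewrite big_nil addr_ge0// divr_ge0 ?(ltW (pi0 _))//.
  by apply: le_trans (hM 0%N); rewrite sumr_ge0// => s _; exact: ltW.
rewrite big_nat_recl//= lerD2l ler_pdivlMr// mulrC.
apply: le_trans (hM (dep x + n)%N); apply: le_trans (le_trans (tot n (dep x) (leqnn _)) _).
  rewrite lerDl sumr_ge0// => s _; rewrite mulr_ge0 ?surv_ge0//; exact: ltW.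
rewrite /S; under eq_bigr do rewrite mulr1.
by rewrite [leRHS](bigID (fun s => s != x))/= lerDl sumr_ge0// => s _; exact: ltW.
Qed.

End Chain.

(** * Flows and cutsets *)

Section Cutsets.
Variables (R : realType) (V : choiceType) (adj : rel V) (o : V).
Hypothesis (Htree : is_tree adj) (Hlf : locally_finite_graph adj).

Notation sp := (spath adj o).
Notation par := (parent adj o).
Notation dep := (depth adj o).
Notation ch := (ch adj o).
Notation lev := (lev adj o).
Notation tball := (tball adj o).

Lemma spath_trans s t u : s \in sp t -> t \in sp u -> s \in sp u.
Proof.
move=> st tu; have [|p e] := @spath_prefix _ _ o Htree u t; first by rewrite inE tu orbT.
by rewrite e mem_cat st.
Qed.

(** If the cutset carried less than the root sends out, some child would again send out more than
    the cutset carries below it, and repeating this choice would give a ray that avoids the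
    cutset. *)
Lemma cutset_flow_le (Pi : set V) (th : V -> R) : cutset adj o Pi ->
  (forall s, s != o -> 0 <= th s) ->
  (forall s, s != o -> th s = \sum_(t <- ch s) th t) ->
  \sum_(t <- ch o) th t <= \sum_(s \in Pi) th s.
Proof.
move=> [Pfin Po Pray _] th0 thf; rewrite fsbig_finite//.
pose P : seq V := fset_set Pi; rewrite -[\sum_(i <- fset_set Pi) _]/(\sum_(i <- P) th i).
have memP u : u \in P -> Pi u by rewrite /P in_fset_set// => /set_mem.
have memP' u : Pi u -> u \in P by move=> h; rewrite /P in_fset_set//; exact/mem_set.
have P0 u : u \in P -> 0 <= th u.
  by move=> /memP h; apply: th0; apply/eqP => e; apply: Po; rewrite -e.
rewrite leNgt; apply/negP => hlt.
(* [b s] is the cutset flow at or below [s]. The invariant [Q s] says that the path to [s] misses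
   the cutset and that [s] sends out more than [b s]. *)
pose b s := \sum_(u <- P | s \in o :: sp u) th u.
pose Q s := (forall t, t \in sp s -> ~ Pi t) /\ b s < \sum_(t <- ch s) th t.
have Qo : Q o.
  by split; [rewrite spath_root|rewrite /b; under eq_bigl do rewrite mem_head].
have Qstep s : Q s -> exists t, t \in ch s /\ Q t.
  move=> [sP sb]; apply: contrapT => hno; move: sb; rewrite ltNge => /negP; apply.
  have h1 : \sum_(t <- ch s) th t <= \sum_(t <- ch s) \sum_(u <- P | t \in sp u) th u.
    rewrite big_seq [leRHS]big_seq ler_sum// => t ts.
    have to := ch_neq_root Htree Hlf ts.
    have bE : b t = \sum_(u <- P | t \in sp u) th u.
      by rewrite /b; apply: eq_bigl => u; rewrite inE (negbTE to).
    have [tP|tP] := pselect (Pi t).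
      rewrite -big_filter (bigD1_seq t) ?filter_uniq ?fset_uniq//=; last first.
        by rewrite mem_filter memP'// spath_self.
      rewrite lerDl big_seq_cond sumr_ge0// => u; rewrite mem_filter.
      by move=> /andP[/andP[_ /P0]].
    rewrite thf// -bE leNgt; apply/negP => hb; apply: hno; exists t; split=> //; split=> //.
    move=> u; rewrite (mem_spath_parent Htree)// (ch_parent Htree Hlf ts).
    by move=> /orP[/eqP -> //|/sP].
  apply: (le_trans h1); rewrite (exchange_big_dep (fun u => true))//=.
  rewrite /b [leRHS]big_mkcond big_seq [leRHS]big_seq ler_sum// => u uP.
  have u0 := P0 _ uP; rewrite -big_filter.
  (* A cutset vertex lies below at most one child of [s], so summing over the children counts it
     once. *)
  have huniq : forall t t', t \in [seq i <- ch s | i \in sp u] ->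
      t' \in [seq i <- ch s | i \in sp u] -> t = t'.
    move=> t t'; rewrite !mem_filter => /andP[tu ts] /andP[tu' ts'].
    rewrite (spath_mem_anc Htree tu) [RHS](spath_mem_anc Htree tu').
    by rewrite (ch_depth Htree Hlf ts) (ch_depth Htree Hlf ts').
  have : uniq [seq i <- ch s | i \in sp u] by rewrite filter_uniq// ch_uniq.
  have hsub : forall t, t \in [seq i <- ch s | i \in sp u] -> s \in o :: sp u.
    move=> t; rewrite mem_filter => /andP[tu ts]; rewrite -(ch_parent Htree Hlf ts).
    have to := ch_neq_root Htree Hlf ts.
    have [->|po] := eqVneq (par t) o; first exact: mem_head.
    rewrite inE; apply/orP; right; apply: (spath_trans _ tu).
    by rewrite (mem_spath_parent Htree)// spath_self ?orbT.
  case: [seq i <- ch s | i \in sp u] huniq hsub => [|t [|t' r]] huniq hsub.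
  - by rewrite big_nil; case: ifP.
  - by rewrite big_seq1 (hsub t) ?mem_head.
  - by rewrite (huniq t t') ?inE ?eqxx ?orbT//= inE eqxx.
pose f s := xget s [set t | t \in ch s /\ Q t].
have fP s : Q s -> f s \in ch s /\ Q (f s).
  by move=> /Qstep[t ht]; exact: (@xgetI _ s [set t | t \in ch s /\ Q t] t ht).
pose x n := iter n f o.
have xQ n : Q (x n) by elim: n => [|n IH] //=; case: (fP _ IH).
have [xa xi] := child_ray Htree Hlf (x := x) erefl (fun n => (fP _ (xQ n)).1).
have [[|n] xn] := Pray x erefl xa xi; first exact: Po.
have [h _] := xQ n.+1; apply: (h (x n.+1)) => //; apply: spath_self => //.
by apply: (@ch_neq_root _ _ _ Htree Hlf (x n)); case: (fP _ (xQ n)).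
Qed.

Lemma no_flow_of_cutsets (C : V -> R) :
  (forall e, 0 < e -> exists2 Pi, cutset adj o Pi & \sum_(s \in Pi) C s < e) ->
  ~ admits_flow adj o C.
Proof.
move=> hC [th [thC [s so sth] thf0]].
have thf u : u != o -> th u = \sum_(t <- ch u) th t by move=> /thf0; rewrite fsum_ch.
have th0 u : u != o -> 0 <= th u by move=> /thC/andP[].
have out0 : \sum_(t <- ch o) th t <= 0.
  rewrite leNgt; apply/negP => h; have [Pi cPi hPi] := hC _ h.
  move: hPi; rewrite ltNge => /negP; apply.
  apply: (le_trans (cutset_flow_le cPi th0 thf)).
  case: cPi => Pfin Po _ _; rewrite !fsbig_finite// big_seq [leRHS]big_seq ler_sum// => u.
  rewrite in_fset_set// => /set_mem uP.
  have uo : u != o by apply/eqP => e; apply: Po; rewrite -e.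
  by case/andP: (thC _ uo).
have sub u t : t \in ch u -> \sum_(t <- ch u) th t <= 0 -> th t = 0.
  move=> tu h; apply/le_anti; rewrite th0 ?(ch_neq_root Htree Hlf tu)// andbT.
  apply: le_trans h; rewrite (bigD1_seq t) ?ch_uniq//= lerDl.
  rewrite big_seq_cond sumr_ge0// => t' /andP[tu' _].
  by rewrite th0 ?(ch_neq_root Htree Hlf tu').
suff all0 u : u != o -> th u = 0 by rewrite all0 ?eqxx in sth.
elim: {u}(dep u) {-2}u (erefl (dep u)) => [|k IH] u e uo.
  by move/eqP: e; rewrite depth_eq0// (negbTE uo).
have uc := in_ch_parent Htree Hlf uo.
have [po|po] := eqVneq (par u) o; first by rewrite po in uc; exact: sub uc out0.
by apply: (sub _ _ uc); rewrite -thf// IH// depth_parent// e.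
Qed.

(** * Max-flow min-cut on finitely many levels *)

Section LevelFlow.
Variables (l c : R) (N : nat).
Hypotheses (l0 : 0 < l) (c0 : 0 <= c).
Hypothesis cut_ge : forall Pi, cutset adj o Pi -> c <= \sum_(s \in Pi) l ^+ dep s.

Fixpoint max_flow_rec (m : nat) (s : V) : R :=
  if m is m'.+1 then Num.min (l ^+ dep s) (\sum_(t <- ch s) max_flow_rec m' t)
  else l ^+ dep s.

(* The maximal flow from [parent s] through [s] to level [N.+1], when the edge
   above each vertex [t] has capacity [l ^+ dep t]. *)
Let F s := max_flow_rec (N.+1 - dep s) s.
Let SF s := \sum_(t <- ch s) F t.
Let sat s := F s == l ^+ dep s.
Let unsat_above s := all (fun t => ~~ sat t) (sp s).
(** First saturated vertices on the paths from the root: the cut dual to the maximal flow. *)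
Let mincut s := [&& s != o, sat s & unsat_above (par s)].

Let F_ge0 s : 0 <= F s.
Proof.
rewrite /F; move: (N.+1 - dep s)%N => m; elim: m s => [|m IH] s /=; first by rewrite exprn_ge0// ltW.
by rewrite le_min exprn_ge0 ?(ltW l0)//= sumr_ge0.
Qed.

Let SF_ge0 s : 0 <= SF s. Proof. by rewrite sumr_ge0. Qed.

Let F_min s : (dep s <= N)%N -> F s = Num.min (l ^+ dep s) (SF s).
Proof.
move=> sN; rewrite /F subSn//=; congr Num.min; apply: eq_big_seq => t ts.
by rewrite /F (ch_depth Htree Hlf ts) subSS.
Qed.

Let F_le s : F s <= l ^+ dep s.
Proof. by rewrite /F; case: (N.+1 - dep s)%N => [|m] //=; rewrite ge_min lexx. Qed.

Let sat_last s : dep s = N.+1 -> sat s.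
Proof. by move=> e; rewrite /sat /F e subnn /= e. Qed.

Let mincut_cutset : cutset adj o [set s | (s \in tball N.+1) && mincut s].
Proof.
split.
- by apply: (sub_finite_set _ (finite_seq (tball N.+1))) => s /= /andP[].
- by rewrite /= /mincut eqxx andbF.
- move=> x x0 xa xi; have xc := ray_child Htree Hlf x0 xa xi.
  have xd n : dep (x n) = n.
    by elim: n => [|n IH]; rewrite ?x0 ?depth_root// (ch_depth Htree Hlf (xc n)) IH.
  have ex : exists n, (0 < n)%N && sat (x n) by exists N.+1; rewrite sat_last.
  case: (ex_minnP ex) => -[//|n] /andP[_ nsat] nmin; exists n.+1.
  apply/andP; split; first by rewrite (mem_ball o Htree Hlf) xd nmin ?sat_last.
  rewrite /mincut (ch_neq_root Htree Hlf (xc n)) nsat /=.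
  rewrite (ch_parent Htree Hlf (xc n)).
  have spx m t : t \in sp (x m) -> exists2 j, (0 < j <= m)%N & t = x j.
    elim: m => [|m IH]; first by rewrite x0 spath_root.
    rewrite (mem_spath_parent Htree) ?(ch_neq_root Htree Hlf (xc m))//.
    rewrite (ch_parent Htree Hlf (xc m)) => /orP[/eqP ->|/IH[j /andP[j0 jm] ->]].
      by exists m.+1; rewrite ?leqnn.
    by exists j => //; rewrite j0 leqW.
  apply/allP => t /spx[j /andP[j0 jn] ->]; apply/negP => js.
  by have := nmin j; rewrite j0 js => /(_ isT); rewrite ltnNge jn.
- move=> s t /andP[_ /and3P[so ssat _]] /andP[_ /and3P[to _ /allP tun]].
  apply/negP => /andP[]; rewrite /tle inE (negbTE so)/= (mem_spath_parent Htree)//.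
  by move=> /orP[-> //|/tun]; rewrite ssat.
Qed.

(** Going down one level, the maximal flow either meets a first saturated vertex or continues
    through an unsaturated one, where [F] is the sum over the children. *)
Let level_balance k : (k <= N.+1)%N ->
  \sum_(s <- tball k | mincut s) l ^+ dep s +
  \sum_(s <- lev k | unsat_above s) (if s == o then SF o else F s) = SF o.
Proof.
elim: k => [|k IH] kN.
  rewrite /= !big_cons !big_nil /mincut eqxx /= addr0 add0r.
  by rewrite /unsat_above spath_root// addr0.
rewrite -[RHS](IH (ltnW kN)) -[tball k.+1]/(tball k ++ lev k.+1) big_cat/= -addrA.
congr (_ + _).
have neq s : s \in lev k.+1 -> s != o.
  by rewrite (mem_lev o Htree Hlf) => /eqP e; rewrite -(depth_eq0 _ Htree) e.
transitivity (\sum_(s <- lev k.+1 | unsat_above (par s)) F s).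
  rewrite [RHS](bigID sat) /=; congr (_ + _); rewrite big_seq_cond [RHS]big_seq_cond.
    apply: eq_big => [s|s /andP[sl /and3P[_ /eqP -> _]]//].
    case: (boolP (s \in lev k.+1)) => //= /neq so.
    by rewrite /mincut so /= andbC.
  apply: eq_big => [s|s /andP[/neq/negbTE -> _]//].
  case: (boolP (s \in lev k.+1)) => //= /neq so.
  by rewrite /unsat_above [sp s](spath_parent Htree so) all_rcons andbC.
rewrite big_mkcond sum_lev [RHS]big_mkcond; apply: eq_big_seq => s sl.
transitivity (if unsat_above s then SF s else 0).
  case: ifP => us; [apply: eq_big_seq|apply: big1_seq] => t.
    by move=> ts; rewrite (ch_parent Htree Hlf ts) us.
  by move=> /andP[_ ts]; rewrite (ch_parent Htree Hlf ts) us.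
case: ifP => // us; case: eqVneq => [->//|so].
move/allP: us => /(_ s (spath_self Htree so)).
rewrite /sat F_min; last by move: sl; rewrite (mem_lev o Htree Hlf) => /eqP ->.
by rewrite /Num.min; case: ifP => //; rewrite eqxx.
Qed.

Let SF_root_ge : c <= SF o.
Proof.
have := cut_ge mincut_cutset.
rewrite (_ : \sum_(s \in _) _ = \sum_(s <- tball N.+1 | mincut s) l ^+ dep s); last first.
  rewrite -[RHS]big_filter [RHS]fsbig_seq ?filter_uniq ?ball_uniq//.
  by apply: eq_fsbigl; apply/seteqP; split => s /=; rewrite mem_filter andbC.

move=> h; rewrite -(level_balance (leqnn N.+1)); apply: (le_trans h).
rewrite lerDl sumr_ge0// => s _; case: ifP => _; [exact: SF_ge0|exact: F_ge0].
Qed.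

Lemma level_flow : exists th : V -> R,
  [/\ th o = c, forall s, 0 <= th s,
      forall s, s != o -> (dep s <= N.+1)%N -> th s <= l ^+ dep s &
      forall s, (dep s < N.+1)%N -> th s = \sum_(t <- ch s) th t].
Proof.
(* Each vertex splits its flow in proportion to the maximal flows of its children. Where [SF]
   vanishes, [bnd] forces the flow to be 0, so the quotient by 0 is harmless. *)
pose th s := c * \prod_(t <- sp s) (F t / SF (par t)).
have thS s : s != o -> th s = th (par s) * (F s / SF (par s)).
  by move=> so; rewrite /th [sp s](spath_parent Htree so) -cats1 big_cat big_seq1 /= mulrA.
have tho : th o = c by rewrite /th spath_root// big_nil mulr1.
have th0 s : 0 <= th s by rewrite mulr_ge0// prodr_ge0// => t _; rewrite divr_ge0.
have bnd s : (dep s <= N.+1)%N -> th s <= if s == o then SF o else F s.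
  elim: {s}(dep s) {-2}s (erefl (dep s)) => [|k IH] s e sN.
    by move/eqP: e; rewrite depth_eq0// => /eqP ->; rewrite eqxx tho SF_root_ge.
  have so : s != o by rewrite -(depth_eq0 _ Htree) e.
  have pd : dep (par s) = k by rewrite depth_parent// e.
  rewrite (negbTE so) thS//.
  have h : th (par s) <= SF (par s).
    apply: (le_trans (IH _ pd _)); first by rewrite pd ltnW// -e.
    case: ifP => [/eqP ->//|_]; rewrite F_min; last by rewrite pd -ltnS -e.
    by rewrite ge_min lexx orbT.
  have [z|nz] := eqVneq (SF (par s)) 0; first by rewrite z invr0 !mulr0.
  rewrite mulrCA ler_piMr// ler_pdivrMr ?mul1r// lt_neqAle eq_sym nz SF_ge0//.
exists th; split => //.
  by move=> s so sN; have := bnd s sN; rewrite (negbTE so) => /le_trans; apply; exact: F_le.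
move=> s sN.
rewrite (eq_big_seq (fun t => th s * (F t / SF s))); last first.
  by move=> t ts; rewrite thS ?(ch_neq_root Htree Hlf ts)// (ch_parent Htree Hlf ts).
rewrite -mulr_sumr -mulr_suml.
have [z|nz] := eqVneq (SF s) 0; last by rewrite divff// mulr1.
rewrite -/(SF s) z mul0r mulr0; apply/le_anti; rewrite th0 andbT.
apply: (le_trans (bnd s (ltnW sN))); case: ifP => [/eqP <-|_]; first by rewrite z.
by rewrite F_min// z ge_min lexx orbT.
Qed.

End LevelFlow.
End Cutsets.

(** * Cramer's lower bound *)

Lemma one_powR (R : realType) (x : R) : 1 `^ x = 1.
Proof. by rewrite powR1. Qed.

Lemma bernoulli_ge (R : realDomainType) (h : R) n : 0 <= h -> 1 + h *+ n <= (1 + h) ^+ n.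
Proof.
move=> h0; elim: n => [|n IH]; first by rewrite mulr0n addr0 expr0.
rewrite exprS mulrSr addrA.
have : (1 + h) * (1 + h *+ n) <= (1 + h) * (1 + h) ^+ n by rewrite ler_wpM2l// addr_ge0.
apply: le_trans; rewrite mulrDl mul1r mulrDr mulr1 lerD2l lerDl.
by rewrite mulr_ge0// mulrn_wge0.
Qed.

Lemma exists_expr_gt (R : archiRealFieldType) (a y : R) : 1 < a -> exists n, y < a ^+ n.
Proof.
move=> a1; have a0 : 0 < a - 1 by rewrite subr_gt0.
exists (Num.bound `|y / (a - 1)|).
have h : y / (a - 1) < (Num.bound `|y / (a - 1)|)%:R.
  exact: le_lt_trans (ler_norm _) (archi_boundP (normr_ge0 _)).
have := bernoulli_ge (Num.bound `|y / (a - 1)|) (ltW a0).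
rewrite [1 + (a - 1)]addrC subrK; apply: lt_le_trans.
by rewrite -mulr_natl; rewrite ltr_pdivrMr// in h; apply: (lt_trans h); rewrite ltrDr.
Qed.

(** With [c] an [M]-th root of [a], the square of Bernoulli's inequality for [c ^+ n] grows
    quadratically in [n] and beats [(2 * n).+1]. *)
Lemma exists_expr_gt_poly (R : realType) (a : R) M : 1 < a ->
  exists k, (0 < k)%N /\ k.+1%:R ^+ M < a ^+ k.
Proof.
move=> a1; have [->|M0] := posnP M; first by exists 1%N; rewrite expr0 expr1.
pose c := a `^ (M%:R^-1).
have c1 : 1 < c.
  by rewrite /c -[ltLHS](@one_powR R M%:R^-1) gt0_ltr_powR ?invr_gt0 ?ltr0n ?nnegrE// ?ltW// (lt_trans _ a1).
have cM : c ^+ M = a.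
  rewrite /c -powR_mulrn ?powR_ge0// -powRrM mulVf ?pnatr_eq0 -?lt0n// powRr1//.
  by rewrite (le_trans _ (ltW a1)).
have h0 : 0 < c - 1 by rewrite subr_gt0.
pose n := (Num.bound `|2 / (c - 1) ^+ 2|).+1.
have hn : 2 < n%:R * (c - 1) ^+ 2.
  rewrite -ltr_pdivrMr ?exprn_gt0//.
  apply: (lt_trans (le_lt_trans (ler_norm _) (archi_boundP (normr_ge0 _)))).
  by rewrite ltr_nat.
have n1 : 1 <= n%:R :> R by rewrite ler1n.
clearbody n.
exists (2 * n)%N; split; first by rewrite muln_gt0 /=; have := lt_le_trans ltr01 n1; rewrite ltr0n.
suff : (2 * n).+1%:R < c ^+ (2 * n).
  by move=> h; rewrite -cM exprAC ltrXn2r ?nnegrE// -lt0n M0.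
rewrite mulnC exprM; have := bernoulli_ge n (ltW h0); rewrite [1 + (c - 1)]addrC subrK => hb.
have : (1 + (c - 1) *+ n) ^+ 2 <= (c ^+ n) ^+ 2.
  have c0 := lt_trans ltr01 c1.
  by rewrite lerXn2r ?nnegrE ?exprn_ge0 ?addr_ge0 ?mulrn_wge0 ?ler01 ?(ltW h0) ?(ltW c0)//.
apply: lt_le_trans; rewrite -[(c - 1) *+ n]mulr_natr -natr1 natrM !expr2.
move: hn n1 h0; rewrite expr2; move: (c - 1) (n%:R : R) => h m hm m1 hh.
have : 2 * m < m * (h * h) * m by rewrite ltr_pM2r// (lt_le_trans _ m1).
have := mulr_gt0 hh (lt_le_trans ltr01 m1); lra.
Qed.

Section WordClasses.
Variables (R : realType) (M : nat) (p b : nat -> R).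
Hypothesis p_ge0 : forall i, 0 <= p i.
Hypothesis b_gt0 : forall i, (0 < i)%N -> 0 < b i.

(** In the application letters are cell numbers, and letter 0 is excluded because its rounded value
    is 0. *)
Definition word_class (K : nat) (r B : R) (Es : seq (seq nat)) : Prop :=
  [/\ uniq Es,
      forall w, w \in Es ->
        [/\ size w = K, all (fun i => 0 < i <= M)%N w & \prod_(i <- w) b i = B] &
      \sum_(w <- Es) \prod_(i <- w) p i = r].

Lemma word_class0 : word_class 0 1 1 [:: [::]].
Proof.
split=> //; first by move=> w; rewrite inE => /eqP ->; rewrite big_nil.
by rewrite big_seq1 big_nil.
Qed.

Lemma word_class_cat K1 r1 B1 E1 K2 r2 B2 E2 :
  word_class K1 r1 B1 E1 -> word_class K2 r2 B2 E2 ->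
  word_class (K1 + K2) (r1 * r2) (B1 * B2) [seq w1 ++ w2 | w1 <- E1, w2 <- E2].
Proof.
move=> [u1 h1 s1] [u2 h2 s2]; split.
- apply: allpairs_uniq => // -[x1 x2] [y1 y2] /=.
  move=> /allpairsP[[a1 a2] /= [a1E a2E [-> ->]]] /allpairsP[[c1 c2] /= [c1E c2E [-> ->]]].
  move=> /eqP; rewrite eqseq_cat; last by case: (h1 _ a1E) => ->; case: (h1 _ c1E) => ->.
  by move=> /andP[/eqP -> /eqP ->].
- move=> w /allpairsP[[a1 a2] /= [/h1[sa1 la1 pa1] /h2[sa2 la2 pa2] ->]].
  by rewrite size_cat sa1 sa2 all_cat la1 la2 big_cat/= pa1 pa2.
- rewrite big_allpairs_dep -s1 -s2 mulr_suml; apply: eq_bigr => a1 _.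
  by rewrite mulr_sumr; apply: eq_bigr => a2 _; rewrite big_cat.
Qed.

Section Types.
Variable k : nat.

(** The type of a word records how often each letter occurs; this determines the product of its
    values. *)
Let ty (w : {ffun 'I_k -> 'I_M}) : {ffun 'I_M -> 'I_k.+1} :=
  [ffun i => inord #|[pred j | w j == i]|].

Let prod_ty (w : {ffun 'I_k -> 'I_M}) (g : 'I_M -> R) :
  \prod_j g (w j) = \prod_i g i ^+ ty w i.
Proof.
rewrite (partition_big w predT)//=; apply: eq_bigr => i _.
rewrite (eq_bigr (fun=> g i)); last by move=> j /eqP ->.
rewrite prodr_const ffunE inordK//.
by rewrite ltnS -[X in (_ <= X)%N]card_ord max_card.
Qed.

Definition type_weight (t : {ffun 'I_M -> 'I_k.+1}) : R :=
  \sum_(w | ty w == t) \prod_(j < k) p (w j).+1.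

Definition type_value (t : {ffun 'I_M -> 'I_k.+1}) : R := \prod_(i < M) b i.+1 ^+ t i.

Lemma type_value_gt0 t : 0 < type_value t.
Proof. by apply: prodr_gt0 => i _; rewrite exprn_gt0// b_gt0. Qed.

Lemma word_class_type t : exists Es, word_class k (type_weight t) (type_value t) Es.
Proof.
pose wd (w : {ffun 'I_k -> 'I_M}) := [seq (w j : nat).+1 | j <- enum 'I_k].
have prod_wd (g : nat -> R) w : \prod_(i <- wd w) g i = \prod_(j < k) g (w j).+1.
  by rewrite /wd big_map big_enum.
have wd_inj : injective wd.
  move=> w w' /eq_in_map h; apply/ffunP => j; apply/val_inj/succn_inj.
  by apply: h; rewrite mem_enum.
exists [seq wd w | w <- enum [pred w | ty w == t]]; split.
- by rewrite map_inj_uniq ?enum_uniq.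
- move=> _ /mapP[w + ->]; rewrite mem_enum inE => /eqP <-; split.
  + by rewrite size_map size_enum_ord.
  + by apply/allP => _ /mapP[j _ ->]; rewrite /= ltn_ord.
  + by rewrite prod_wd (prod_ty _ (fun i => b i.+1)).
- by rewrite big_map big_enum /=; apply: eq_bigr => w _; rewrite prod_wd.
Qed.

(** Pigeonhole: the [k]-th power of the sum expands over all words of length [k], and these fall
    into only [k.+1 ^ M] types. *)
Lemma exists_good_type (c x : R) : 0 < c -> c <= \sum_(i < M) p i.+1 * b i.+1 `^ x ->
  exists t, c ^+ k / k.+1%:R ^+ M <= type_weight t * type_value t `^ x.
Proof.
move=> c0 hc; apply: contrapT => hno.
have {}hno t : type_weight t * type_value t `^ x < c ^+ k / k.+1%:R ^+ M.
  by rewrite ltNge; apply/negP => h; apply: hno; exists t.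
have powR_prod (I : finType) (F : I -> R) : (forall i, 0 <= F i) ->
    (\prod_i F i) `^ x = \prod_i F i `^ x.
  move=> F0; have [_] : 0 <= \prod_i F i /\ (\prod_i F i) `^ x = \prod_i F i `^ x; last by [].
  elim/big_rec2: _ => [|i y1 y2 _ [y0 <-]]; first by rewrite powR1.
  by rewrite powRM// mulr_ge0.
suff : c ^+ k < c ^+ k by rewrite ltxx.
apply: (@le_lt_trans _ _ (\sum_(t : {ffun 'I_M -> 'I_k.+1}) type_weight t * type_value t `^ x)).
  apply: (@le_trans _ _ ((\sum_(i < M) p i.+1 * b i.+1 `^ x) ^+ k)).
    by rewrite lerXn2r ?nnegrE ?(ltW c0)// sumr_ge0// => i _; rewrite mulr_ge0 ?powR_ge0.
  rewrite -[X in _ ^+ X]card_ord -prodr_const bigA_distr_bigA/=.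
  rewrite (partition_big ty predT)//= ler_sum// => t _.
  rewrite /type_weight mulr_suml ler_sum// => w /eqP <-.
  rewrite big_split/= ler_wpM2l ?prodr_ge0//.
  by rewrite /type_value -prod_ty powR_prod// => j; rewrite ltW// b_gt0.
have card_t : #|{ffun 'I_M -> 'I_k.+1}|%:R = k.+1%:R ^+ M :> R.
  by rewrite card_ffun !card_ord natrX.
have -> : c ^+ k = \sum_(t : {ffun 'I_M -> 'I_k.+1}) c ^+ k / k.+1%:R ^+ M.
  by rewrite sumr_const -[RHS]mulr_natr card_t divfK// expf_neq0// pnatr_eq0.
apply: ltr_sum => //.
by apply/hasP; exists [ffun=> ord0]; rewrite ?mem_index_enum.
Qed.

End Types.

(** Append the class of value at most 1 when the running product is at least 1, and the other class
    otherwise. The product stays in a fixed window while the lower bounds multiply. *)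
Lemma greedy_class (k1 : nat) r1 B1 E1 r2 B2 E2 x c D :
  word_class k1 r1 B1 E1 -> word_class k1 r2 B2 E2 -> 0 < c ->
  D^-1 <= B1 <= 1 -> 1 <= B2 <= D -> 1 <= D ->
  c <= r1 * B1 `^ x -> c <= r2 * B2 `^ x ->
  forall n, exists r B Es, [/\ word_class (k1 * n) r B Es, D^-1 <= B <= D &
    c ^+ n <= r * B `^ x].
Proof.
move=> h1 h2 c0 /andP[B1l B1u] /andP[B2l B2u] D1 c1 c2; elim=> [|n [r [B [Es [hE /andP[Bl Bu] hr]]]]].
  exists 1, 1, [:: [::]]; rewrite muln0; split; first exact: word_class0.
    by rewrite D1 andbT invf_le1// (lt_le_trans _ D1).
  by rewrite powR1 mulr1 expr0.
have D0 : 0 < D by exact: lt_le_trans D1.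
have Di0 : 0 < D^-1 by rewrite invr_gt0.
have B0 : 0 < B by exact: lt_le_trans Bl.
have [B1'|B1'] := leP 1 B.
  exists (r * r1), (B * B1), [seq w1 ++ w2 | w1 <- Es, w2 <- E1].
  have B10 : 0 < B1 by exact: lt_le_trans B1l.
  split; first by rewrite mulnSr; exact: word_class_cat.
    apply/andP; split; first by rewrite (le_trans B1l)// ler_peMl// ltW.
    by rewrite (le_trans _ Bu)// ler_piMr// ltW.
  by rewrite exprSr powRM ?(ltW B0) ?(ltW B10)// mulrACA ler_pM ?exprn_ge0 ?(ltW c0).
exists (r * r2), (B * B2), [seq w1 ++ w2 | w1 <- Es, w2 <- E2].
have B20 : 0 < B2 by exact: lt_le_trans B2l.
split; first by rewrite mulnSr; exact: word_class_cat.
  apply/andP; split; first by rewrite (le_trans Bl)// ler_peMr// ltW.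
  by rewrite (le_trans _ B2u)// ler_piMl// ltW.
by rewrite exprSr powRM ?(ltW B0) ?(ltW B20)// mulrACA ler_pM ?exprn_ge0 ?(ltW c0).
Qed.

(* At the crossing point [x] between types with value
   below 1 and types with value above 1, alternate both so that the product of
   the values stays bounded. *)
Lemma exists_word_class (c lam : R) : 0 < c -> 0 < lam -> 1 < c * lam ->
  (forall x, 0 <= x <= 1 -> c <= \sum_(i < M) p i.+1 * b i.+1 `^ x) ->
  exists K r B Es, [/\ (0 < K)%N, word_class K r B Es, 0 < B &
    1 < r * Num.min 1 B * lam ^+ K].
Proof.
move=> c0 lam0 clam hc.
have [k [k0 hk]] := exists_expr_gt_poly M clam.
pose c1 := c ^+ k / k.+1%:R ^+ M.
have kM0 : 0 < k.+1%:R ^+ M :> R by rewrite exprn_gt0.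
have c10 : 0 < c1 by rewrite divr_gt0// exprn_gt0.
have c1lam : 1 < c1 * lam ^+ k by rewrite /c1 mulrAC -exprMn ltr_pdivlMr// mul1r.
have good x : 0 <= x <= 1 -> exists t, c1 <= @type_weight k t * type_value t `^ x.
  by move=> /hc; exact: exists_good_type.
have lamk0 : 0 < lam ^+ k by rewrite exprn_gt0.
have fin (t : {ffun 'I_M -> 'I_k.+1}) : c1 <= type_weight t * Num.min 1 (type_value t) ->
    exists K r B Es, [/\ (0 < K)%N, word_class K r B Es, 0 < B &
      1 < r * Num.min 1 B * lam ^+ K].
  move=> h; have [Es hE] := word_class_type t.
  exists k, (type_weight t), (type_value t), Es; split=> //; first exact: type_value_gt0.
  by rewrite (lt_le_trans c1lam)// ler_wpM2r// ltW.
(* [pos x]: at exponent [x] some good type has value at least 1. If this holds at 0 or fails at 1, a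
   single type is enough; otherwise it switches on between two neighbouring points of a grid of mesh
   [1 / n]. *)
pose pos (x : R) := `[< exists t : {ffun 'I_M -> 'I_k.+1},
  1 <= type_value t /\ c1 <= type_weight t * type_value t `^ x >].
have [/asboolP[t [t1 tc]]|npos0] := boolP (pos 0).
  by apply: (fin t); rewrite powRr0 in tc; rewrite min_l.
have [/asboolP pos1|npos1] := boolP (pos 1); last first.
  have [|t tc] := good 1; first by rewrite ler01 lexx.
  apply: (fin t); have t0 := type_value_gt0 t.
  have [t1|t1] := leP 1 (type_value t).
    by exfalso; move/asboolP: npos1; apply; exists t.
  by rewrite powRr1 in tc; rewrite // ltW.
pose d := \prod_(t : {ffun 'I_M -> 'I_k.+1}) Num.min 1 (type_value t).
have min0 (t : {ffun 'I_M -> 'I_k.+1}) : 0 < Num.min 1 (type_value t).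
  by rewrite lt_min ltr01 type_value_gt0.
have d0 : 0 < d by rewrite prodr_gt0.
have dle (t : {ffun 'I_M -> 'I_k.+1}) : d <= Num.min 1 (type_value t).
  rewrite /d (bigD1 t)//= ler_piMr ?(ltW (min0 _))//.
  by apply: prodr_ile1 => u _; rewrite (ltW (min0 _)) ge_min lexx.
pose rho := (c1 * lam ^+ k)^-1.
(* Raising the exponent of a type by [1 / n] costs at most a factor [d] to the power [1 / n]; this
   [n] keeps the product with [lam ^+ k] above 1. *)
have [n hn] := exists_expr_gt d^-1 c1lam.
have [n0|n0] := posnP n.
  move: hn; rewrite n0 expr0 invf_lt1// ltNge => /negP; case.
  by apply: (le_trans (dle [ffun=> ord0])); rewrite ge_min lexx.
have nR0 : 0 < n%:R :> R by rewrite ltr0n.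
have ex : exists j, (0 < j)%N && pos (j%:R / n%:R).
  by exists n; rewrite n0 divff ?gt_eqF//; apply/asboolP.
case: (ex_minnP ex) => -[//|j] /andP[_ /asboolP[t2 [t21 t2c]]] jmin.
have jn : (j < n)%N by apply: jmin; rewrite n0 divff ?gt_eqF//; apply/asboolP.
have npos : ~~ pos (j%:R / n%:R).
  case: j {t2c jn} jmin => [|j] jmin; first by rewrite mul0r.
  by apply/negP => h; have := jmin j.+1; rewrite h ltnn => /(_ isT).
have [|t1 t1c] := good (j%:R / n%:R).
  by rewrite divr_ge0//= ler_pdivrMr// mul1r ler_nat ltnW.
have t11 : type_value t1 < 1.
  rewrite ltNge; apply/negP => h; move/asboolP: npos; apply; by exists t1.
pose x : R := j.+1%:R / n%:R.
pose c2 := c1 * d `^ n%:R^-1.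
have c20 : 0 < c2 by rewrite mulr_gt0// powR_gt0.
have c2lam : 1 < c2 * lam ^+ k.
  rewrite /c2 mulrAC; set a := c1 * lam ^+ k in hn c1lam *.
  have a0 : 0 < a by exact: lt_trans c1lam.
  have an : (a ^+ n) `^ n%:R^-1 = a.
    by rewrite -powR_mulrn ?(ltW a0)// -powRrM divff ?gt_eqF// powRr1// ltW.
  rewrite -[X in X * _]an -powRM ?exprn_ge0 ?(ltW a0) ?(ltW d0)//.
  rewrite -[ltLHS](@one_powR R n%:R^-1) gt0_ltr_powR ?invr_gt0 ?nnegrE ?mulr_ge0 ?exprn_ge0 ?ler01 ?(ltW a0) ?(ltW d0)//.
  by rewrite -ltr_pdivrMr// div1r.
have dl1 : d `^ n%:R^-1 <= 1.
  rewrite -[leRHS](@one_powR R n%:R^-1) ge0_ler_powR ?nnegrE ?invr_ge0 ?ler01 ?(ltW d0)//.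
  by apply: (le_trans (dle t1)); rewrite ge_min lexx.
have t1x : c2 <= type_weight t1 * type_value t1 `^ x.
  rewrite /x -natr1 mulrDl mul1r powRD; last by rewrite (gt_eqF (type_value_gt0 _)) implybT.
  rewrite mulrA ler_pM ?powR_ge0 ?(ltW c10)//.
  rewrite ge0_ler_powR ?nnegrE ?invr_ge0 ?(ltW d0) ?(ltW (type_value_gt0 _))//.
  by apply: (le_trans (dle t1)); rewrite ge_min lexx orbT.
have t2x : c2 <= type_weight t2 * type_value t2 `^ x.
  by apply: (le_trans _ t2c); rewrite /c2 ler_piMr// ltW.
have [E1 hE1] := word_class_type t1; have [E2 hE2] := word_class_type t2.
pose D := Num.max d^-1 (type_value t2).
have D1 : 1 <= D by rewrite le_max t21 orbT.
have D0 : 0 < D by exact: lt_le_trans D1.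
(* Replacing the power of [B] by [Num.min 1 B] costs at most the factor [D], whatever the length, so
   enough repetitions absorb it. *)
have [N hN] := exists_expr_gt D c2lam.
have t1b : D^-1 <= type_value t1 <= 1.
  rewrite (ltW t11) andbT invf_ple ?posrE ?type_value_gt0// le_max.
  rewrite lef_pV2 ?posrE ?type_value_gt0//.
  by rewrite (le_trans (dle t1))// ge_min lexx orbT.
have t2b : 1 <= type_value t2 <= D by rewrite t21 le_max lexx orbT.
have [r [B [Es [hE /andP[Bl Bu] hr]]]] := greedy_class hE1 hE2 c20 t1b t2b D1 t1x t2x N.
have B0 : 0 < B by rewrite (lt_le_trans _ Bl)// invr_gt0.
have [N0|N0] := posnP N; first by move: hN; rewrite N0 expr0 ltNge D1.
exists (k * N)%N, r, B, Es; split=> //; first by rewrite muln_gt0 k0.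
have x01 : 0 <= x <= 1 by rewrite divr_ge0//= ler_pdivrMr// mul1r ler_nat.
have r0 : 0 < r.
  have := lt_le_trans (exprn_gt0 N c20) hr; rewrite pmulr_lgt0// powR_gt0//.
have key : r * B `^ x <= r * Num.min 1 B * D.
  rewrite -mulrA ler_wpM2l ?(ltW r0)//; have [B1|B1] := leP 1 B.
    rewrite mul1r (le_trans _ Bu)// -[leRHS]powRr1 ?(ltW B0)// ler_powR//.
    by case/andP: x01.
  apply: (@le_trans _ _ 1); last by rewrite -ler_pdivrMr// div1r.
  rewrite -[leRHS](@one_powR R x) ge0_ler_powR ?nnegrE ?ler01 ?(ltW B0) ?(ltW B1)//.
  by case/andP: x01.
rewrite -(ltr_pM2r D0) mul1r mulrAC (lt_le_trans hN)// exprMn exprM.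
by apply: ler_wpM2r; [rewrite exprn_ge0// ltW|exact: le_trans hr key].
Qed.

End WordClasses.

(** * Means of independent edge ratios *)

Section Mean.
Context d (T : measurableType d) (R : realType) (P : probability T R).

Definition has_mean (Y : T -> R) (e : R) : Prop :=
  P.-integrable [set: T] (EFin \o Y) /\ (\int[P]_w (Y w)%:E)%E = e%:E.

Lemma eq_has_mean (Y Z : T -> R) e : Y =1 Z -> has_mean Y e -> has_mean Z e.
Proof. by move=> /funext ->. Qed.

Lemma has_mean_cst c : has_mean (cst c) c.
Proof.
split; first exact: finite_measure_integrable_cst.
rewrite -[LHS]/(\int[P]_w cst c%:E w)%E integral_cst// -[RHS]mule1.
by congr (_ * _)%E; exact: probability_setT.
Qed.

Lemma has_meanD Y Z e f : has_mean Y e -> has_mean Z f ->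
  has_mean (fun w => Y w + Z w) (e + f).
Proof.
move=> [iY eY] [iZ eZ]; split.
  rewrite (_ : EFin \o _ = (EFin \o Y \+ (EFin \o Z))%E); last exact/funext.
  exact: (integrableD measurableT iY iZ).
by under eq_integral do rewrite EFinD; rewrite integralD// eY eZ.
Qed.

Lemma has_meanZ c Y e : has_mean Y e -> has_mean (fun w => c * Y w) (c * e).
Proof.
move=> [iY eY]; split.
  rewrite (_ : EFin \o _ = (fun w => c%:E * (EFin \o Y) w)%E); last exact/funext.
  exact: (integrableZl measurableT c iY).
by under eq_integral do rewrite EFinM; rewrite integralZl// eY.
Qed.

Lemma has_mean_sum (I : eqType) (r : seq I) (p : pred I) (Y : I -> T -> R) (e : I -> R) :
  (forall i, i \in r -> p i -> has_mean (Y i) (e i)) ->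
  has_mean (fun w => \sum_(i <- r | p i) Y i w) (\sum_(i <- r | p i) e i).
Proof.
elim: r => [|i r IH] h.
  by rewrite big_nil; apply: eq_has_mean (has_mean_cst 0) => w; rewrite big_nil.
have {}IH := IH (fun j jr => h j (mem_behead (s := i :: r) jr)).
rewrite big_cons; case: ifP => pi.
  apply: eq_has_mean (has_meanD (h i (mem_head _ _) pi) IH) => w.
  by rewrite big_cons pi.
by apply: eq_has_mean IH => w; rewrite big_cons pi.
Qed.

Lemma has_mean_le Y Z e f : has_mean Y e -> has_mean Z f ->
  (forall w, Y w <= Z w) -> e <= f.
Proof.
move=> [iY eY] [iZ eZ] YZ; rewrite -lee_fin -eY -eZ.
by apply: le_integral => // w _; rewrite lee_fin.
Qed.

Lemma has_mean_measurable Y e : has_mean Y e -> measurable_fun [set: T] Y.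
Proof. by move=> [/measurable_int h _]; apply/measurable_EFinP. Qed.

Lemma measurable_pred (f : T -> bool) : measurable_fun [set: T] f ->
  measurable [set w | f w].
Proof.
move=> mf; have := mf measurableT [set true] I; rewrite setTI.
by rewrite (_ : f @^-1` [set true] = [set w | f w])//; apply/seteqP; split => w /=.
Qed.

Lemma has_mean_pred (f : T -> bool) e : measurable_fun [set: T] f ->
  P [set w | f w] = e%:E -> has_mean (fun w => (f w)%:R) e.
Proof.
move=> /measurable_pred mf Pf.
have fE : (fun w => (f w)%:R) = \1_[set w | f w] :> (T -> R).
  by apply/funext => w; rewrite indicE mem_setE.
rewrite fE; split.
  exact: integrable_indic.
by rewrite integral_indic// setIT.
Qed.

Lemma has_mean_of_measurable (f : T -> bool) :
  measurable_fun [set: T] (fun w => (f w)%:R : R) ->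
  has_mean (fun w => (f w)%:R) (fine (P [set w | f w])).
Proof.
move=> mf.
have mf' : measurable_fun [set: T] f.
  rewrite (_ : f = fun w => (f w)%:R == 1 :> R); last first.
    by apply/funext => w; case: (f w); rewrite /= ?eqxx// eq_sym oner_eq0.
  exact: measurable_fun_eqr.
by apply: has_mean_pred => //; rewrite fineK// fin_num_measure//; exact: measurable_pred.
Qed.

Lemma has_mean_markov (Y : T -> R) (e r : R) : has_mean Y e -> (forall w, 0 <= Y w) -> 0 < r ->
  measurable [set w | r <= Y w] /\ (P [set w | (r <= Y w)%R] <= (e / r)%:E)%E.
Proof.
move=> hY Y0 r0; have mY := has_mean_measurable hY.
have mf : measurable_fun [set: T] (fun w => r <= Y w) by apply: measurable_fun_ler.
have ms := measurable_pred mf; split=> //.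
have [x xE] : exists x, P [set w | r <= Y w] = x%:E.
  by exists (fine (P [set w | r <= Y w])); rewrite fineK// fin_num_measure.
rewrite xE lee_fin ler_pdivlMr// mulrC.
have := has_meanZ r (has_mean_pred mf xE) => h1.
apply: (has_mean_le h1 hY) => w; case: (leP r (Y w)) => h /=; first by rewrite mulr1.
by rewrite mulr0.
Qed.

End Mean.

(** At every [x], 0 included, the inverse is [x] times the power -1 of its square. *)
Lemma measurable_inv (R : realType) : measurable_fun [set: R] (@GRing.inv R).
Proof.
have -> : @GRing.inv R = fun x => x * (x * x) `^ (-1).
  apply/funext => x; rewrite powR_inv1 -?expr2 ?sqr_ge0//.
  have [->|x0] := eqVneq x 0; first by rewrite invr0 mul0r.
  by rewrite expr2 invfM mulrA divff// mul1r.
apply: measurable_funM => //.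
apply: (measurableT_comp (measurable_powR (-1))).
exact: measurable_funM.
Qed.

(** * Events of the environment and independence of blocks *)

Section Environment.
Context d (T : measurableType d) (R : realType) (P : probability T R).
Variables (V : choiceType) (adj : rel V) (o : V).
Hypothesis (Htree : is_tree adj) (Hlf : locally_finite_graph adj).
Variables (q : V -> V -> {RV P >-> R}) (a : V -> {RV P >-> R}) (A : {RV P >-> R}).
Hypothesis Hindep : independent_family P [set: V]
  (fun s => sigma_gen [set: V] (fun t => q s t : T -> R)).

Notation sp := (spath adj o).
Notation par := (parent adj o).
Notation dep := (depth adj o).

Definition edge_ratio (t : V) (w : T) : R :=
  env_ratio adj o (fun u v => q u v) (fun u => a u) t w.

Notation X := edge_ratio.

Lemma edge_ratioE t w : (2 <= dep t)%N ->
  X t w = q (par t) t w / q (par t) (par (par t)) w.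
Proof. by rewrite /X /env_ratio => ->. Qed.

Lemma edge_ratio_sigma t B : (2 <= dep t)%N -> measurable B ->
  sigma_gen [set: V] (fun u => q (par t) u : T -> R) (X t @^-1` B).
Proof.
move=> t2 mB; set G := [set E | exists i (B : set R),
  [/\ [set: V] i, measurable B & E = (q (par t) i : T -> R) @^-1` B]].
have mq u : measurable_fun [set: g_sigma_algebraType G] (q (par t) u : T -> R).
  move=> _ C mC; rewrite setTI; apply: sub_sigma_algebra.
  by exists u, C.
have : measurable_fun [set: g_sigma_algebraType G] (X t : T -> R).
  rewrite (_ : X t = fun w => q (par t) t w * (q (par t) (par (par t)) w)^-1); last first.
    by apply/funext => w; rewrite edge_ratioE.
  apply: measurable_funM; first exact: mq.
  apply: measurableT_comp (@measurable_inv R) _; exact: mq.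
by move=> /(_ measurableT _ mB); rewrite setTI.
Qed.

Lemma edge_ratio_measurable t : (2 <= dep t)%N -> measurable_fun [set: T] (X t).
Proof.
move=> t2; rewrite (_ : X t = fun w => q (par t) t w * (q (par t) (par (par t)) w)^-1); last first.
  by apply/funext => w; rewrite edge_ratioE.
apply: measurable_funM => //.
by apply: measurableT_comp (@measurable_inv R) _.
Qed.

(** Level 1 counts as irregular: its auxiliary variables have the right law but do not come from
    [q]. Only finitely many edges are lost, and independence of the transition vectors then covers
    all regular edges. *)
Definition regular t : bool := `[< (2 <= dep t)%N /\ same_law P (X t) A >].

Lemma regular_depth t : regular t -> (2 <= dep t)%N.
Proof. by move=> /asboolP[]. Qed.

Section Grid.
Variable m : nat.

Definition cell (x : R) : nat := Num.truncn (m%:R * x).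

Lemma measurable_cell i : measurable [set x | cell x = i].
Proof.
case: i => [|i].
  rewrite (_ : [set x | cell x = 0%N] = [set x | m%:R * x < 1]).
    by apply: measurable_pred; apply: measurable_fun_ltr => //; exact: measurable_funM.
  apply/seteqP; split => x /=; rewrite /cell.
    by move=> h; rewrite ltNge -truncn_gt0 h.
  by move=> h; apply/eqP; rewrite -leqn0 leqNgt truncn_gt0 -ltNge.
rewrite (_ : [set x | cell x = i.+1] =
    [set x | (i.+1%:R <= m%:R * x) && (m%:R * x < i.+2%:R)]).
  apply: measurable_pred; apply: measurable_and.
    by apply: measurable_fun_ler => //; exact: measurable_funM.
  by apply: measurable_fun_ltr => //; exact: measurable_funM.
apply/seteqP; split => x /=; rewrite /cell.
  move=> h; have x0 : 0 <= m%:R * x.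
    by rewrite ltW// (lt_le_trans ltr01)// -truncn_gt0 h.
  by rewrite -h truncn_itv.
by move=> h; apply/eqP; rewrite truncn_eq// (le_trans _ (andP h).1).
Qed.

Lemma measurable_cell_eq (f : T -> R) i : measurable_fun [set: T] f ->
  measurable_fun [set: T] (fun w => cell (f w) == i).
Proof.
move=> mf; apply: (measurable_fun_bool true); rewrite setTI.
have := mf measurableT _ (measurable_cell i); rewrite setTI.
by congr (measurable _); apply/seteqP; split => w /= /eqP.
Qed.

Definition cell_prob i : R := fine (P ((A : T -> R) @^-1` [set x | cell x = i])).

Lemma cell_prob_ge0 i : 0 <= cell_prob i.
Proof. exact: fine_ge0. Qed.

Lemma cell_probE i : P ((A : T -> R) @^-1` [set x | cell x = i]) = (cell_prob i)%:E.
Proof.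
rewrite fineK// fin_num_measure//.
have mA : measurable_fun [set: T] (A : T -> R) by [].
by have := mA measurableT _ (measurable_cell i); rewrite setTI.
Qed.

Notation Z t w := (cell (X t w)).

Definition rect (L : seq (V * nat)) (w : T) : bool := all (fun ti => Z ti.1 w == ti.2) L.

Lemma measurable_rect L : {in L, forall ti, (2 <= dep ti.1)%N} ->
  measurable_fun [set: T] (rect L).
Proof.
elim: L => [|ti L IH] h; first exact: measurable_cst.
apply: measurable_and.
  by apply: measurable_cell_eq; apply: edge_ratio_measurable; apply: h; exact: mem_head.
by apply: IH => tj tjL; apply: h; rewrite inE tjL orbT.
Qed.

(** The hypothesis on the environment is independence between vertices; distinct parents let each
    ratio be charged to its own transition vector. *)
Lemma rect_prob L : {in L, forall ti, regular ti.1} -> uniq [seq par ti.1 | ti <- L] ->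
  P [set w | rect L w] = (\prod_(ti <- L) cell_prob ti.2)%:E.
Proof.
move=> reg uL; pose ps := [seq par ti.1 | ti <- L].
have [->|L0] := eqVneq L [::].
  rewrite big_nil (_ : [set w | _] = setT) ?probability_setT//.
  by apply/seteqP; split.
have [ti0 _] : exists ti, ti \in L by case: (L) L0 => // ti l _; exists ti; exact: mem_head.
pose pick u := nth ti0 L (index u ps).
pose E u := X (pick u).1 @^-1` [set x | cell x = (pick u).2].
have pickP ti : ti \in L -> pick (par ti.1) = ti.
  move=> tiL; rewrite /pick.
  have -> : index (par ti.1) ps = index ti L.
    have iL : (index ti L < size L)%N by rewrite index_mem.
    by rewrite -{1}(nth_index ti0 tiL) -(nth_map _ (par ti.1) (fun tj => par tj.1))// index_uniq// size_map.
  exact: nth_index.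
have := Hindep (s := ps) (E := E) uL.
have hE u : u \in ps -> [set: V] u /\
    sigma_gen [set: V] (fun t => q u t : T -> R) (E u).
  move=> /mapP[ti tiL ->]; split => //; rewrite /E pickP//.
  apply: edge_ratio_sigma; last exact: measurable_cell.
  by apply: regular_depth; exact: reg.
move=> /(_ hE) h.
have -> : [set w | rect L w] = \bigcap_(i in [set` ps]) E i.
  apply/seteqP; split => w /=.
    move=> /allP hw u /= /mapP[ti tiL ->]; rewrite /E /= pickP//.
    by apply/eqP; exact: hw.
  move=> hw; apply/allP => ti tiL; apply/eqP.
  by have := hw (par ti.1); rewrite /E /= pickP//; apply; apply: map_f.
rewrite h /ps big_map (eq_big_seq (fun ti => (cell_prob ti.2)%:E)); last first.
  move=> ti tiL; rewrite /E pickP//; have /asboolP[_ law] := reg _ tiL.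
  by rewrite law ?cell_probE//; exact: measurable_cell.
by elim: (L) => [|ti l IH]; rewrite ?big_nil// !big_cons IH EFinM.
Qed.

(** Weights 1 give the indicator that the block spells a word of [Es]; one-letter words weighted by
    powers give rounded moments. *)
Definition block_fun (Es : seq (seq nat)) (wt : seq nat -> R) (b : seq V) (w : T) : R :=
  \sum_(e <- Es) wt e * ([seq Z t w | t <- b] == e)%:R.

Lemma rect_zip (b : seq V) (e : seq nat) w : size b = size e ->
  rect (zip b e) w = ([seq Z t w | t <- b] == e).
Proof. by elim: b e => [|t b IH] [|i e] // [/IH h]; rewrite eqseq_cons -h. Qed.

(** Induction on the blocks: expanding the function of one block over its words turns each word into
    constraints that join the rectangle [L]. *)
Lemma blocks_mean K Es wt (bs : seq (seq V)) (L : seq (V * nat)) :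
  {in Es, forall e, size e = K} -> {in bs, forall b, size b = K} ->
  {in unzip1 L ++ flatten bs, forall t, regular t} ->
  uniq [seq par t | t <- unzip1 L ++ flatten bs] ->
  has_mean P (fun w => (rect L w)%:R * \prod_(b <- bs) block_fun Es wt b w)
    ((\prod_(ti <- L) cell_prob ti.2) *
     (\sum_(e <- Es) wt e * \prod_(i <- e) cell_prob i) ^+ size bs).
Proof.
move=> sEs; elim: bs L => [|b bs IH] L sbs reg un.
  rewrite /= expr0 mulr1; have regL : {in L, forall ti, regular ti.1}.
    by move=> ti tiL; apply: reg; rewrite cats0 map_f.
  apply: (@eq_has_mean _ _ _ _ (fun w => (rect L w)%:R)).
    by move=> w; rewrite big_nil mulr1.
  apply: has_mean_pred; first by apply: measurable_rect => ti /regL/regular_depth.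
  by apply: rect_prob => //; move: un; rewrite cats0 /unzip1 -map_comp.
have sb : size b = K by apply: sbs; exact: mem_head.
have sbs' : {in bs, forall b, size b = K}.
  by move=> b' b'bs; apply: sbs; rewrite inE b'bs orbT.
set rho := \sum_(e <- Es) _.
have -> : (\prod_(ti <- L) cell_prob ti.2) * rho ^+ size (b :: bs) =
    \sum_(e <- Es) wt e * ((\prod_(ti <- zip b e ++ L) cell_prob ti.2) * rho ^+ size bs).
  rewrite exprS mulrCA [in LHS]/rho mulr_suml; apply: eq_big_seq => e /sEs eK.
  rewrite -mulrA; congr (_ * _); rewrite big_cat/= mulrA; congr (_ * _ * _).
  rewrite -(big_map (fun ti : V * nat => ti.2) predT cell_prob).
  by rewrite [map _ _](_ : _ = e)//; apply: unzip2_zip; rewrite eK sb.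
apply: (@eq_has_mean _ _ _ _ (fun w => \sum_(e <- Es) wt e *
    ((rect (zip b e ++ L) w)%:R * \prod_(b' <- bs) block_fun Es wt b' w))).
  move=> w; rewrite big_cons [block_fun Es wt b w]/block_fun mulrCA mulr_suml.
  apply: eq_big_seq => e /sEs eK; rewrite -mulrA; congr (_ * _).
  by rewrite /rect all_cat -/(rect _ w) rect_zip ?eK// -mulnb natrM mulrA.
apply: has_mean_sum => e /sEs eK _; apply: has_meanZ.
have u1 : unzip1 (zip b e ++ L) = b ++ unzip1 L.
  by rewrite /unzip1 map_cat -!/(unzip1 _) unzip1_zip// eK sb.
apply: IH => //; rewrite u1.
  move=> t tin.
  apply: reg; move: tin; rewrite /= !mem_cat => /orP[/orP[]|] ->; rewrite ?orbT//.
rewrite -(perm_uniq (s1 := [seq par t | t <- unzip1 L ++ flatten (b :: bs)]))//.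
by apply: perm_map; rewrite /= -catA perm_catCA.
Qed.

Lemma words_mean K Es (bs : seq (seq V)) :
  uniq Es -> {in Es, forall e, size e = K} -> {in bs, forall b, size b = K} ->
  {in flatten bs, forall t, regular t} -> uniq [seq par t | t <- flatten bs] ->
  has_mean P (fun w => (all (fun b => [seq Z t w | t <- b] \in Es) bs)%:R)
    ((\sum_(e <- Es) \prod_(i <- e) cell_prob i) ^+ size bs).
Proof.
move=> uEs sEs sbs reg un.
have := blocks_mean (fun=> 1) (L := [::]) sEs sbs reg un.
rewrite big_nil mul1r; under eq_bigr do rewrite mul1r.
apply: eq_has_mean => w; rewrite mul1r; elim: (bs) => [|b l IH]; first by rewrite big_nil.
rewrite big_cons IH /= -mulnb natrM; congr (_ * _); rewrite /block_fun.
under eq_bigr do rewrite mul1r; rewrite -natr_sum -big_mkcond/=.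
elim: (Es) uEs => [|e E IHE]; first by rewrite big_nil.
move=> /andP[eE /IHE h]; rewrite big_cons inE; case: eqP => [be|_]; last exact: h.
suff -> : (\sum_(i <- E | [seq Z t w | t <- b] == i) 1 = 0)%N by [].
by rewrite big1_seq// => i /andP[/eqP <-]; rewrite be (negbTE eE).
Qed.

End Grid.
End Environment.

(** * Second moment of the surviving flow *)

Lemma geometric_tail (R : realFieldType) (x : R) i m : 0 <= x -> x < 1 ->
  \sum_(i <= j < m) x ^+ j <= x ^+ i / (1 - x).
Proof.
move=> x0 x1; have y0 : 0 < 1 - x by rewrite subr_gt0.
rewrite ler_pdivlMr//; have [im|im] := leqP i m; last first.
  by rewrite big_geq 1?ltnW// mul0r exprn_ge0.
suff -> : (\sum_(i <= j < m) x ^+ j) * (1 - x) = x ^+ i - x ^+ m.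
  by rewrite lerBlDr lerDl exprn_ge0.
elim: m im => [|m IH]; first by rewrite leqn0 => /eqP ->; rewrite big_geq// mul0r subrr.
rewrite leq_eqVlt => /orP[/eqP ->|im]; first by rewrite big_geq// mul0r subrr.
by rewrite big_nat_recr//= mulrDl IH// exprSr; ring.
Qed.

Lemma sum_divn (R : pzSemiRingType) (f : nat -> R) K m : (0 < K)%N ->
  \sum_(0 <= k < m * K) f (k %/ K)%N = K%:R * \sum_(0 <= i < m) f i.
Proof.
move=> K0; elim: m => [|m IH]; first by rewrite mul0n !big_nil mulr0.
rewrite (@big_cat_nat _ _ _ (m * K)) ?leq_mul//= IH big_nat_recr//= mulrDr; congr (_ + _).
rewrite (eq_big_nat _ _ (F2 := fun=> f m)); last first.
  move=> k /andP[h1 h2]; congr f; apply/eqP; rewrite eqn_leq leq_divRL// h1 andbT.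
  by rewrite -ltnS ltn_divLR.
by rewrite sumr_const_nat mulSn addnK mulr_natl.
Qed.

Lemma sum_if_eq (R : nmodType) (I : eqType) (r : seq I) (x : I) (F : I -> R) : uniq r ->
  \sum_(t <- r | x == t) F t = if x \in r then F x else 0.
Proof.
move=> ur; case: ifP => xr; last first.
  by rewrite big1_seq// => t /andP[/eqP <-]; rewrite xr.
rewrite big_mkcond (bigD1_seq x)//= eqxx big1 ?addr0// => t tx.
by rewrite eq_sym (negbTE tx).
Qed.

Section TreeSums.
Variables (V : choiceType) (adj : rel V) (o : V).
Hypothesis (Htree : is_tree adj) (Hlf : locally_finite_graph adj).

Notation sp := (spath adj o).
Notation par := (parent adj o).
Notation dep := (depth adj o).
Notation ch := (ch adj o).
Notation lev := (lev adj o).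

Lemma mem_drop_spath l s t : (t \in drop l (sp s)) = (t \in sp s) && (l < dep t)%N.
Proof.
elim: {s}(dep s) {-2}s (erefl (dep s)) => [|k IH] s e.
  by move/eqP: e; rewrite depth_eq0// => /eqP ->; rewrite spath_root//= .
have so : s != o by rewrite -(depth_eq0 _ Htree) e.
have pk : dep (par s) = k by rewrite depth_parent// e.
rewrite (spath_parent Htree so) mem_rcons inE.
have [lk|kl] := leqP l k.
  rewrite drop_rcons; last by rewrite -/(dep _) pk.
  rewrite mem_rcons inE IH//; case: eqVneq => [->|_] //=.
  by rewrite e ltnS lk.
rewrite drop_oversize; last by rewrite size_rcons -/(dep _) pk.
rewrite in_nil; case: eqVneq => [->|_] /=; first by rewrite e ltnNge kl.
case ts: (t \in _) => //=; have := spath_mem_depth Htree ts; rewrite pk => h.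
by rewrite ltnNge (leq_trans h)// ltnW.
Qed.

Lemma parent_inj_spath s : {in sp s &, injective par}.
Proof.
move=> t t' ts ts' e.
have to := spath_mem_neq_root Htree ts; have to' := spath_mem_neq_root Htree ts'.
rewrite (spath_mem_anc Htree ts) [RHS](spath_mem_anc Htree ts').
by rewrite (depth_parentS Htree to) (depth_parentS Htree to') e.
Qed.

Lemma flatten_blocks (T : Type) (s : seq T) x K j m :
  flatten [seq take K (drop (x + i * K) s) | i <- iota j m] =
  take (m * K) (drop (x + j * K) s).
Proof.
elim: m j => [|m IH] j; first by rewrite take0.
rewrite /= IH mulSn takeD drop_drop; congr (_ ++ take _ (drop _ _)).
nia.
Qed.

Lemma sum_lev_anc (R : nmodType) l k (F : V -> V -> R) :
  \sum_(t <- lev l) \sum_(s <- lev (k + l) | iter k par s == t) F t s =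
  \sum_(s <- lev (k + l)) F (iter k par s) s.
Proof.
rewrite (exchange_big_dep predT)//=; apply: eq_big_seq => s sl.
rewrite (sum_if_eq _ (F^~ s)) ?lev_uniq//.
by rewrite (anc_lev Htree Hlf sl).
Qed.

Lemma sum_desc_children (R : nmodType) N (f : V -> R) s : (dep s < N)%N ->
  \sum_(u <- lev N | iter (N - dep s) par u == s) f u =
  \sum_(t <- ch s) \sum_(u <- lev N | iter (N - dep t) par u == t) f u.
Proof.
move=> sN; transitivity
  (\sum_(t <- ch s) \sum_(u <- lev N | iter (N - (dep s).+1) par u == t) f u); last first.
  by apply: eq_big_seq => t ts; rewrite (ch_depth Htree Hlf ts).
rewrite (exchange_big_dep predT)//= big_mkcond; apply: eq_big_seq => u uN.
rewrite (sum_if_eq _ (fun=> f u)) ?ch_uniq//.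
have e : (N - dep s = (N - (dep s).+1).+1)%N by rewrite -subSn// subSS.
rewrite e iterS mem_ch// childE//; set v := iter _ _ _.
suff -> : v != o by [].
have : v \in lev (dep s).+1.
  by apply: (anc_lev Htree Hlf); rewrite subnK.
by rewrite mem_lev// => /eqP h; rewrite -(depth_eq0 _ Htree) h.
Qed.

Lemma flow_desc (R : nmodType) N (th : V -> R) s : (dep s <= N)%N ->
  (forall s, (dep s < N)%N -> th s = \sum_(t <- ch s) th t) ->
  \sum_(u <- lev N | iter (N - dep s) par u == s) th u = th s.
Proof.
move=> + thf; elim: {s}(N - dep s)%N {-2}s (erefl (N - dep s)%N) => [|k IH] s e sN.
  have sN' : dep s = N by apply/eqP; rewrite eqn_leq sN -subn_eq0 e.
  rewrite e /=; under eq_bigl do rewrite eq_sym.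
  by rewrite sum_if_eq ?lev_uniq// mem_lev// sN' eqxx.
have sN' : (dep s < N)%N by rewrite -subn_gt0 e.
rewrite sum_desc_children// thf//; apply: eq_big_seq => t ts.
have td := ch_depth Htree Hlf ts.
by apply: IH; rewrite td// subnS e.
Qed.

End TreeSums.

Section SecondMoment.
Context d (T : measurableType d) (R : realType) (P : probability T R).
Variables (V : choiceType) (adj : rel V) (o : V).
Hypothesis (Htree : is_tree adj) (Hlf : locally_finite_graph adj).

Notation sp := (spath adj o).
Notation par := (parent adj o).
Notation dep := (depth adj o).
Notation ch := (ch adj o).
Notation lev := (lev adj o).

Variables (alive : seq V -> T -> bool) (K N0 : nat) (r : R).
Hypotheses (K0 : (0 < K)%N) (N00 : (0 < N0)%N) (r0 : 0 < r).
Hypothesis blocks_indep : forall bs : seq (seq V),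
  {in bs, forall b, size b = K} -> {in flatten bs, forall t, (N0 < dep t)%N} ->
  uniq [seq par t | t <- flatten bs] ->
  has_mean P (fun w => (all (alive^~ w) bs)%:R) (r ^+ size bs).

Variables (n : nat) (l c : R) (th : V -> R).
Hypotheses (n0 : (0 < n)%N) (l0 : 0 < l) (l1 : l <= 1) (c0 : 0 <= c).
Let N := (N0 + n * K)%N.
Hypotheses (th_root : th o = c) (th_ge0 : forall s, 0 <= th s).
Hypothesis th_le : forall s, s != o -> (dep s <= N)%N -> th s <= l ^+ dep s.
Hypothesis th_flow : forall s, (dep s < N)%N -> th s = \sum_(t <- ch s) th t.

Definition block (s : V) (i : nat) : seq V := take K (drop (N0 + i * K) (sp s)).
Definition survives (s : V) (w : T) : bool :=
  all (alive^~ w) [seq block s i | i <- iota 0 n].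

Let anc j s := iter (N - j) par s.
Let level j := (N0 + j * K)%N.
Let common j s t := anc (level j) s == anc (level j) t.

Let size_blocks s j m : s \in lev N -> (j + m <= n)%N ->
  {in [seq block s i | i <- iota j m], forall b, size b = K}.
Proof.
rewrite mem_lev// => /eqP sN jm _ /mapP[i + ->]; rewrite mem_iota => /andP[ji im].
have iK : (i.+1 * K <= n * K)%N by rewrite leq_mul2r (leq_trans im)// orbT.
rewrite /block size_take size_drop -/(dep s) sN /N.
by rewrite mulSn in iK; case: ltnP => //; lia.
Qed.

Let flatten_block s j : s \in lev N -> (j <= n)%N ->
  flatten [seq block s i | i <- iota j (n - j)] = drop (level j) (sp s).
Proof.
rewrite mem_lev// => /eqP sN jn; rewrite (flatten_blocks (sp s) N0 K).
rewrite take_oversize// size_drop -/(dep s) sN /N mulnBl; lia.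
Qed.

Let anc_lev_level j s : s \in lev N -> (j <= N)%N -> anc j s \in lev j.
Proof. by move=> sN jN; apply: (anc_lev Htree Hlf); rewrite subnK. Qed.

Let anc_anc i j s : (i <= j <= N)%N -> anc i s = iter (j - i) par (anc j s).
Proof. by move=> /andP[ij jN]; rewrite /anc -iterD; congr (iter _ par s); lia. Qed.

Let level_le j : (j <= n)%N -> (level j <= N)%N.
Proof. by move=> jn; rewrite /level /N leq_add2l leq_mul2r jn orbT. Qed.

(** An edge of [t] below level [level j] sharing its parent with an edge of [s] would give both the
    same ancestor at that level. So all parents involved are distinct. *)
Let pair_blocks s t j : s \in lev N -> t \in lev N -> (j <= n)%N ->
  ~~ common j s t ->
  has_mean P (fun w => (survives s w &&
      all (alive^~ w) [seq block t i | i <- iota j (n - j)])%:R) (r ^+ (n + (n - j))).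
Proof.
move=> sN tN jn nc; pose bs := [seq block s i | i <- iota 0 n] ++ [seq block t i | i <- iota j (n - j)].
have fE : flatten bs = drop N0 (sp s) ++ drop (level j) (sp t).
  rewrite flatten_cat flatten_block// -[X in iota 0 X]subn0 flatten_block//.
  by rewrite /level mul0n addn0.
have sz : size bs = (n + (n - j))%N by rewrite size_cat !size_map !size_iota.
rewrite -sz; apply: (@eq_has_mean _ _ _ P (fun w => (all (alive^~ w) bs)%:R)).
  by move=> w; rewrite /bs all_cat.
apply: blocks_indep.
- move=> b; rewrite mem_cat => /orP[]; first by apply: size_blocks; rewrite ?add0n.
  by apply: size_blocks => //; rewrite subnKC.
- move=> u; rewrite fE mem_cat !mem_drop_spath// => /orP[/andP[]//|/andP[_]].
  by apply: leq_ltn_trans; rewrite leq_addr.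
rewrite fE map_cat cat_uniq.
have und k u : uniq [seq par t' | t' <- drop k (sp u)].
  rewrite map_inj_in_uniq ?drop_uniq//; last first.
    by move=> x y /mem_drop hx /mem_drop hy; exact: (parent_inj_spath Htree hx hy).
  by have [_ _ /andP[]] := spath_spec o Htree u.
rewrite !und andbT /=; apply/hasPn => _ /mapP[v + ->].
rewrite mem_drop_spath// => /andP[vt vj]; apply/negP => /mapP[u].
rewrite mem_drop_spath// => /andP[us _] puv.
move/negP: nc; apply.
move: sN tN; rewrite !mem_lev// => /eqP sN /eqP tN.
have vo := spath_mem_neq_root Htree vt; have uo := spath_mem_neq_root Htree us.
have duv : dep u = dep v by rewrite (depth_parentS Htree vo) puv -depth_parentS.
have dvN : (dep v <= N)%N by rewrite -tN (spath_mem_depth Htree vt).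
have ancv : par v = anc (dep v).-1 t.
  rewrite {1}(spath_mem_anc Htree vt) -iterS /anc tN; congr (iter _ par t).
  by move: vj; case: (dep v) dvN => //= k; lia.
have ancu : par u = anc (dep v).-1 s.
  rewrite {1}(spath_mem_anc Htree us) -iterS /anc sN duv; congr (iter _ par s).
  by move: vj; case: (dep v) dvN => //= k; lia.
have hl : (level j <= (dep v).-1 <= N)%N by move: vj dvN; case: (dep v) => //= k; lia.
by rewrite /common !(anc_anc _ hl) -ancu -ancv puv.
Qed.

Let survives_mean s : s \in lev N -> has_mean P (fun w => (survives s w)%:R) (r ^+ n).
Proof.
move=> sN; have sz : size [seq block s i | i <- iota 0 n] = n by rewrite size_map size_iota.
rewrite -[X in _ ^+ X]sz; apply: blocks_indep.
- by apply: size_blocks; rewrite ?add0n.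
- move=> u; rewrite -[X in iota 0 X]subn0 flatten_block// mem_drop_spath// => /andP[_].
  by rewrite /level mul0n addn0.
rewrite -[X in iota 0 X]subn0 flatten_block// map_inj_in_uniq ?drop_uniq//; last first.
  by move=> x y /mem_drop hx /mem_drop hy; exact: (parent_inj_spath Htree hx hy).
by have [_ _ /andP[]] := spath_spec o Htree s.
Qed.

Let r1 s : s \in lev N -> r <= 1.
Proof.
move=> sN.
have h : has_mean P (fun w => (all (alive^~ w) [:: block s 0])%:R) (r ^+ 1).
  have := @blocks_indep [:: block s 0]; apply.
  - move=> b; rewrite inE => /eqP ->.
    by apply: (@size_blocks s 0 n) => //; apply: map_f; rewrite mem_iota.
  - move=> u; rewrite /= cats0 => /mem_take; rewrite mem_drop_spath// => /andP[_].
    by rewrite mul0n addn0.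
  rewrite /= cats0 map_inj_in_uniq; last first.
    by move=> x y /mem_take/mem_drop hx /mem_take/mem_drop hy; exact: (parent_inj_spath Htree hx hy).
  by rewrite take_uniq// drop_uniq//; have [_ _ /andP[]] := spath_spec o Htree s.
rewrite expr1 in h; apply: (has_mean_le h (has_mean_cst P 1)) => w /=.
by case: (_ && _).
Qed.

Let both s t w := survives s w && survives t w.
Let pr s t := fine (P [set w | both s t w]).

Let both_mean s t : s \in lev N -> t \in lev N ->
  has_mean P (fun w => (both s t w)%:R) (pr s t).
Proof.
move=> sN tN; apply: has_mean_of_measurable.
rewrite (_ : (fun w => _) = (fun w => (survives s w)%:R * (survives t w)%:R)); last first.
  by apply/funext => w; rewrite /both -mulnb natrM.
apply: measurable_funM; exact: has_mean_measurable (survives_mean _).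
Qed.

Let pr_le s t e (Q : T -> bool) : s \in lev N -> t \in lev N ->
  has_mean P (fun w => (Q w)%:R) e -> (forall w, both s t w -> Q w) -> pr s t <= e.
Proof.
move=> sN tN hQ h; apply: (has_mean_le (both_mean sN tN) hQ) => w.
by rewrite ler_nat; case: (both s t w) (h w) => // ->.
Qed.

(** Bounds joint survival divided by [r ^+ (2 * n)]. If the ancestors agree at [level j] but not at
    [level j.+1], block [j] of [t] may be partly shared and is given up, hence the exponent [j.+1].
    Summing over all common [j] avoids naming the last one. *)
Let corr i s t : R := \sum_(i <= j < n.+1) (common j s t)%:R * r^-1 ^+ j.+1.

Let corr_ge0 i s t : 0 <= corr i s t.
Proof. by rewrite sumr_ge0// => j _; rewrite mulr_ge0// exprn_ge0// invr_ge0 ltW. Qed.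

Let corr_ge i j s t : (i <= j <= n)%N -> common j s t -> r^-1 ^+ j.+1 <= corr i s t.
Proof.
move=> /andP[ij jn] cj; rewrite /corr (@big_cat_nat _ _ _ j)//=; last exact: leqW.
rewrite [X in _ + X]big_ltn// cj mul1r addrCA lerDl addr_ge0// sumr_ge0// => k _.
  by rewrite mulr_ge0// exprn_ge0// invr_ge0 ltW.
by rewrite mulr_ge0// exprn_ge0// invr_ge0 ltW.
Qed.

(** Induction moves [i] to the last common level, below which the blocks of [t] after block [i] are
    independent of those of [s]. If even level [N] is common, [r <= 1] pays for the surplus factor
    [r^-1]. *)
Let pr_common i s t : s \in lev N -> t \in lev N -> (i <= n)%N -> common i s t ->
  pr s t <= r ^+ (2 * n) * corr i s t.
Proof.
move=> sN tN; have [m mE] : exists m, (n - i)%N = m by exists (n - i)%N.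
elim: m i mE => [|m IH] i mE i_le ci.
  have {}mE : i = n by lia.
  apply: (@le_trans _ _ (r ^+ n)); first by apply: (pr_le sN tN (survives_mean sN)) => w /andP[].
  apply: (@le_trans _ _ (r ^+ (2 * n) * r^-1 ^+ n.+1)); last first.
    by rewrite ler_wpM2l ?exprn_ge0 ?(ltW r0)// corr_ge// ?mE ?leqnn// -mE.
  rewrite mul2n -addnn exprD -mulrA ler_peMr ?exprn_ge0 ?(ltW r0)//.
  rewrite exprS mulrCA -exprMn divff ?gt_eqF// expr1n mulr1 invf_ge1//; exact: r1 sN.
have iln : (i < n)%N by lia.
have [ci1|ci1] := boolP (common i.+1 s t).
  apply: (le_trans (IH i.+1 _ _ ci1)) => //; first lia.
  rewrite ler_wpM2l ?exprn_ge0 ?(ltW r0)// /corr [leRHS]big_ltn ?ltnS// lerDr.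
  by rewrite mulr_ge0// exprn_ge0// invr_ge0 ltW.
apply: (@le_trans _ _ (r ^+ (n + (n - i.+1)))).
  apply: (pr_le sN tN (pair_blocks sN tN iln ci1)) => w /andP[-> ht] /=.
  move/allP: ht => ht; apply/allP => _ /mapP[k + ->]; rewrite mem_iota => /andP[_ kn].
  by apply: ht; apply: map_f; rewrite mem_iota /= add0n; lia.
apply: (@le_trans _ _ (r ^+ (2 * n) * r^-1 ^+ i.+1)); last first.
  by rewrite ler_wpM2l ?exprn_ge0 ?(ltW r0)// corr_ge// leqnn.
have -> : (2 * n = n + (n - i.+1) + i.+1)%N by lia.
by rewrite [X in _ <= X * _](exprD r (n + (n - i.+1)) i.+1) -mulrA -exprMn divff ?gt_eqF// expr1n mulr1.
Qed.

Let pr_any s t : s \in lev N -> t \in lev N ->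
  pr s t <= r ^+ (2 * n) * (1 + corr 0 s t).
Proof.
move=> sN tN; have [c0'|c0'] := boolP (common 0 s t).
  apply: (le_trans (pr_common sN tN (leq0n n) c0')).
  by rewrite ler_wpM2l ?exprn_ge0 ?(ltW r0)// lerDr.
apply: (@le_trans _ _ (r ^+ (2 * n))).
  have := pair_blocks sN tN (leq0n n) c0'; rewrite subn0 addnn -mul2n => h.
  by apply: (pr_le sN tN h) => w.
by rewrite ler_peMr ?exprn_ge0 ?(ltW r0)// lerDl.
Qed.

Let sum_th : \sum_(s <- lev N) th s = c.
Proof.
rewrite -th_root -[RHS](@flow_desc V adj o Htree Hlf R N th o) ?depth_root//.
rewrite big_seq [RHS]big_seq_cond; apply: eq_bigl => s; case sN: (s \in _) => //=.
apply/esym/eqP/eqP; rewrite -(depth_eq0 _ Htree) depth_anc// subn0.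
by move: sN; rewrite mem_lev// => /eqP ->; rewrite subnn.
Qed.

(** The vertices counted are the descendants of one ancestor, so their total flow is the flow
    through it. *)
Let sum_th_common j s : s \in lev N -> (j <= n)%N ->
  \sum_(t <- lev N | common j s t) th t <= l ^+ level j.
Proof.
move=> sN jn; have jN := level_le jn.
have aN := anc_lev_level sN jN; set u := anc (level j) s in aN.
have du : dep u = level j by move: aN; rewrite mem_lev// => /eqP.
have -> : \sum_(t <- lev N | common j s t) th t = th u.
  rewrite -[RHS](@flow_desc V adj o Htree Hlf R N th u) ?du//.
  by apply: eq_bigl => t; rewrite /common eq_sym.
rewrite -du; apply: th_le; last by rewrite du.
by rewrite -(depth_eq0 _ Htree) du /level addn_eq0 negb_and -lt0n N00.
Qed.

Let x : R := r^-1 * l ^+ K.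
Hypothesis x1 : x < 1.

Let x_ge0 : 0 <= x.
Proof. by rewrite mulr_ge0 ?exprn_ge0 ?invr_ge0 ?ltW. Qed.

(** The factor [l ^+ N0] makes this small when the blocks start far from the root. *)
Let M : R := c * (l ^+ N0 / r) / (1 - x).

Let M_ge0 : 0 <= M.
Proof. by rewrite /M !mulr_ge0 ?invr_ge0 ?exprn_ge0 ?subr_ge0 ?(ltW x1) ?(ltW l0) ?(ltW r0). Qed.

Let sum_corr i : (i <= n)%N ->
  \sum_(s <- lev N) \sum_(t <- lev N) th s * th t * corr i s t <= M * x ^+ i.
Proof.
move=> i_le.
have -> : \sum_(s <- lev N) \sum_(t <- lev N) th s * th t * corr i s t =
    \sum_(i <= j < n.+1) r^-1 ^+ j.+1 *
      \sum_(s <- lev N) th s * \sum_(t <- lev N | common j s t) th t.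
  under [RHS]eq_bigr do rewrite mulr_sumr.
  rewrite [RHS]exchange_big/=; apply: eq_bigr => s _.
  under [LHS]eq_bigr do rewrite mulr_sumr.
  rewrite [LHS]exchange_big/=; apply: eq_bigr => j _.
  rewrite !mulr_sumr [RHS]big_mkcond; apply: eq_bigr => t _.
  by case: (common j s t); rewrite /= ?mul0r ?mulr0// mul1r; ring.
apply: (@le_trans _ _ (\sum_(i <= j < n.+1) c * (l ^+ N0 / r) * x ^+ j)).
  rewrite big_nat [leRHS]big_nat ler_sum// => j /andP[ij jn].
  apply: (@le_trans _ _ (r^-1 ^+ j.+1 * (c * l ^+ level j))).
    rewrite ler_wpM2l ?exprn_ge0 ?invr_ge0 ?(ltW r0)//.
    rewrite -sum_th mulr_suml big_seq [leRHS]big_seq ler_sum// => s sN.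
    by rewrite ler_wpM2l// sum_th_common.
  rewrite /level /x exprMn exprD exprS mulnC exprM.
  by rewrite le_eqVlt; apply/orP; left; apply/eqP; ring.
rewrite -mulr_sumr /M -[leRHS]mulrA ler_wpM2l//; last first.
  by rewrite mulrC; exact: geometric_tail.
by rewrite !mulr_ge0 ?invr_ge0 ?exprn_ge0 ?(ltW l0) ?(ltW r0).
Qed.

Definition weight (s : V) (w : T) : R := th s * (survives s w)%:R / r ^+ n.
Definition root_flow (w : T) : R := \sum_(s <- lev N) weight s w.
(** Survival is decided at level [N]; summing over the descendants there makes conservation
    automatic above it. *)
Definition flow_through (t : V) (w : T) : R :=
  \sum_(s <- lev N | iter (N - dep t) par s == t) weight s w.

Let rn0 : 0 < r ^+ n. Proof. exact: exprn_gt0. Qed.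

Let weight_mean s : s \in lev N -> has_mean P (weight s) (th s).
Proof.
move=> sN; have := has_meanZ (th s / r ^+ n) (survives_mean sN).
rewrite divfK ?gt_eqF//; apply: eq_has_mean => w; rewrite /weight; ring.
Qed.

Let weight2_mean s t : s \in lev N -> t \in lev N ->
  has_mean P (fun w => weight s w * weight t w) (th s * th t * (pr s t / r ^+ (2 * n))).
Proof.
move=> sN tN; rewrite mulrA mulrAC.
apply: eq_has_mean (has_meanZ (th s * th t / r ^+ (2 * n)) (both_mean sN tN)) => w.
rewrite /weight /both -mulnb natrM mul2n -addnn exprD invfM; ring.
Qed.

Let r2n0 : 0 < r ^+ (2 * n). Proof. exact: exprn_gt0. Qed.

Let corr_any s t : s \in lev N -> t \in lev N -> pr s t / r ^+ (2 * n) <= 1 + corr 0 s t.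
Proof. by move=> sN tN; rewrite ler_pdivrMr// mulrC pr_any. Qed.

Let corr_common i s t : s \in lev N -> t \in lev N -> (i <= n)%N -> common i s t ->
  pr s t / r ^+ (2 * n) <= corr i s t.
Proof. by move=> sN tN i_le ci; rewrite ler_pdivrMr// mulrC pr_common. Qed.

Lemma total_variance :
  exists2 v, has_mean P (fun w => (root_flow w - c) ^+ 2) v & v <= M.
Proof.
exists (\sum_(s <- lev N) \sum_(t <- lev N) th s * th t * (pr s t / r ^+ (2 * n) - 1)).
  have h1 : has_mean P (fun w => \sum_(s <- lev N) \sum_(t <- lev N) weight s w * weight t w)
      (\sum_(s <- lev N) \sum_(t <- lev N) th s * th t * (pr s t / r ^+ (2 * n))).
    by apply: has_mean_sum => s sN _; apply: has_mean_sum => t tN _; exact: weight2_mean.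
  have h2 : has_mean P root_flow c.
    by rewrite -sum_th; apply: has_mean_sum => s sN _; exact: weight_mean.
  have h3 := has_meanD h1 (has_meanD (has_meanZ (- (2 * c)) h2) (has_mean_cst P (c ^+ 2))).
  have -> : \sum_(s <- lev N) \sum_(t <- lev N) th s * th t * (pr s t / r ^+ (2 * n) - 1) =
     \sum_(s <- lev N) \sum_(t <- lev N) th s * th t * (pr s t / r ^+ (2 * n)) +
     (- (2 * c) * c + c ^+ 2).
    under eq_bigr do under eq_bigr do rewrite mulrBr mulr1.
    under eq_bigr do rewrite sumrB -mulr_sumr.
    by rewrite sumrB -mulr_suml sum_th; ring.
  apply: eq_has_mean h3 => w /=.
  have -> : \sum_(s <- lev N) \sum_(t <- lev N) weight s w * weight t w = root_flow w ^+ 2.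
    by under eq_bigr do rewrite -mulr_sumr; rewrite -mulr_suml expr2.
  ring.
have := sum_corr (leq0n n); rewrite expr0 mulr1; apply: le_trans.
rewrite big_seq [leRHS]big_seq ler_sum// => s sN.
rewrite big_seq [leRHS]big_seq ler_sum// => t tN.
by rewrite ler_wpM2l ?mulr_ge0// lerBlDl corr_any.
Qed.

(** Squaring the flow through a vertex leaves pairs with the same ancestor at level [j], which share
    the first [(j - N0) %/ K] blocks. Before the blocks start there is no decay, whence the term
    [c ^+ 2]. *)
Let level_energy j : (j <= N)%N -> exists2 g,
  has_mean P (fun w => \sum_(t <- lev j) flow_through t w ^+ 2) g &
  g <= (j < N0)%N%:R * c ^+ 2 + M * x ^+ ((j - N0) %/ K).
Proof.
move=> jN.
pose F (f : V -> V -> R) := \sum_(s <- lev N) \sum_(t <- lev N | anc j t == anc j s) f s t.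
have FE (f : V -> V -> R) : \sum_(u <- lev j) \sum_(s <- lev N | anc j s == u)
    \sum_(t <- lev N | anc j t == u) f s t = F f.
  have := @sum_lev_anc V adj o Htree Hlf R j (N - j) (fun u s => \sum_(t <- lev N | anc j t == u) f s t).
  by rewrite subnK.
exists (F (fun s t => th s * th t * (pr s t / r ^+ (2 * n)))).
  have h : has_mean P (fun w => F (fun s t => weight s w * weight t w))
      (F (fun s t => th s * th t * (pr s t / r ^+ (2 * n)))).
    by apply: has_mean_sum => s sN _; apply: has_mean_sum => t tN _; exact: weight2_mean.
  apply: eq_has_mean h => w; rewrite -FE; apply: eq_big_seq => u.
  rewrite mem_lev// => /eqP du; rewrite /flow_through du expr2 mulr_suml.
  by apply: eq_bigr => s _; rewrite mulr_sumr.
have drop_cond (f : V -> V -> R) : (forall s t, s \in lev N -> t \in lev N -> 0 <= f s t) ->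
    F f <= \sum_(s <- lev N) \sum_(t <- lev N) f s t.
  move=> f0; rewrite /F big_seq [leRHS]big_seq ler_sum// => s sN.
  rewrite [leRHS](bigID (fun t => anc j t == anc j s))/= lerDl.
  by rewrite big_seq_cond sumr_ge0// => t /andP[tN _]; exact: f0.
have Fle (f g : V -> V -> R) : (forall s t, s \in lev N -> t \in lev N ->
    anc j t = anc j s -> f s t <= g s t) -> F f <= F g.
  move=> fg; rewrite /F big_seq [leRHS]big_seq ler_sum// => s sN.
  by rewrite big_seq_cond [leRHS]big_seq_cond ler_sum// => t /andP[tN /eqP e]; exact: fg.
have [jN0|N0j] := ltnP j N0.
  rewrite mul1r (_ : (j - N0 = 0)%N); last by apply/eqP; rewrite subn_eq0 ltnW.
  rewrite div0n.
  apply: (@le_trans _ _ (F (fun s t => th s * th t * (1 + corr 0 s t)))).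
    by apply: Fle => s t sN tN _; rewrite ler_wpM2l ?mulr_ge0// corr_any.
  apply: (le_trans (drop_cond _ _)).
    by move=> s t _ _; rewrite !mulr_ge0 ?addr_ge0.
  under eq_bigr do under eq_bigr do rewrite mulrDr mulr1.
  under eq_bigr do rewrite big_split/= -mulr_sumr.
  by rewrite big_split/= -mulr_suml sum_th -expr2 lerD2l sum_corr.
rewrite mul0r add0r; set i := ((j - N0) %/ K)%N.
have iK : (i * K <= j - N0)%N by exact: leq_trunc_div.
have i_le : (i <= n)%N.
  rewrite -(leq_pmul2r K0); apply: (leq_trans iK); rewrite leq_subLR; exact: jN.
apply: (@le_trans _ _ (F (fun s t => th s * th t * corr i s t))).
  apply: Fle => s t sN tN e; rewrite ler_wpM2l ?mulr_ge0// corr_common//.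
  have ij : (level i <= j <= N)%N.
    rewrite jN andbT; apply: (@leq_trans (N0 + (j - N0))); last by rewrite subnKC.
    by rewrite leq_add2l.
  by rewrite /common !(anc_anc _ ij) e.
apply: (le_trans (drop_cond _ _)); first by move=> s t _ _; rewrite !mulr_ge0.
exact: sum_corr.
Qed.

(** The number [b] stands for the lower bound on conductances gained per block, so the energy series
    has ratio [x / b]. *)
Lemma total_energy (b : R) : 0 < b -> b <= 1 -> x < b ->
  exists2 g, has_mean P (fun w => \sum_(1 <= j < N.+1)
      b^-1 ^+ ((j - N0) %/ K) * \sum_(t <- lev j) flow_through t w ^+ 2) g &
    g <= N0%:R * c ^+ 2 + M * (N0%:R + K%:R / (1 - x / b)).
Proof.
move=> b0 b1 xb; pose y := x / b.
have y0 : 0 <= y by rewrite divr_ge0// ltW.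
have y1 : y < 1 by rewrite ltr_pdivrMr// mul1r.
have hg j : exists g, (j <= N)%N ->
    has_mean P (fun w => \sum_(t <- lev j) flow_through t w ^+ 2) g /\
    g <= (j < N0)%N%:R * c ^+ 2 + M * x ^+ ((j - N0) %/ K).
  have [jN|jN] := leqP j N; last by exists 0.
  by have [g h1 h2] := level_energy jN; exists g.
have [g gP] := choice hg.
exists (\sum_(1 <= j < N.+1) b^-1 ^+ ((j - N0) %/ K) * g j).
  apply: has_mean_sum => j; rewrite mem_index_iota => /andP[_ jN] _.
  by apply: has_meanZ; case: (gP j jN).
apply: (@le_trans _ _ (\sum_(1 <= j < N.+1) ((j < N0)%N%:R * c ^+ 2 + M * y ^+ ((j - N0) %/ K)))).
  rewrite big_nat [leRHS]big_nat ler_sum// => j /andP[_ jN].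
  have [_ h] := gP j jN.
  have bi0 : 0 <= b^-1 ^+ ((j - N0) %/ K) by rewrite exprn_ge0// invr_ge0 ltW.
  apply: (le_trans (ler_wpM2l bi0 h)); rewrite mulrDr lerD//.
    case: ltnP => jN0; last by rewrite !mul0r mulr0.
    have -> : (j - N0 = 0)%N by apply/eqP; rewrite subn_eq0 ltnW.
    by rewrite div0n expr0 mul1r.
  by rewrite mulrCA -exprMn [_ * x]mulrC.
rewrite big_split/= lerD//.
  rewrite -mulr_suml ler_wpM2r ?sqr_ge0//.
  apply: (@le_trans _ _ (\sum_(0 <= j < N.+1) (j < N0)%N%:R)).
    by rewrite [leRHS]big_ltn// lerDr.
  rewrite -natr_sum ler_nat (@big_cat_nat _ _ _ N0)//=; last exact/leqW/leq_addr.
  have z : (\sum_(N0 <= j < N.+1) (j < N0) = 0)%N.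
    by rewrite big_nat_cond big1// => j /andP[/andP[h _] _]; rewrite ltnNge h.
  rewrite z addn0.
  rewrite -[leqRHS]subn0 -[leqRHS]muln1 -sum_nat_const_nat leq_sum// => j _.
  by case: (j < N0)%N.
rewrite -mulr_sumr ler_wpM2l//.
rewrite (@big_cat_nat _ _ _ N0)//=; last exact/leqW/leq_addr.
rewrite lerD//.
  apply: (@le_trans _ _ (\sum_(0 <= j < N0) (1 : R))); last by rewrite sumr_const_nat subn0.
  rewrite [leRHS]big_ltn// -[leLHS]add0r lerD// big_nat [leRHS]big_nat ler_sum// => j.
  move=> /andP[_ jN0]; have -> : (j - N0 = 0)%N by apply/eqP; rewrite subn_eq0 ltnW.
  by rewrite div0n expr0.
rewrite -{1}[N0]add0n big_addn; under eq_bigr do rewrite addnK.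
apply: (@le_trans _ _ (\sum_(0 <= k < n.+1 * K) y ^+ (k %/ K))).
  rewrite (@big_cat_nat _ _ _ (N.+1 - N0) 0 (n.+1 * K))//=; last first.
    by rewrite /N -addnS addKn mulSn -add1n leq_add2r.
  by rewrite lerDl sumr_ge0// => j _; rewrite exprn_ge0.
rewrite (sum_divn (fun i => y ^+ i))// ler_wpM2l//.
by have := geometric_tail 0 n.+1 y0 y1; rewrite expr0 mul1r.
Qed.

End SecondMoment.

(** * Moments of A *)

(** Dominating the identity is all that is asked of the indices [e k]; it makes the grids with
    parameter [(e k).+1] arbitrarily fine. *)
Lemma bolzano_weierstrass01 (R : realType) (x : nat -> R) : (forall k, 0 <= x k <= 1) ->
  exists2 l : R, 0 <= l <= 1 & exists2 e : nat -> nat, (forall k, k <= e k)%N &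
    (fun k => x (e k)) @ \oo --> l.
Proof.
move=> x01; have [|l [l01 cl]] := @segment_compact R 0 1 (x @ \oo) _.
  by exists 0%N => // k _ /=; rewrite in_itv/= x01.
exists l; first by move: l01; rewrite /= in_itv.
have step k : exists m, (k <= m)%N /\ `|l - x m| < k.+1%:R^-1.
  have [||_ [[m km <-] hm]] := cl (x @` [set m | (k <= m)%N]) (ball l k.+1%:R^-1).
  - by exists k => // m /= km; exists m.
  - exact: nbhsx_ballx.
  - by exists m.
have [e he] := choice step; exists e => [k|]; first by case: (he k).
apply/cvgrPdist_lt => eps eps0; near=> k; have [_ /lt_le_trans] := he k; apply.
apply: ltW; near: k; exact: (near_infty_natSinv_lt (PosNum eps0)).
Unshelve. all: by end_near. Qed.

Lemma cvg_powR (R : realType) (a x : nat -> R) (b y : R) : 0 < b ->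
  a @ \oo --> b -> x @ \oo --> y -> (fun k => a k `^ x k) @ \oo --> b `^ y.
Proof.
move=> b0 ab xy.
have h : (fun k => expR (x k * ln (a k))) @ \oo --> expR (y * ln b).
  apply: continuous_cvg; first exact: continuous_expR.
  by apply: cvgM => //; apply: continuous_cvg => //; exact: continuous_ln.
have -> : b `^ y = expR (y * ln b) by rewrite /powR gt_eqF.
apply: (cvg_trans _ h); apply: near_eq_cvg; near=> k.
by rewrite /powR gt_eqF//; near: k; exact: (cvgr_gt b ab).
Unshelve. all: by end_near. Qed.

Section Fatou.
Context d (T : measurableType d) (R : realType) (P : probability T R).

Lemma fatou_bound (f : nat -> T -> R) (g : T -> R) (v : nat -> R) c :
  (forall n, measurable_fun [set: T] (f n)) -> (forall n w, 0 <= f n w) ->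
  (forall w, f^~ w @ \oo --> g w) ->
  (forall n, \int[P]_w (f n w)%:E <= (v n)%:E)%E -> v @ \oo --> c ->
  (\int[P]_w (g w)%:E <= c%:E)%E.
Proof.
move=> mf f0 fg fv vc.
have -> : (\int[P]_w (g w)%:E = \int[P]_w limn_einf (fun n => (f n w)%:E))%E.
  apply: eq_integral => w _; apply/esym.
  have h : (fun n => (f n w)%:E) @ \oo --> (g w)%:E.
    by apply: cvg_EFin; [exact: nearW|exact: fg].
  by have [-> _] := cvg_limn_einf_sup h.
apply: (le_trans (fatou P measurableT (f := fun n w => (f n w)%:E) _ _)).
- by move=> n; apply/measurable_EFinP.
- by move=> n w _; rewrite lee_fin.
rewrite limn_einf_lim.
have vc' : (fun n => (v n)%:E) @ \oo --> c%:E by apply: cvg_EFin => //; exact: nearW.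
rewrite -(cvg_lim _ vc')//; apply: lee_lim; first exact: is_cvg_einfs.
  by apply/cvg_ex; eexists; exact: vc'.
near=> n; apply: (le_trans _ (fv n)); apply: ereal_inf_lbound.
by exists n => /=.
Unshelve. all: by end_near. Qed.

End Fatou.

(** The value 0 for [y <= 0], even at exponent 0, is the limit of the grid powers. *)
Definition pos_powR (R : realType) (x y : R) : R := if 0 < y then y `^ x else 0.

Lemma pos_powR_ge0 (R : realType) (x y : R) : 0 <= pos_powR x y.
Proof. by rewrite /pos_powR; case: ifP => // _; exact: powR_ge0. Qed.

Lemma measurable_pos_powR (R : realType) (x : R) : measurable_fun [set: R] (pos_powR x).
Proof.
apply: measurable_fun_ifT; [|exact: measurable_powR|exact: measurable_cst].
apply: measurable_fun_ltr; [exact: measurable_cst|exact: measurable_id].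
Qed.

(* The largest power [(i / m) `^ x] with [i / m <= y], for [1 <= i <= m ^ 2]. *)
Definition grid_powR (R : realType) (m : nat) (x y : R) : R :=
  if (0 < cell m y <= m * m)%N then ((cell m y)%:R / m%:R) `^ x else 0.

Lemma grid_powR_ge0 (R : realType) m (x y : R) : 0 <= grid_powR m x y.
Proof. by rewrite /grid_powR; case: ifP => // _; exact: powR_ge0. Qed.

Lemma cell_le (R : realType) (m : nat) (y : R) : (0 < m)%N -> (0 < cell m y)%N ->
  (cell m y)%:R / m%:R <= y.
Proof.
move=> m0; rewrite /cell truncn_gt0 => h.
by rewrite ler_pdivrMr ?ltr0n// [leRHS]mulrC truncn_le (le_trans ler01 h).
Qed.

Lemma grid_powR_le (R : realType) m (x y : R) : (0 < m)%N -> 0 <= x ->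
  grid_powR m x y <= pos_powR x y.
Proof.
move=> m0 x0; rewrite /grid_powR; case: ifP => [/andP[c0 _]|_]; last exact: pos_powR_ge0.
have h := cell_le m0 c0; have cm : 0 < (cell m y)%:R / m%:R :> R.
  by rewrite divr_gt0// ltr0n.
rewrite /pos_powR (lt_le_trans cm h) ge0_ler_powR ?nnegrE ?(ltW cm)//.
by rewrite (le_trans (ltW cm)).
Qed.

Lemma grid_powR_cvg (R : realType) (x : nat -> R) (e : nat -> nat) (z y : R) :
  (forall k, k <= e k)%N -> x @ \oo --> z ->
  (fun k => grid_powR (e k).+1 (x k) y) @ \oo --> pos_powR z y.
Proof.
move=> ek xz; rewrite /pos_powR; case: ltP => y0; last first.
  rewrite [X in X @ _ --> _](_ : _ = cst 0); first exact: cvg_cst.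
  apply/funext => k; rewrite /grid_powR ltnNge leqn0.
  suff -> : cell (e k).+1 y = 0%N by [].
  by apply/eqP; rewrite -leqn0 leqNgt truncn_gt0 -ltNge (le_lt_trans _ ltr01)// mulr_ge0_le0.
have ev A : \forall k \near \oo, A <= (e k).+1%:R :> R.
  near=> k; apply: (@le_trans _ _ k%:R); last by rewrite ler_nat (leq_trans (ek k)).
  near: k; exact: nbhs_infty_ger.
have ay : (fun k => (cell (e k).+1 y)%:R / (e k).+1%:R) @ \oo --> y.
  apply/cvgrPdist_le => eps eps0; near=> k.
  have m0 : 0 < (e k).+1%:R :> R by rewrite ltr0n.
  have /andP[h1 h2] := truncn_itv (ltW (mulr_gt0 m0 y0)).
  rewrite /cell ger0_norm; last by rewrite subr_ge0 ler_pdivrMr// [leRHS]mulrC.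
  rewrite lerBlDl -lerBlDr ler_pdivlMr// mulrBl mulrC lerBlDr.
  apply: (le_trans (ltW h2)); rewrite -natr1 lerD2l.
  have : eps^-1 <= (e k).+1%:R by near: k; exact: ev.
  by rewrite -(ler_pM2l eps0) divff ?gt_eqF.
have := cvg_powR y0 ay xz; apply: cvg_trans; apply: near_eq_cvg; near=> k.
rewrite /grid_powR; suff -> : (0 < cell (e k).+1 y <= (e k).+1 * (e k).+1)%N by [].
have m0 : 0 < (e k).+1%:R :> R by rewrite ltr0n.
apply/andP; split.
  rewrite /cell truncn_gt0 -ler_pdivrMr// mul1r.
  by near: k; exact: ev.
rewrite -(ler_nat R) natrM.
have /andP[h1 _] := truncn_itv (ltW (mulr_gt0 m0 y0)).
apply: (le_trans h1); rewrite ler_pM2l//; near: k; exact: ev.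
Unshelve. all: by end_near. Qed.

Section Moments.
Context d (T : measurableType d) (R : realType) (P : probability T R).
Variables (V : choiceType) (adj : rel V) (o : V).
Hypothesis (Htree : is_tree adj) (Hlf : locally_finite_graph adj).
Variables (q : V -> V -> {RV P >-> R}) (a : V -> {RV P >-> R}) (A : {RV P >-> R}).
Hypothesis Hindep : independent_family P [set: V]
  (fun s => sigma_gen [set: V] (fun t => q s t : T -> R)).
Notation par := (parent adj o).
Notation X := (edge_ratio adj o q a).

Definition grid_moment (m : nat) (x : R) : R :=
  \sum_(i < m * m) cell_prob A m i.+1 * (i.+1%:R / m%:R) `^ x.

Lemma grid_sum (m : nat) (x y : R) :
  grid_powR m x y = \sum_(i < m * m) (i.+1%:R / m%:R) `^ x * (cell m y == i.+1)%:R.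
Proof.
rewrite /grid_powR; case: ifP => [/andP[]|]; case: (cell m y) => [|i]//.
  move=> _ im; rewrite (bigD1 (Ordinal im))//= eqxx mulr1 big1 ?addr0// => j ji.
  rewrite eqSS; case: eqP => [e|_]; last by rewrite mulr0.
  by move: ji; rewrite -val_eqE /= e eqxx.
  by rewrite big1// => j _; rewrite mulr0.
rewrite ltnS /= => /negbT im; rewrite big1// => j _; rewrite eqSS.
case: eqP => [e|_]; last by rewrite mulr0.
by move: im; rewrite e ltn_ord.
Qed.

Lemma grid_mean m x : has_mean P (fun w => grid_powR m x (A w)) (grid_moment m x).
Proof.
apply: (@eq_has_mean _ _ _ _ (fun w => \sum_(i < m * m)
    (i.+1%:R / m%:R) `^ x * (cell m (A w) == i.+1)%:R)).
  by move=> w; rewrite grid_sum.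
rewrite /grid_moment; apply: has_mean_sum => i _ _; rewrite [X in has_mean P _ X]mulrC; apply: has_meanZ.
apply: has_mean_pred; first exact: measurable_cell_eq.
rewrite -cell_probE; congr (P _); apply/seteqP; split => w /=; first by move/eqP.
by move=> ->.
Qed.

Definition moment (x : R) : \bar R := (\int[P]_w (pos_powR x (A w))%:E)%E.

(** Compactness in the exponent while the grid is refined. It shows that the minimal moment is
    attained and, by contraposition, that a single grid works for all exponents. *)
Lemma fatou_moment c :
  (forall k : nat, exists x, 0 <= x <= 1 /\ grid_moment k.+1 x <= c + k.+1%:R^-1) ->
  exists x, 0 <= x <= 1 /\ (moment x <= c%:E)%E.
Proof.
move=> /choice[x hx]; have [|z z01 [e ek xz]] := @bolzano_weierstrass01 R x.
  by move=> k; case: (hx k).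
exists z; split=> //; rewrite /moment.
apply: (@fatou_bound _ _ _ P (fun k w => grid_powR (e k).+1 (x (e k)) (A w))
  (fun w => pos_powR z (A w)) (fun k => c + k.+1%:R^-1)).
- by move=> k; exact: has_mean_measurable (grid_mean _ _).
- by move=> k w; exact: grid_powR_ge0.
- by move=> w; exact: grid_powR_cvg.
- move=> k; have [_ ->] := grid_mean (e k).+1 (x (e k)).
  rewrite lee_fin; have [_ /le_trans] := hx (e k); apply.
  by rewrite lerD2l lef_pV2 ?posrE ?ltr0n// ler_nat ltnS.
- rewrite -[X in _ --> X]addr0; apply: cvgD; first exact: cvg_cst.
  exact: cvg_harmonic.
Qed.

Lemma grid_moment_le m x : (0 < m)%N -> 0 <= x -> ((grid_moment m x)%:E <= moment x)%E.
Proof.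
move=> m0 x0; have [_ <-] := grid_mean m x; apply: ge0_le_integral => //.
- by move=> w _; rewrite lee_fin grid_powR_ge0.
- by apply/measurable_EFinP; exact: has_mean_measurable (grid_mean _ _).
- apply/measurable_EFinP; apply: measurableT_comp => //; exact: measurable_pos_powR.
- by move=> w _; rewrite lee_fin grid_powR_le.
Qed.

(** Independence has been exploited for cells only. The product formula holds for grid powers, with
    every edge a block of length 1, and Fatou carries the upper bound to the limit. *)
Lemma prod_moment_le (x p : R) (S : seq V) : 0 <= x -> (moment x <= p%:E)%E ->
  {in S, forall t, regular adj o q a A t} -> uniq [seq par t | t <- S] ->
  (\int[P]_w (\prod_(t <- S) pos_powR x (X t w))%:E <= (p ^+ size S)%:E)%E.
Proof.
move=> x0 hp reg un.
pose Es m : seq (seq nat) := [seq [:: i.+1] | i : 'I_(m * m)].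
pose wt m (e : seq nat) : R := ((head 0%N e)%:R / m%:R) `^ x.
have bE m t w : block_fun adj o q a m (Es m) (wt m) [:: t] w = grid_powR m x (X t w).
  rewrite /block_fun /Es big_map big_enum/= grid_sum; apply: eq_bigr => i _.
  by rewrite /wt /= eqseq_cons andbT.
have mean k : has_mean P (fun w => \prod_(t <- S) grid_powR k.+1 x (X t w))
    (grid_moment k.+1 x ^+ size S).
  have h := @blocks_mean _ _ _ P _ adj o q a A Hindep k.+1 1 (Es k.+1) (wt k.+1)
    [seq [:: t] | t <- S] [::].
  have fS : flatten [seq [:: t] | t <- S] = S.
    by elim: (S) => //= t l ->.
  have {}h := h _ _ _ _.
  have -> : grid_moment k.+1 x ^+ size S = (\prod_(ti <- [::] : seq (V * nat)) cell_prob A k.+1 ti.2) *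
      (\sum_(e <- Es k.+1) wt k.+1 e * \prod_(i <- e) cell_prob A k.+1 i) ^+ size [seq [:: t] | t <- S].
    rewrite big_nil mul1r size_map; congr (_ ^+ _); rewrite /Es big_map big_enum/=.
    by apply: eq_bigr => i _; rewrite big_seq1 mulrC.
  apply: eq_has_mean (h _ _ _ _).
  - by move=> w; rewrite mul1r big_map; apply: eq_bigr => t _; rewrite bE.
  - by move=> e /mapP[i _ ->].
  - by move=> b /mapP[t _ ->].
  - by rewrite fS.
  - by rewrite fS.
apply: (@fatou_bound _ _ _ P (fun k w => \prod_(t <- S) grid_powR k.+1 x (X t w))
  (fun w => \prod_(t <- S) pos_powR x (X t w)) (fun=> p ^+ size S)).
- by move=> k; exact: has_mean_measurable (mean k).
- by move=> k w; rewrite prodr_ge0// => t _; exact: grid_powR_ge0.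
- move=> w; elim: (S) => [|t l IH].
    by rewrite big_nil; under eq_fun do rewrite big_nil; exact: cvg_cst.
  rewrite big_cons; under eq_fun do rewrite big_cons; apply: cvgM => //.
  by apply: (grid_powR_cvg (x := fun=> x) (e := id)) => //; exact: cvg_cst.
- move=> k; have [_ ->] := mean k; rewrite lee_fin lerXn2r ?nnegrE//.
  + by rewrite sumr_ge0// => i _; rewrite mulr_ge0 ?cell_prob_ge0 ?powR_ge0.
  + by have := le_trans (grid_moment_le (ltn0Sn 0) x0) hp; rewrite lee_fin; apply: le_trans; rewrite sumr_ge0// => i _; rewrite mulr_ge0 ?cell_prob_ge0 ?powR_ge0.
  + by have := le_trans (grid_moment_le (ltn0Sn k) x0) hp; rewrite lee_fin.
- exact: cvg_cst.
Qed.

End Moments.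

(** * The walk and its network *)

Section NetworkWalk.
Variables (R : realType) (V : choiceType) (adj : rel V) (o : V).
Hypothesis (Htree : is_tree adj) (Hlf : locally_finite_graph adj).
Variable q : V -> V -> R.
Hypothesis Hq : tree_walk adj q.

Notation sp := (spath adj o).
Notation par := (parent adj o).
Notation dep := (depth adj o).
Notation ch := (ch adj o).
Notation lev := (lev adj o).
Notation tball := (tball adj o).
Notation nb := (nb adj).

Variable X : V -> R.
Hypothesis X_gt0 : forall s, s != o -> 0 < X s.
Hypothesis XE : forall t, (2 <= dep t)%N -> X t = q (par t) t / q (par t) (par (par t)).

Definition path_weight (s : V) : R := \prod_(t <- sp s) X t.
Notation C := path_weight.

Lemma path_weight_gt0 s : 0 < C s.
Proof.
rewrite /C big_seq prodr_gt0// => t ts; apply: X_gt0.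
exact: (spath_mem_neq_root Htree ts).
Qed.

Lemma path_weight_parent s : s != o -> C s = C (par s) * X s.
Proof.
by move=> so; rewrite /C [sp s](spath_parent Htree so) -cats1 big_cat big_seq1.
Qed.

Lemma parent_nb s : s != o -> par s \in nb s.
Proof. by move=> so; rewrite mem_nb// adj_sym// adj_parent. Qed.

Lemma path_weight_child s t : s != o -> t \in ch s -> C t = C s * (q s t / q s (par s)).
Proof.
move=> so ts; have tp := ch_parent Htree Hlf ts.
rewrite path_weight_parent ?(ch_neq_root Htree Hlf ts)// tp XE ?tp//.
by rewrite (ch_depth Htree Hlf ts) ltnS lt0n depth_eq0.
Qed.

(** Away from the root, edge weights at [s] are proportional to transition probabilities, so the
    node law is harmonicity for the walk. At the root the auxiliary variables may break this
    proportionality. *)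
Lemma harmonic_of_network (f : V -> R) s : s != o ->
  C s * (f (par s) - f s) = \sum_(t <- ch s) C t * (f s - f t) ->
  f s = \sum_(t <- nb s) q s t * f t.
Proof.
move=> so h; have qp := q_gt0 Hlf Hq (parent_nb so); have C0 := path_weight_gt0 s.
have {}h : q s (par s) * (f (par s) - f s) = \sum_(t <- ch s) q s t * (f s - f t).
  have Cn : C s / q s (par s) != 0 by rewrite mulf_neq0 ?invr_neq0 ?gt_eqF.
  apply: (mulfI Cn); rewrite mulrA divfK ?gt_eqF// h mulr_sumr.
  apply: eq_big_seq => t ts; rewrite (path_weight_child so ts).
  by rewrite [q s t / _]mulrC !mulrA.
rewrite (sum_nb o)// (negbTE so).
have : \sum_(t <- nb s) q s t = 1 by exact: sum_q.
rewrite (sum_nb o)// (negbTE so) => h1.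
move: h; under [X in _ = X]eq_bigr do rewrite mulrBr.
rewrite sumrB -mulr_suml mulrBr => h2.
rewrite -[LHS]mul1r -h1 mulrDl; lra.
Qed.

Lemma recurrent_of_voltage1 : (forall s, voltage adj o C s = 1) -> recurrent q.
Proof.
have HC s : s != o -> 0 < C s by move=> _; exact: path_weight_gt0.
move=> h; apply: (@recurrent_of_voltages R V adj o Htree Hlf q Hq (volt adj o C)).
- by move=> n s; rewrite volt_ge0// volt_le1.
- by move=> n s e; rewrite /volt e ltnn.
- move=> n s /andP[s0 sn]; have so : s != o by rewrite -(depth_eq0 _ Htree) -lt0n.
  by apply: harmonic_of_network => //; exact: volt_harmonic.
- by move=> s; rewrite -(h s); exact: voltage_cvg.
Qed.

Lemma transient_of_voltage : (exists s, voltage adj o C s < 1) -> transient q.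
Proof.
have HC s : s != o -> 0 < C s by move=> _; exact: path_weight_gt0.
move=> [s s1]; apply: (@transient_of_superharmonic R V adj Htree Hlf q Hq (voltage adj o C) s o).
- by move=> t; exact: voltage_ge0.
- move=> t; have [->|to] := eqVneq t o; last first.
    by rewrite -harmonic_of_network//; exact: voltage_harmonic.
  (* At the root the voltage has its maximal value 1, so superharmonicity holds there for any
     transition probabilities. *)
  rewrite voltage_root// -(sum_q Hlf Hq o) ler_sum// => u _.
  by rewrite ler_piMr ?voltage_le1//; exact: (q_ge0 Hlf Hq).
- by rewrite voltage_root// lt_eqF.
Qed.

Lemma no_flow_conclusions : ~ admits_flow adj o C ->
  recurrent q /\ zero_conductance adj o C.
Proof.
have HC s : s != o -> 0 < C s by move=> _; exact: path_weight_gt0.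
move=> hno; have h s : voltage adj o C s = 1.
  apply/le_anti; rewrite voltage_le1//= leNgt; apply/negP => s1.
  by apply: hno; apply: voltage1_or_flow => //; exists s.
by split; [exact: recurrent_of_voltage1|exact: voltage1_zero_conductance].
Qed.

Lemma conductance_conclusions (e : R) : 0 < e ->
  (forall m, exists2 n, (m <= n)%N & e <= out_cond adj o C n o) ->
  [/\ transient q, positive_conductance adj o C & admits_flow adj o C].
Proof.
have HC s : s != o -> 0 < C s by move=> _; exact: path_weight_gt0.
move=> e0 h; have [h1 h2] := positive_conductance_of_frequently Htree Hlf HC e0 h.
by split; [exact: transient_of_voltage|exact: h1|exact: voltage1_or_flow].
Qed.

Section Positive.
(* At level 1 the weights of the edges are the transition probabilities from the
   root, so that [C] is the network of the walk itself. *)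
Hypothesis X1 : forall t, t \in ch o -> X t = q o t.

(** The total conductance at [s], recovered from the edge to the parent; at the root it is the sum
    of the [q o t], which is 1. *)
Definition stationary (s : V) : R := if s == o then 1 else C s / q s (par s).

Lemma stationary_gt0 s : 0 < stationary s.
Proof.
rewrite /stationary; case: eqVneq => // so.
by rewrite divr_gt0 ?path_weight_gt0// (q_gt0 Hlf Hq (parent_nb so)).
Qed.

Lemma path_weight_root_child t : t \in ch o -> C t = q o t.
Proof.
move=> to; rewrite path_weight_parent ?(ch_neq_root Htree Hlf to)//.
by rewrite (ch_parent Htree Hlf to) {1}/C spath_root// big_nil mul1r X1.
Qed.

Lemma stationary_child s t : t \in ch s -> stationary s * q s t = C t.
Proof.
move=> ts; rewrite /stationary; case: eqVneq => [so|so].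
  by rewrite so in ts *; rewrite mul1r path_weight_root_child.
by rewrite (path_weight_child so ts) mulrA mulrAC.
Qed.

Lemma stationary_parent s : s != o -> stationary s * q s (par s) = C s.
Proof.
move=> so; rewrite /stationary (negbTE so) divfK// gt_eqF//.
exact: (q_gt0 Hlf Hq (parent_nb so)).
Qed.

Lemma stationary_reversible s t : adj s t -> stationary s * q s t = stationary t * q t s.
Proof.
rewrite (adjE o Htree) => /orP[]; rewrite -mem_ch// => h.
  by rewrite (stationary_child h) -{1}(ch_parent Htree Hlf h) stationary_parent ?(ch_neq_root Htree Hlf h).
by rewrite (stationary_child h) -{1}(ch_parent Htree Hlf h) stationary_parent ?(ch_neq_root Htree Hlf h).
Qed.

Lemma stationary_le s : stationary s <= C s + \sum_(t <- ch s) C t.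
Proof.
rewrite -[leLHS]mulr1 -(sum_q Hlf Hq s) (sum_nb o)// mulrDr mulr_sumr.
rewrite lerD//; last by rewrite big_seq [leRHS]big_seq ler_sum// => t /stationary_child ->.
case: eqVneq => [_|so]; last by rewrite stationary_parent.
by rewrite mulr0 ltW// path_weight_gt0.
Qed.

Lemma mean_return_of_summable B : (forall n, \sum_(s <- tball n) C s <= B) ->
  forall x, (mean_return_time q x < +oo)%E.
Proof.
(* Each edge weight is counted at both of its endpoints, whence [B + B]. *)
move=> hB; apply: (@mean_return_finite R V adj o Htree Hlf q Hq stationary (B + B)).
- exact: stationary_gt0.
- exact: stationary_reversible.
move=> n; apply: (@le_trans _ _ (\sum_(s <- tball n) (C s + \sum_(t <- ch s) C t))).
  by rewrite ler_sum// => s _; exact: stationary_le.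
rewrite big_split/= lerD// (le_trans _ (hB n.+1))//.
rewrite !sum_ball// (eq_bigr (fun i => \sum_(t <- lev i.+1) C t)); last first.
  by move=> i _; rewrite sum_lev.
rewrite [leRHS]big_nat_recl// lerDr sumr_ge0// => s _; exact/ltW/path_weight_gt0.
Qed.

End Positive.
End NetworkWalk.

(** * Almost sure statements from small exceptional events *)

Section Probability.
Context d (T : measurableType d) (R : realType) (P : probability T R).

Lemma bigcup_measure_le (F : nat -> set T) (e : \bar R) :
  (forall n, measurable (F n)) -> (forall n, F n `<=` F n.+1) ->
  (forall n, P (F n) <= e)%E -> (P (\bigcup_n F n) <= e)%E.
Proof.
move=> mF Finc Fe; have nd : nondecreasing_seq F.
  by apply/nondecreasing_seqP => n; apply/subsetPset.
have h := nondecreasing_cvg_mu mF (bigcup_measurable (fun n _ => mF n)) nd (mu := P).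
rewrite -(cvg_lim _ h)//; apply: lime_le; first by apply/cvg_ex; eexists; exact: h.
by near=> n; exact: Fe.
Unshelve. all: by end_near. Qed.

(** The negligible set is an intersection of exceptional events with probabilities tending to 0, so
    measurability of [Q] itself does not enter. *)
Lemma ae_of_small (Q : T -> Prop) :
  (forall e : R, 0 < e -> exists2 B : set T, measurable B /\ (P B <= e%:E)%E &
    forall w, ~ B w -> Q w) -> {ae P, forall w, Q w}.
Proof.
move=> h; have hk k : exists B : set T, [/\ measurable B, (P B <= (k.+1%:R^-1)%:E)%E &
    forall w, ~ B w -> Q w].
  by have [|B [mB PB] BQ] := h k.+1%:R^-1; [rewrite invr_gt0 ltr0n|exists B].
have [B hB] := choice hk; exists (\bigcap_k B k); split.
- by apply: bigcap_measurable => // k _; case: (hB k).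
- apply/eqP; rewrite eq_le measure_ge0 andbT.
  apply/lee_addgt0Pr => e e0; rewrite add0e.
  have [k hk'] : exists k : nat, k.+1%:R^-1 < e.
    have [k _ /(_ k)] := near_infty_natSinv_lt (PosNum e0); rewrite /= leqnn => /(_ isT) hh.
    by exists k.
  have [mB PB _] := hB k.
  apply: (@le_trans _ _ (P (B k))).
    apply: le_measure; rewrite ?inE//; last by move=> w; exact.
    by apply: bigcap_measurable => // j _; case: (hB j).
  by apply: (le_trans PB); rewrite lee_fin ltW.
- move=> w /= nQ k _; apply: contrapT => nB; apply: nQ.
  by case: (hB k) => _ _; exact.
Qed.

Lemma has_mean_of_le (Y : T -> R) (e : R) : measurable_fun [set: T] Y ->
  (forall w, 0 <= Y w) -> (\int[P]_w (Y w)%:E <= e%:E)%E ->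
  exists2 e', has_mean P Y e' & e' <= e.
Proof.
move=> mY Y0 hY; have i0 : (0 <= \int[P]_w (Y w)%:E)%E.
  by apply: integral_ge0 => w _; rewrite lee_fin.
have fi : (\int[P]_w (Y w)%:E \is a fin_num)%E.
  by rewrite ge0_fin_numE// (le_lt_trans hY)// ltry.
exists (fine (\int[P]_w (Y w)%:E)); last by rewrite -lee_fin fineK.
split; last by rewrite fineK.
apply/integrableP; split; first exact/measurable_EFinP.
rewrite (eq_integral (fun w => (Y w)%:E)) ?ltey_eq ?fi// => w _.
by rewrite /= ger0_norm.
Qed.

End Probability.

(** * The minimal moment and its grid approximation *)

Section MinMoment.
Context d (T : measurableType d) (R : realType) (P : probability T R).
Variable A : {RV P >-> R}.
Hypothesis HA : {ae P, forall w, 0 < A w}.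
Let p := min_moment A.

Lemma moment_expectation x : 'E_P[(fun w => A w `^ x)%R]%E = moment A x.
Proof.
rewrite unlock; apply: ae_eq_integral => //.
- by apply/measurable_EFinP; exact: (measurableT_comp (measurable_powR x)).
- by apply/measurable_EFinP; exact: (measurableT_comp (measurable_pos_powR x)).
- by apply: filterS HA => w A0 _; rewrite /pos_powR A0.
Qed.

Lemma moment_ge0 x : (0 <= moment A x)%E.
Proof. by apply: integral_ge0 => w _; rewrite lee_fin pos_powR_ge0. Qed.

Let inf_moment := ereal_inf [set moment A x | x in [set x : R | 0 <= x <= 1]].

Let inf_momentE : inf_moment = p%:E.
Proof.
have h0 : (0 <= inf_moment)%E.
  by apply: le_ereal_inf_tmp => _ [x _ <-]; exact: moment_ge0.
have h1 : (inf_moment <= 1)%E.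
  apply: (@le_trans _ _ (moment A 0)); first by apply: ereal_inf_lbound; exists 0; rewrite //= lexx ler01.
  rewrite -moment_expectation (_ : (fun w => _) = cst 1); first by rewrite expectation_cst.
  by apply/funext => w; rewrite powRr0.
rewrite /p /min_moment fineK.
  by congr ereal_inf; apply/seteqP; split => _ [x x01 <-]; exists x => //; rewrite moment_expectation.
rewrite (_ : ereal_inf _ = inf_moment); first by rewrite ge0_fin_numE// (le_lt_trans h1)// ltry.
by congr ereal_inf; apply/seteqP; split => _ [x x01 <-]; exists x => //; rewrite moment_expectation.
Qed.

Lemma min_moment_le x : 0 <= x <= 1 -> (p%:E <= moment A x)%E.
Proof. by move=> x01; rewrite -inf_momentE; apply: ereal_inf_lbound; exists x. Qed.

Lemma min_moment_le1 : p <= 1.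
Proof.
rewrite -lee_fin; apply: (le_trans (min_moment_le (x := 0) _)); first by rewrite lexx ler01.
rewrite -moment_expectation (_ : (fun w => _) = cst 1); first by rewrite expectation_cst.
by apply/funext => w; rewrite powRr0.
Qed.

Lemma min_moment_attained : exists2 x, 0 <= x <= 1 & (moment A x <= p%:E)%E.
Proof.
have [|x [x01 hx]] := @fatou_moment _ _ _ P A p; last by exists x.
move=> k; have k0 : 0 < k.+1%:R^-1 :> R by rewrite invr_gt0 ltr0n.
have fin : inf_moment \is a fin_num by rewrite inf_momentE.
have [_ [x x01 <-]] := lb_ereal_inf_adherent k0 fin.
rewrite -/inf_moment inf_momentE => hx; exists x; split=> //.
have /andP[x0 _] := x01.
have := le_lt_trans (grid_moment_le A (ltn0Sn k) x0) hx.
by rewrite -EFinD lte_fin => /ltW.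
Qed.

(** A minimum 0 would be attained, so a power of [A] would vanish almost surely, against [A > 0]. *)
Lemma min_moment_gt0 : 0 < p.
Proof.
have [x x01 hx] := min_moment_attained.
have h0 : 0 <= p by rewrite -lee_fin (le_trans (moment_ge0 x)).
rewrite lt_neqAle h0 andbT; apply/eqP => p0.
have m0 : moment A x = 0%E by apply/eqP; rewrite eq_le moment_ge0 andbT; move: hx; rewrite -p0.
have mf : measurable_fun [set: T] (fun w => (pos_powR x (A w))%:E).
  by apply/measurable_EFinP; exact: (measurableT_comp (measurable_pos_powR x)).
have : (\int[P]_w `|(pos_powR x (A w))%:E| = 0)%E.
  by rewrite -[RHS]m0; apply: eq_integral => w _; rewrite gee0_abs// lee_fin pos_powR_ge0.
move=> /(ae_eq_integral_abs P measurableT mf) h.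
have [w _] : exists w : T, True.
  apply: contrapT => hno; have := probability_setT P.
  rewrite (_ : [set: T] = set0) ?measure0; first by move/eqP; rewrite eqe eq_sym oner_eq0.
  by apply/seteqP; split => w // _; case: hno; exists w.
have : {ae P, forall w : T, False}.
  apply: filterS2 HA h => v Av /(_ I) /= [].
  by rewrite /pos_powR Av => /eqP; rewrite gt_eqF// powR_gt0.
move=> [B [mB PB hB]]; have : P B = 1%E.
  rewrite -(probability_setT P); congr (P _); apply/seteqP; split => // v _.
  by apply: hB => /=.
by rewrite PB => /eqP; rewrite eqe eq_sym oner_eq0.
Qed.

(** Otherwise every grid has an exponent with grid moment below [c], and a limit point of these
    exponents would have moment at most [c < p]. *)
Lemma grid_moment_gt c : c < p ->
  exists m, (0 < m)%N /\ forall x, 0 <= x <= 1 -> c <= grid_moment A m x.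
Proof.
move=> cp; apply: contrapT => hno.
have [k|x [x01 hx]] := @fatou_moment _ _ _ P A c.
  apply: contrapT => hk; apply: hno; exists k.+1; split=> // x x01.
  rewrite leNgt; apply/negP => h; apply: hk; exists x; split=> //.
  by rewrite (le_trans (ltW h))// lerDl invr_ge0.
by have := le_trans (min_moment_le x01) hx; rewrite lee_fin leNgt cp.
Qed.

End MinMoment.

(** * Upper bounds in the random network *)

Lemma powR_prod (R : realType) (I : eqType) (r : seq I) (F : I -> R) (x : R) :
  (forall i, i \in r -> 0 <= F i) -> (\prod_(i <- r) F i) `^ x = \prod_(i <- r) F i `^ x.
Proof.
elim: r => [|i r IH] h; first by rewrite !big_nil one_powR.
have h' j : j \in r -> 0 <= F j by move=> jr; apply: h; rewrite inE jr orbT.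
rewrite !big_cons powRM ?IH//; first by apply: h; exact: mem_head.
by rewrite big_seq prodr_ge0.
Qed.

Lemma le_powR_of_lt1 (R : realType) (x c : R) : 0 <= x <= 1 -> 0 < c -> c `^ x < 1 ->
  c <= c `^ x.
Proof.
move=> /andP[x0 x1] c0 h; have c1 : c <= 1.
  rewrite leNgt; apply/negP => c1; move: h; rewrite ltNge => /negP; apply.
  by rewrite -[leLHS](@one_powR R x) ge0_ler_powR ?nnegrE ?ler01 ?(ltW c0) ?(ltW c1).
by rewrite -[leLHS]powRr1 ?(ltW c0)// ger_powR// c0 c1.
Qed.

Lemma prod_sub_le (R : realDomainType) (I : eqType) (r s : seq I) (f : I -> R) :
  uniq r -> uniq s -> {subset r <= s} -> (forall i, 1 <= f i) ->
  \prod_(i <- r) f i <= \prod_(i <- s) f i.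
Proof.
move=> ur us rs f1; have f0 i : 0 <= f i by rewrite (le_trans ler01).
have e : perm_eq [seq i <- s | i \in r] r.
  apply: uniq_perm => [||i]; [exact: filter_uniq|exact: ur|rewrite mem_filter /=].
  by case: (boolP (i \in r)) => // /rs ->.
rewrite [leRHS](bigID (mem r))/= -[X in _ <= X * _]big_filter (perm_big _ e).
rewrite ler_peMr ?prodr_ge0//.
by elim/big_ind : _ => // x y x1 y1; rewrite mulr_ege1.
Qed.

Section RandomNetwork.
Context d (T : measurableType d) (R : realType) (P : probability T R).
Variables (V : choiceType) (adj : rel V) (o : V).
Hypothesis (Htree : is_tree adj) (Hlf : locally_finite_graph adj).
Variables (q : V -> V -> {RV P >-> R}) (a : V -> {RV P >-> R}) (A : {RV P >-> R}).
Hypothesis Henv : random_environment adj o q a A.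
Hypothesis HA : {ae P, forall w, 0 < A w}.

Notation sp := (spath adj o).
Notation par := (parent adj o).
Notation dep := (depth adj o).
Notation ch := (ch adj o).
Notation lev := (lev adj o).
Notation tball := (tball adj o).
Notation X := (edge_ratio adj o q a).
Notation reg := (regular adj o q a A).
Notation walk w := (fun s t => q s t w).
Let p := min_moment A.

Definition nice (w : T) : Prop :=
  tree_walk adj (walk w) /\ forall s, s \in lev 1 -> 0 < a s w.

Lemma ae_nice : {ae P, forall w, nice w}.
Proof.
case: Henv => [Hwalk _ _ [Ha _] _].
have hA : P [set w | A w <= 0] = 0%E.
  have mA : measurable [set w | A w <= 0].
    by apply: measurable_pred; apply: measurable_fun_ler => //; exact: measurable_cst.
  case: HA => B [mB PB hB]; apply/eqP; rewrite eq_le measure_ge0 andbT -PB.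
  apply: le_measure; rewrite ?inE// => w /= Aw.
  by apply: hB => /=; apply/negP; rewrite -leNgt.
have ha s : s \in lev 1 -> {ae P, forall w, 0 < a s w}.
  rewrite mem_lev// => /eqP s1; have law := Ha s s1.
  have mle : measurable [set x : R | x <= 0].
    by apply: measurable_pred; apply: measurable_fun_ler => //; exact: measurable_cst.
  exists [set w | a s w <= 0]; split.
  - by apply: measurable_pred; apply: measurable_fun_ler => //; exact: measurable_cst.
  - by rewrite -hA; exact: (law _ mle).
  - by move=> w /= /negP; rewrite -leNgt.
suff : {ae P, forall w, forall s, s \in lev 1 -> 0 < a s w}.
  by apply: filterS2 Hwalk => w h1 h2; split.
elim: (lev 1) ha => [|s l IH] h; first exact: aeW.
have := IH (fun t tl => h t (mem_behead (s := s :: l) tl)).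
apply: filterS2 (h s (mem_head _ _)) => w h1 h2 t.
by rewrite inE => /orP[/eqP ->//|/h2].
Qed.

Lemma depth_ge2 t : t != o -> t \notin lev 1 -> (2 <= dep t)%N.
Proof.
rewrite mem_lev// -(depth_eq0 _ Htree); by case: (dep t) => [|[|k]].
Qed.

Lemma edge_ratio1 t w : dep t = 1%N -> X t w = a t w.
Proof. by move=> e; rewrite /edge_ratio /env_ratio e. Qed.

Lemma edge_ratio_gt0 w t : nice w -> t != o -> 0 < X t w.
Proof.
move=> [Hw Ha] to; have [t1|t1] := boolP (t \in lev 1).
  by rewrite edge_ratio1 ?Ha//; move: t1; rewrite mem_lev// => /eqP.
have t2 := depth_ge2 to t1; rewrite edge_ratioE//.
have po : par t != o by rewrite -(depth_eq0 _ Htree) depth_parent//; case: (dep t) t2 => [|[]].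
apply: divr_gt0.
  by apply: (q_gt0 Hlf Hw); rewrite mem_nb// adj_parent.
by apply: (q_gt0 Hlf Hw); rewrite mem_nb// adj_sym// adj_parent.
Qed.

Lemma irregular_list : exists bad : seq V, uniq bad /\
  forall t, t != o -> ~~ reg t -> t \in bad.
Proof.
case: Henv => [_ _ Hexc _ _].
exists (undup (lev 1 ++ fset_set [set s | (2 <= dep s)%N /\
  ~ same_law P (env_ratio adj o (fun u v => q u v) (fun u => a u) s) A])).
split; first exact: undup_uniq.
move=> t to nr; rewrite mem_undup mem_cat; have [//|t1] := boolP (t \in lev 1).
have t2 := depth_ge2 to t1; rewrite /= in_fset_set//; apply/mem_set => /=; split=> // h.
by move/asboolP: nr; apply.
Qed.

Let Hindep : independent_family P [set: V]
  (fun s => sigma_gen [set: V] (fun t => q s t : T -> R)).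
Proof. by case: Henv. Qed.

Section Upper.
Variable x : R.
Hypotheses (x01 : 0 <= x <= 1) (hx : (moment A x <= p%:E)%E).
Variable bad : seq V.
Hypotheses (ubad : uniq bad) (hbad : forall t, t != o -> ~~ reg t -> t \in bad).

Let x0 : 0 <= x. Proof. by case/andP: x01. Qed.
Let p0 : 0 < p. Proof. exact: min_moment_gt0. Qed.
Let p1 : p <= 1. Proof. exact: min_moment_le1. Qed.

Definition regular_power (s : V) (w : T) : R :=
  \prod_(t <- sp s | reg t) pos_powR x (X t w).
Notation D := regular_power.

Lemma regular_power_ge0 s w : 0 <= D s w.
Proof. by rewrite prodr_ge0// => t _; exact: pos_powR_ge0. Qed.

Let K1 : R := p^-1 ^+ size bad.
Let K10 : 0 < K1. Proof. by rewrite exprn_gt0// invr_gt0. Qed.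

(** At most [size bad] edges of the path are left out of the product; each missing factor [p] is
    made up for by a factor [p^-1 >= 1] of [K1]. *)
Lemma regular_power_mean s : exists2 e, has_mean P (D s) e & e <= K1 * p ^+ dep s.
Proof.
pose S := [seq t <- sp s | reg t].
have [_ _ /andP[_ us]] := spath_spec o Htree s.
have regS : {in S, forall t, reg t} by move=> t; rewrite mem_filter => /andP[].
have DE w : D s w = \prod_(t <- S) pos_powR x (X t w) by rewrite /D big_filter.
have parS : uniq [seq par t | t <- S].
  rewrite map_inj_in_uniq ?filter_uniq// => t t'; rewrite !mem_filter => /andP[_ ts] /andP[_ ts'].
  exact: (parent_inj_spath Htree ts ts').
have h := prod_moment_le Hindep x0 hx regS parS.
have [||e he ep] := @has_mean_of_le _ _ _ P (D s) (p ^+ size S) _ (regular_power_ge0 s).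
- rewrite (_ : D s = fun w => \prod_(t <- S) pos_powR x (X t w)); last exact/funext.
  apply: measurable_prod => t tS.
  apply: (measurableT_comp (measurable_pos_powR x)); apply: edge_ratio_measurable.
  exact: regular_depth (regS _ tS).
- by under eq_integral do rewrite DE.
exists e => //; apply: (le_trans ep).
pose I := [seq t <- sp s | ~~ reg t].
have szI : (size I <= size bad)%N.
  apply: uniq_leq_size; first by rewrite filter_uniq.
  move=> t; rewrite mem_filter => /andP[nr ts]; apply: hbad => //.
  exact: (spath_mem_neq_root Htree ts).
have -> : dep s = (size S + size I)%N by rewrite /S /I !size_filter count_predC.
rewrite exprD mulrCA ler_peMr ?exprn_ge0 ?(ltW p0)//.
apply: (@le_trans _ _ (p^-1 ^+ size I * p ^+ size I)).
  by rewrite -exprMn mulVf ?gt_eqF// expr1n.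
rewrite ler_wpM2r ?exprn_ge0 ?(ltW p0)// ler_weXn2l// invf_ge1//.
Qed.

(* The irregular factors of a path only contribute a random constant. *)
Definition irregular_factor (Y : V -> R) : R := \prod_(t <- bad) Num.max 1 (Y t `^ x).

Lemma irregular_factor_ge1 Y : 1 <= irregular_factor Y.
Proof.
rewrite /irregular_factor; elim/big_ind : _ => // [u v u1 v1|t _].
  by rewrite mulr_ege1.
by rewrite le_max lexx.
Qed.

(** [Y] may depart from the environment at irregular edges, which allows the weights of level 1 to
    be replaced by transition probabilities of the walk. *)
Lemma path_weight_power_le (Y : V -> R) s w :
  (forall t, t != o -> 0 < Y t) -> (forall t, reg t -> Y t = X t w) ->
  path_weight adj o Y s `^ x <= irregular_factor Y * D s w.
Proof.
move=> Y0 YX; have Ysp t : t \in sp s -> 0 < Y t.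
  by move=> ts; apply: Y0; exact: (spath_mem_neq_root Htree ts).
rewrite /path_weight powR_prod; last by move=> t /Ysp/ltW.
rewrite (bigID reg)/= mulrC; apply: ler_pM.
- by rewrite prodr_ge0// => t _; exact: powR_ge0.
- by rewrite prodr_ge0// => t _; exact: powR_ge0.
all: swap 1 2.
- rewrite le_eqVlt; apply/orP; left; apply/eqP; rewrite /D big_seq_cond [RHS]big_seq_cond.
  apply: eq_bigr => t /andP[ts rt]; rewrite /pos_powR -YX//.
  by rewrite Ysp.
rewrite -big_filter; apply: (@le_trans _ _ (\prod_(t <- [seq t <- sp s | ~~ reg t]) Num.max 1 (Y t `^ x))).
  by apply: ler_prod => t _; rewrite powR_ge0 le_max lexx orbT.
apply: prod_sub_le => //.
- by rewrite filter_uniq//; have [_ _ /andP[]] := spath_spec o Htree s.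
- move=> t; rewrite mem_filter => /andP[nr ts]; apply: hbad => //.
  exact: (spath_mem_neq_root Htree ts).
- by move=> t; rewrite le_max lexx.
Qed.

Lemma ae_cutsets : cutset_inf adj o p = 0%E ->
  {ae P, forall w, forall e, 0 < e -> exists2 Pi, cutset adj o Pi &
     \sum_(s \in Pi) path_weight adj o (X^~ w) s < e}.
Proof.
move=> hinf.
have small e : 0 < e -> exists2 Pi : set V, cutset adj o Pi &
    \sum_(s \in Pi) p ^+ dep s < e.
  move=> e0; have [_ [Pi cPi <-]] := @ereal_inf_lt R _ e%:E (eq_ind_r (fun z => (z < e%:E)%E) (e0 : (0 < e%:E)%E) hinf).
  by rewrite lte_fin => h; exists Pi.
have hj j : {ae P, forall w, exists2 Pi, cutset adj o Pi &
    \sum_(s \in Pi) D s w < j.+1%:R^-1}.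
  have j0 : 0 < j.+1%:R^-1 :> R by rewrite invr_gt0.
  apply: ae_of_small => e e0.
  (* This cutset makes Markov's bound at level [j.+1%:R^-1] equal to at most [e]. *)
  have [|Pi cPi hPi] := small (e * j.+1%:R^-1 / K1); first by rewrite divr_gt0// mulr_gt0.
  have Pfin : finite_set Pi by case: cPi.
  pose S w := \sum_(s <- fset_set Pi) D s w.
  have [f hf] := choice (fun s => let: ex_intro2 e h1 h2 := regular_power_mean s in ex_intro (fun e => has_mean P (D s) e /\ e <= K1 * p ^+ dep s) e (conj h1 h2)).
  have hS : has_mean P S (\sum_(s <- fset_set Pi) f s).
    by apply: has_mean_sum => s _ _; case: (hf s).
  have S0 w : 0 <= S w by rewrite sumr_ge0// => s _; exact: regular_power_ge0.
  have [mB PB] := has_mean_markov hS S0 j0.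
  exists [set w | j.+1%:R^-1 <= S w].
    split=> //; apply: (le_trans PB); rewrite lee_fin ler_pdivrMr//.
    apply: (@le_trans _ _ (K1 * \sum_(s <- fset_set Pi) p ^+ dep s)).
      by rewrite mulr_sumr ler_sum// => s _; case: (hf s).
    by rewrite mulrC -ler_pdivlMr// ltW// -fsbig_finite.
  move=> w /= /negP; rewrite -ltNge => hw; exists Pi => //.
  by rewrite fsbig_finite.
apply: filterS2 ae_nice (ae_foralln hj) => w nw hw e e0.
pose k := irregular_factor (X^~ w).
have k1 : 1 <= k := irregular_factor_ge1 _.
have k0 : 0 < k by exact: lt_le_trans k1.
(* The random factor [k] is known before [j] is chosen. The bound 1 forces each weight below its
   power; the bound [e] then gives the claim. *)
have [j hj'] : exists j : nat, j.+1%:R^-1 < Num.min 1 e / k.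
  have h0 : 0 < Num.min 1 e / k by rewrite divr_gt0// lt_min ltr01.
  have [j _ /(_ j)] := near_infty_natSinv_lt (PosNum h0); rewrite /= leqnn => /(_ isT) hh.
  by exists j.
have [Pi cPi hPi] := hw j; exists Pi => //.
have Pfin : finite_set Pi by case: cPi.
rewrite fsbig_finite// in hPi; rewrite fsbig_finite//.
have hk : k * \sum_(s <- fset_set Pi) D s w < Num.min 1 e.
  by rewrite mulrC -ltr_pdivlMr// (lt_trans hPi).
move: hk; rewrite lt_min => /andP[hk1 hke]; apply: le_lt_trans hke.
rewrite mulr_sumr big_seq [leRHS]big_seq ler_sum// => s sPi.
have Xp t : t != o -> 0 < X t w by exact: edge_ratio_gt0.
have hp : path_weight adj o (X^~ w) s `^ x <= k * D s w by exact: path_weight_power_le.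
apply: (le_trans _ hp); apply: le_powR_of_lt1 => //; first exact: path_weight_gt0.
apply: (le_lt_trans hp); apply: (le_lt_trans _ hk1); rewrite ler_wpM2l ?(ltW k0)//.
rewrite (bigD1_seq s)//= ?fset_uniq// lerDl sumr_ge0// => t _; exact: regular_power_ge0.
Qed.

Lemma ae_ball_sums B0 : (forall n, \sum_(s <- tball n) p ^+ dep s <= B0) ->
  {ae P, forall w, exists M, forall n, \sum_(s <- tball n) D s w <= M}.
Proof.
move=> hB; apply: ae_of_small => e e0.
have B00 : 0 <= B0.
  by apply: le_trans (hB 0%N); rewrite sumr_ge0// => s _; rewrite exprn_ge0// ltW.
(* Markov's bound [K1 * B0 / M] is at most [e], uniformly in [n]; the added 1 keeps [M] positive. *)
pose M := (K1 * B0 + 1) / e.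
have M0 : 0 < M by rewrite divr_gt0// ltr_wpDl// mulr_ge0// ltW.
pose S n w := \sum_(s <- tball n) D s w.
have [f hf] := choice (fun s => let: ex_intro2 e h1 h2 := regular_power_mean s in ex_intro (fun e => has_mean P (D s) e /\ e <= K1 * p ^+ dep s) e (conj h1 h2)).
have hS n : has_mean P (S n) (\sum_(s <- tball n) f s).
  by apply: has_mean_sum => s _ _; case: (hf s).
have S0 n w : 0 <= S n w by rewrite sumr_ge0// => s _; exact: regular_power_ge0.
have hM n := has_mean_markov (hS n) (S0 n) M0.
exists (\bigcup_n [set w | M <= S n w]).
  split; first by apply: bigcup_measurable => n _; case: (hM n).
  apply: bigcup_measure_le => n; first by case: (hM n).
    move=> w /= /le_trans; apply; rewrite /S [tball n.+1]/(tball n ++ lev n.+1) big_cat/=.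
    by rewrite lerDl sumr_ge0// => s _; exact: regular_power_ge0.
  have [_ PB] := hM n; apply: (le_trans PB); rewrite lee_fin ler_pdivrMr//.
  rewrite /M mulrC divfK ?gt_eqF//.
  apply: (@le_trans _ _ (K1 * B0)); last by rewrite lerDl.
  apply: (@le_trans _ _ (K1 * \sum_(s <- tball n) p ^+ dep s)).
    by rewrite mulr_sumr ler_sum// => s _; case: (hf s).
  by rewrite ler_wpM2l// ltW.
move=> w hw; exists M => n; rewrite leNgt; apply/negP => h; apply: hw.
by exists n => //=; exact: ltW.
Qed.

End Upper.
End RandomNetwork.

(** * Lower bounds in the random network *)

Lemma prod_ge_exp (R : realDomainType) (V : eqType) (Y : V -> R) (u : R) (r : seq V) :
  0 <= u -> {in r, forall t, u <= Y t} -> u ^+ size r <= \prod_(t <- r) Y t.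
Proof.
move=> u0; elim: r => [|t r IH] h; first by rewrite big_nil.
rewrite big_cons exprS ler_pM ?exprn_ge0//; first by apply: h; exact: mem_head.
by apply: IH => t' t'r; apply: h; rewrite inE t'r orbT.
Qed.

(** Complete blocks contribute at least [b] each; an incomplete last block has fewer than [K]
    factors, each at least [u]. *)
Lemma prefix_prod_ge (R : realType) (V : eqType) (Y : V -> R) (K : nat) (u b : R)
    (bs : seq (seq V)) (x : nat) : (0 < K)%N -> 0 < u <= 1 -> 0 < b <= 1 ->
  {in bs, forall B, [/\ size B = K, {in B, forall t, u <= Y t} & b <= \prod_(t <- B) Y t]} ->
  u ^+ K * b ^+ (x %/ K) <= \prod_(t <- take x (flatten bs)) Y t.
Proof.
move=> K0 /andP[u0 u1] /andP[b0 b1]; elim: bs x => [|B bs IH] x h.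
  rewrite big_nil -[leRHS]mulr1 ler_pM ?exprn_ge0 ?(ltW u0) ?(ltW b0)//.
    by rewrite exprn_ile1 ?(ltW u0).
  by rewrite exprn_ile1 ?(ltW b0).
have [sB uB bB] := h B (mem_head _ _).
have {}IH := IH (x - K)%N (fun B' hB' => h B' (mem_behead (s := B :: bs) hB')).
rewrite /= take_cat sB; have [xK|Kx] := ltnP x K.
  rewrite divn_small// expr0 mulr1.
  apply: (@le_trans _ _ (u ^+ x)); first by rewrite ler_wiXn2l ?(ltW u0)// ltnW.
  have sz : size (take x B) = x by rewrite size_take sB xK.
  rewrite -{1}sz; apply: prod_ge_exp; first exact: ltW.
  by move=> t /mem_take/uB.
have -> : (x %/ K = ((x - K) %/ K).+1)%N.
  by rewrite -{1}(subnK Kx) divnDr// divnn K0 addn1.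
by rewrite big_cat/= exprS mulrCA ler_pM ?mulr_ge0 ?exprn_ge0 ?(ltW u0) ?(ltW b0).
Qed.

Section LowerBound.
Context d (T : measurableType d) (R : realType) (P : probability T R).
Variables (V : choiceType) (adj : rel V) (o : V).
Hypothesis (Htree : is_tree adj) (Hlf : locally_finite_graph adj).
Variables (q : V -> V -> {RV P >-> R}) (a : V -> {RV P >-> R}) (A : {RV P >-> R}).
Hypothesis Henv : random_environment adj o q a A.
Hypothesis HA : {ae P, forall w, 0 < A w}.

Notation sp := (spath adj o).
Notation par := (parent adj o).
Notation dep := (depth adj o).
Notation ch := (ch adj o).
Notation lev := (lev adj o).
Notation tball := (tball adj o).
Notation X := (edge_ratio adj o q a).
Notation reg := (regular adj o q a A).
Notation nice := (nice adj o q a).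
Notation C w := (path_weight adj o (X^~ w)).
Let p := min_moment A.

Lemma spath_anc k s : sp (iter k par s) = take (dep s - k) (sp s).
Proof.
elim: k => [|k IH]; first by rewrite subn0 take_oversize.
have [e|e] := eqVneq (iter k par s) o.
  have := depth_anc o Htree k s; rewrite e depth_root// => /esym/eqP.
  rewrite subn_eq0 => h; rewrite iterS e parent_root// spath_root//.
  by rewrite (_ : (dep s - k.+1 = 0)%N) ?take0//; apply/eqP; rewrite subn_eq0 ltnW.
have dk : (0 < dep s - k)%N by rewrite -(depth_anc o Htree) lt0n (depth_eq0 _ Htree).
have := IH; rewrite (spath_parent Htree e) -iterS => h.
have sz : size (sp (iter k.+1 par s)) = (dep s - k.+1)%N by rewrite -/(dep _) depth_anc.
have : take (dep s - k.+1) (rcons (sp (iter k.+1 par s)) (iter k par s)) =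
    take (dep s - k.+1) (take (dep s - k) (sp s)) by rewrite h.
rewrite -cats1 take_size_cat// take_takel// leq_sub2l//.
Qed.

Section Survivors.
Variables (m K : nat) (r B : R) (Es : seq (seq nat)) (N0 n : nat).
Hypotheses (m0 : (0 < m)%N) (K0 : (0 < K)%N) (B0 : 0 < B).
Hypothesis HEs : word_class (m * m) (cell_prob A m) (fun i => i%:R / m%:R) K r B Es.
Hypothesis N0reg : forall t, (N0 < dep t)%N -> reg t.
Hypothesis N00 : (0 < N0)%N.

Definition alive (b : seq V) (w : T) : bool := [seq cell m (X t w) | t <- b] \in Es.

Lemma alive_indep bs : {in bs, forall b, size b = K} ->
  {in flatten bs, forall t, (N0 < dep t)%N} -> uniq [seq par t | t <- flatten bs] ->
  has_mean P (fun w => (all (alive^~ w) bs)%:R) (r ^+ size bs).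
Proof.
move=> sbs dbs ubs; have [uEs hEs <-] := HEs.
apply: (@words_mean _ _ _ P V adj o q a A _ m K) => //.
- by case: Henv.
- by move=> e /hEs[].
- by move=> t /dbs/N0reg.
Qed.

Let N := (N0 + n * K)%N.
Let beta := Num.min 1 B.

(** One random constant, independent of [n], below all weights down to level [N0]: the minimum with
    1 puts the product below each factor. *)
Definition ball_factor (w : T) : R := \prod_(v <- tball N0) Num.min 1 (C w v).

Lemma ball_factor_gt0 w : nice w -> 0 < ball_factor w.
Proof.
move=> nw; rewrite /ball_factor prodr_gt0// => v _; rewrite lt_min ltr01 path_weight_gt0//.
by move=> t; exact: edge_ratio_gt0.
Qed.

Lemma ball_factor_le w v : nice w -> (dep v <= N0)%N -> ball_factor w <= C w v.
Proof.
move=> nw vN; have C0 u : 0 < C w u.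
  by rewrite path_weight_gt0// => t; exact: edge_ratio_gt0.
have m0' u : 0 < Num.min 1 (C w u) by rewrite lt_min ltr01 C0.
rewrite /ball_factor (bigD1_seq v) ?mem_ball ?ball_uniq//=.
apply: (@le_trans _ _ (Num.min 1 (C w v))); last by rewrite ge_min lexx orbT.
rewrite ler_piMr ?(ltW (m0' _))//; apply: prodr_ile1 => u _.
by rewrite (ltW (m0' _)) ge_min lexx.
Qed.

Lemma survivor_weight w s j : nice w -> dep s = N -> (j <= N)%N ->
  survives adj o alive K N0 n s w ->
  ball_factor w * (m%:R^-1 ^+ K * beta ^+ ((j - N0) %/ K)) <= C w (iter (N - j) par s).
Proof.
move=> nw sN jN hs.
have b0 : 0 < beta by rewrite lt_min ltr01.
have b1 : beta <= 1 by rewrite ge_min lexx.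
have u0 : 0 < m%:R^-1 :> R by rewrite invr_gt0 ltr0n.
have u1 : m%:R^-1 <= 1 :> R by rewrite invf_le1 ?ltr0n// ler1n.
have dt : dep (iter (N - j) par s) = j by rewrite depth_anc// sN subKn.
have [jN0|N0j] := leqP j N0.
  apply: (@le_trans _ _ (ball_factor w)); last by apply: ball_factor_le; rewrite ?dt.
  rewrite ler_piMr ?(ltW (ball_factor_gt0 _))// -[leRHS]mulr1.
  by rewrite ler_pM ?exprn_ge0 ?exprn_ile1 ?(ltW u0) ?(ltW b0).
rewrite /path_weight spath_anc sN subKn// -[X in take X _](subnK (ltnW N0j)) addnC takeD big_cat/=.
apply: ler_pM.
- exact/ltW/ball_factor_gt0.
- by rewrite mulr_ge0 ?exprn_ge0 ?(ltW u0) ?(ltW b0).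
- have -> : take N0 (sp s) = sp (iter (N - N0) par s).
    by rewrite spath_anc sN subKn// (leq_trans (ltnW N0j)).
  rewrite -/(path_weight adj o (X^~ w) _); apply: ball_factor_le => //.
  by rewrite depth_anc// sN subKn// (leq_trans (ltnW N0j)).
have -> : drop N0 (sp s) = flatten [seq block adj o K N0 s i | i <- iota 0 n].
  by rewrite (flatten_blocks (sp s) N0 K) mul0n addn0 take_oversize// size_drop -/(dep s) sN addKn.
apply: prefix_prod_ge; rewrite ?u0 ?b0//.
move=> blk hblk; have /allP/(_ _ hblk) := hs; rewrite /alive => wE.
have [_ /(_ _ wE)[sz /allP letters prodB] _] := HEs; rewrite size_map in sz.
have Xcell t : t \in blk -> (0 < (cell m (X t w))%:R / m%:R :> R) && ((cell m (X t w))%:R / m%:R <= X t w).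
  move=> tb; have /andP[c0 _] := letters _ (map_f (fun t => cell m (X t w)) tb).
  by rewrite divr_gt0 ?ltr0n//= cell_le.
split=> // [t tb|].
  have /andP[_] := Xcell _ tb; apply: le_trans.
  have /andP[c0 _] := letters _ (map_f (fun t => cell m (X t w)) tb).
  by rewrite ler_peMl ?(ltW u0)// ler1n.
apply: (@le_trans _ _ B); first by rewrite ge_min lexx orbT.
rewrite -prodB big_map [leLHS]big_seq [leRHS]big_seq; apply: ler_prod => t tb.
by have /andP[/ltW -> ->] := Xcell _ tb.
Qed.

Section Network.
Variables (c L l : R) (th : V -> R).
Hypotheses (c0 : 0 < c) (L0 : 0 < L).

Notation flow := (flow_through adj o alive K N0 r n th).

(** Outside the two Markov events the root flow exceeds [c / 2] and the weighted energy is below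
    [L], so Thomson's principle bounds the conductance. *)
Lemma conductance_ge w : nice w ->
  ~ (c ^+ 2 / 4 <= (root_flow adj o alive K N0 r n th w - c) ^+ 2) ->
  ~ (L <= \sum_(1 <= j < N.+1)
      beta^-1 ^+ ((j - N0) %/ K) * \sum_(t <- lev j) flow t w ^+ 2) ->
  ball_factor w * m%:R^-1 ^+ K * (c ^+ 2 / 4) / L <= out_cond adj o (C w) N.-1 o.
Proof.
move=> nw /negP; rewrite -ltNge => hW /negP; rewrite -ltNge => hE.
have HC s : s != o -> 0 < C w s.
  by move=> _; apply: path_weight_gt0 => // t; exact: edge_ratio_gt0.
have b0 : 0 < beta by rewrite lt_min ltr01.
have u0 : 0 < m%:R^-1 :> R by rewrite invr_gt0 ltr0n.
set k := ball_factor w * m%:R^-1 ^+ K.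
have k0 : 0 < k by rewrite mulr_gt0 ?ball_factor_gt0// exprn_gt0.
have N1 : N = N.-1.+1 by rewrite prednK// /N addn_gt0 N00.
have ftot : flow o w = root_flow adj o alive K N0 r n th w.
  rewrite /flow_through /root_flow big_seq_cond [RHS]big_seq; apply: eq_bigl => s.
  case sN: (s \in _) => //=; rewrite depth_root// subn0.
  rewrite -(depth_eq0 _ Htree) depth_anc//; move: sN; rewrite mem_lev// => /eqP ->.
  by rewrite subnn.
have fflow s : (dep s < N)%N -> flow s w = \sum_(t <- ch s) flow t w.
  by move=> sN; rewrite /flow_through sum_desc_children.
have := thomson Htree Hlf HC fflow N1; rewrite ftot => hT.
have W2 : c ^+ 2 / 4 <= root_flow adj o alive K N0 r n th w ^+ 2.
  move: hW; set W := root_flow _ _ _ _ _ _ _ _ _ => hW.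
  have := sqr_ge0 (W - c / 2); move: hW.
  move=> hW _; have : 0 < c * (W - c / 2).
    rewrite ltNge; apply/negP => h; move: hW; rewrite ltNge => /negP; apply.
    move: h; rewrite !expr2 => h; have := sqr_ge0 (W - c / 2); rewrite expr2; lra.
  rewrite pmulr_rgt0// subr_gt0 => h; have cc : 0 < c / 2 by rewrite divr_gt0.
  have : (c / 2) ^+ 2 <= W ^+ 2 by rewrite lerXn2r ?nnegrE ?ltW// (lt_trans cc).
  by apply: le_trans; rewrite exprMn exprVn -natrX.
apply: (@le_trans _ _ (k * root_flow adj o alive K N0 r n th w ^+ 2 / L)).
  by rewrite ler_wpM2r ?invr_ge0 ?(ltW L0)// ler_wpM2l ?(ltW k0).
rewrite ler_pdivrMr// mulrC -ler_pdivlMr//.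
apply: (le_trans hT); rewrite -mulrA ler_wpM2l ?out_cond_ge0//.
rewrite ler_pdivlMr// (le_trans _ (ltW hE))// mulrC mulr_sumr.
rewrite -[in X in X <= _]N1 big_nat [leRHS]big_nat ler_sum// => j /andP[j1 jN].
rewrite !mulr_sumr big_seq [leRHS]big_seq ler_sum// => t.
rewrite mem_lev// => /eqP tj.
have to : t != o by rewrite -(depth_eq0 _ Htree) tj -lt0n.
have [->|f0] := eqVneq (flow t w) 0; first by rewrite expr0n/= mul0r !mulr0.
(* A vertex with nonzero flow lies above a survivor of level [N], which bounds its weight from
   below. *)
have [s sN [st ss]] : exists2 s, s \in lev N & iter (N - dep t) par s == t /\
    survives adj o alive K N0 n s w.
  apply: contrapT => hno; move/eqP: f0; apply; rewrite /flow_through big_seq_cond big1// => s.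
  move=> /andP[sN st]; rewrite /weight; case: (boolP (survives _ _ _ _ _ _ _ _)) => [ss|_].
    by case: hno; exists s.
  by rewrite mulr0 mul0r.
have sN' : dep s = N by move: sN; rewrite mem_lev// => /eqP.
have := survivor_weight nw sN' (jN : (j <= N)%N) ss.
rewrite (_ : iter (N - j) par s = t); last by rewrite -tj; apply/eqP.
rewrite mulrA -/k => hC.
have Ct := HC t to; have bj0 : 0 < beta ^+ ((j - N0) %/ K) by rewrite exprn_gt0.
rewrite mulrCA [leRHS]mulrC ler_wpM2l ?sqr_ge0// ler_pdivrMr//.
by rewrite exprVn mulrC ler_pdivlMr.
Qed.

End Network.
End Survivors.

Lemma regular_depth_bound : exists N0, (0 < N0)%N /\ forall t, (N0 < dep t)%N -> reg t.
Proof.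
have [bad [_ hbad]] := irregular_list Htree Hlf Henv.
exists (\max_(t <- bad) dep t).+1; split=> // t ht; apply/negPn/negP => nr.
have to : t != o by rewrite -(depth_eq0 _ Htree) -lt0n (leq_ltn_trans _ ht).
have := @leq_bigmax_seq _ bad predT dep t (hbad t to nr) isT.
by move=> h; move: ht; rewrite ltnNge (leqW h).
Qed.

Lemma ae_lower (lam c : R) : 0 < lam -> 1 < p * lam -> 0 < c ->
  (forall Pi, cutset adj o Pi -> c <= \sum_(s \in Pi) lam^-1 ^+ dep s) ->
  {ae P, forall w, nice w -> exists2 e, 0 < e &
     forall k, exists2 n, (k <= n)%N & e <= out_cond adj o (C w) n o}.
Proof.
move=> lam0 plam c0 hcut.
have p1 : p <= 1 by exact: min_moment_le1.
have p0 : 0 < p by exact: min_moment_gt0.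
have lam1 : 1 < lam.
  by rewrite (lt_le_trans plam)// ler_piMl// ltW.
pose l := lam^-1.
have l0 : 0 < l by rewrite invr_gt0.
have l1 : l <= 1 by rewrite invf_le1// ltW.
(* Strictly between [lam^-1] and [p]: room below [p] for the grid, room above [lam^-1] for the word
   class. *)
pose cc := (p + l) / 2.
have lp : l < p by rewrite /l -[X in X < _]div1r ltr_pdivrMr.
have cp : cc < p by rewrite /cc; lra.
have cl : l < cc by rewrite /cc; lra.
have cc0 : 0 < cc by exact: lt_trans cl.
have [m [m0 hm]] := grid_moment_gt HA cp.
have b0 i : (0 < i)%N -> 0 < i%:R / m%:R :> R by move=> i0; rewrite divr_gt0 ?ltr0n.
have cclam : 1 < cc * lam by rewrite -ltr_pdivrMr// div1r.
have [K [r [B [Es [K0 HEs B0 hr]]]]] :=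
  exists_word_class (cell_prob_ge0 A m) b0 cc0 lam0 cclam hm.
pose beta := Num.min 1 B.
have be0 : 0 < beta by rewrite lt_min ltr01.
have be1 : beta <= 1 by rewrite ge_min lexx.
have lamK : 0 < lam ^+ K by rewrite exprn_gt0.
have r0 : 0 < r.
  rewrite ltNge; apply/negP => h; move: hr; rewrite ltNge => /negP; apply.
  by rewrite (le_trans _ ler01)// mulr_le0_ge0 ?(ltW lamK)// mulr_le0_ge0 ?(ltW be0).
pose x := r^-1 * l ^+ K.
(* The word class inequality rewritten; it makes both the variance and the energy series
   converge. *)
have xb : x < beta.
  rewrite /x /l exprVn -invfM -[X in X < _]div1r ltr_pdivrMr ?mulr_gt0//.
  by rewrite mulrC mulrAC.
have x1 : x < 1 by exact: lt_le_trans be1.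
have [N00 [N00_gt0 N00reg]] := regular_depth_bound.
have y0 : 0 < 1 - x by rewrite subr_gt0.
apply: ae_of_small => e e0.
have c20 : 0 < c ^+ 2 / 4 by rewrite divr_gt0// exprn_gt0.
(* Once [lam ^+ N0] reaches [z], the variance event has probability at most [e / 2]. *)
pose z := c / r / (1 - x) / (c ^+ 2 / 4) / (e / 2).
have [k0 hk0] := exists_expr_gt z lam1.
pose N0 := (N00 + k0)%N.
have N0_gt0 : (0 < N0)%N by rewrite addn_gt0 N00_gt0.
have N0reg t : (N0 < dep t)%N -> reg t.
  by move=> h; apply: N00reg; apply: leq_ltn_trans h; rewrite leq_addr.
pose M := c * (l ^+ N0 / r) / (1 - x).
have hM : M / (c ^+ 2 / 4) <= e / 2.
  have e20 : 0 < e / 2 by rewrite divr_gt0.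
  rewrite -[leRHS]mul1r -ler_pdivrMr//.
  have -> : M / (c ^+ 2 / 4) / (e / 2) = z / lam ^+ N0.
    by rewrite /M /z /l exprVn; ring.
  rewrite ler_pdivrMr ?exprn_gt0// mul1r (le_trans (ltW hk0))//.
  by rewrite ler_eXn2l// leq_addl.
pose Mb := N0%:R * c ^+ 2 + M * (N0%:R + K%:R / (1 - x / beta)).
have M0 : 0 <= M by rewrite !mulr_ge0 ?invr_ge0 ?exprn_ge0 ?(ltW c0) ?(ltW l0) ?(ltW r0) ?(ltW y0).
have Mb0 : 0 <= Mb.
  have xb0 : 0 <= 1 - x / beta by rewrite subr_ge0 ler_pdivrMr// mul1r ltW.
  apply: addr_ge0; first by rewrite mulr_ge0 ?sqr_ge0.
  by apply: (mulr_ge0 M0); rewrite addr_ge0 ?divr_ge0.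
pose L := (Mb + 1) / (e / 2).
have L0 : 0 < L by rewrite divr_gt0 ?divr_gt0// ltr_wpDl.
have step (n : nat) : exists F : set T, [/\ measurable F, (P F <= e%:E)%E &
    forall w, nice w -> ~ F w ->
      ball_factor N0 w * m%:R^-1 ^+ K * (c ^+ 2 / 4) / L <=
      out_cond adj o (C w) (N0 + n.+1 * K).-1 o].
  pose N := (N0 + n.+1 * K)%N.
  have N1 : N.-1.+1 = N by rewrite prednK// /N addn_gt0 N0_gt0.
  have [th [th_root th_ge0 th_le th_flow]] := level_flow Htree Hlf N.-1 l0 (ltW c0) hcut.
  rewrite N1 in th_le th_flow.
  have ind := alive_indep HEs N0reg.
  have [v hv vM] := total_variance Htree Hlf K0 N0_gt0 r0 ind (ltn0Sn n) l0 l1 (ltW c0)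
    th_root th_ge0 th_le th_flow x1.
  have [g hg gM] := total_energy Htree Hlf K0 N0_gt0 r0 ind (ltn0Sn n) l0 l1 (ltW c0)
    th_root th_ge0 th_le th_flow x1 be0 be1 xb.
  have [mV PV] := has_mean_markov hv (fun w => sqr_ge0 _) c20.
  have E0 w : 0 <= \sum_(1 <= j < N.+1) beta^-1 ^+ ((j - N0) %/ K) *
      \sum_(t <- lev j) flow_through adj o (alive m Es) K N0 r n.+1 th t w ^+ 2.
    rewrite sumr_ge0// => j _; rewrite mulr_ge0 ?exprn_ge0 ?invr_ge0 ?(ltW be0)//.
    by rewrite sumr_ge0// => t _; exact: sqr_ge0.
  have [mE PE] := has_mean_markov hg E0 L0.
  eexists (_ `|` _); split.
  - exact: (measurableU _ _ mV mE).
  - apply: (le_trans (measureU2 _ mV mE)).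
    have -> : e%:E = ((e / 2)%:E + (e / 2)%:E)%E by rewrite -EFinD; congr EFin; lra.
    apply: leeD.
      by apply: (le_trans PV); rewrite lee_fin (le_trans _ hM)// ler_wpM2r// invr_ge0 ltW.
    apply: (le_trans PE); rewrite lee_fin ler_pdivrMr// /L.
    rewrite mulrC divfK; last by rewrite gt_eqF// divr_gt0.
    by rewrite (le_trans gM)// lerDl.
  - move=> w nw nF; apply: (conductance_ge (th := th) m0 K0 B0 HEs N0_gt0 c0 L0 nw).
      by move=> h; apply: nF; left.
    by move=> h; apply: nF; right.
have [F hF] := choice step.
(* On [G k] every [n >= k] fails. Its probability is at most that of [F k] alone, so up to
   probability [e] infinitely many [n] succeed; no summability of the probabilities is involved. *)
pose G k := \bigcap_(n in [set n | (k <= n)%N]) F n.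
have mG k : measurable (G k) by apply: bigcap_measurable => [|n _]; [exists k => /=|case: (hF n)].
exists (\bigcup_k G k).
  split; first by apply: bigcup_measurable => k _.
  apply: bigcup_measure_le => // k.
    by move=> w hw n /= kn; apply: hw; exact: ltnW.
  have [mF PF _] := hF k; apply: (le_trans _ PF); apply: le_measure; rewrite ?inE//.
  by move=> w; apply => /=.
move=> w hw nw; exists (ball_factor N0 w * m%:R^-1 ^+ K * (c ^+ 2 / 4) / L).
  by rewrite divr_gt0// mulr_gt0// mulr_gt0 ?exprn_gt0 ?invr_gt0 ?ltr0n// ball_factor_gt0.
move=> k; have : ~ G k w by move=> h; apply: hw; exists k.
move=> /existsNP[n /not_implyP[kn nF]].
have [_ _ /(_ w nw nF) h] := hF n.
exists (N0 + n.+1 * K).-1 => //.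
rewrite -ltnS (@prednK (N0 + n.+1 * K)%N); last by rewrite addn_gt0 N0_gt0.
apply: (@leq_trans n.+1); first by rewrite ltnS.
by rewrite (leq_trans _ (leq_addl _ _))// leq_pmulr.
Qed.

End LowerBound.

(** * Summability criteria and the theorem *)

(** Outside some finite list the remaining powers sum to less than 1, so there each [f s] is at most
    its power. *)
Lemma sum_bounded_of_power (R : realType) (V : choiceType) (r : nat -> seq V) (f : V -> R)
    (x B : R) : 0 <= x <= 1 -> (forall n, uniq (r n)) ->
  (forall m n, (m <= n)%N -> {subset r m <= r n}) -> (forall s, 0 < f s) ->
  (forall n, \sum_(s <- r n) f s `^ x <= B) ->
  exists B', forall n, \sum_(s <- r n) f s <= B'.
Proof.
move=> x01 ur rr f0 hB.
pose Q n := \sum_(s <- r n) f s `^ x.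
have hs : has_sup (range Q) by split; [exists (Q 0%N), 0%N|exists B => _ [n _ <-]; exact: hB].
have [_ [m _ <-] hm] := sup_adherent (ltr01 : 0 < 1) hs.
exists (\sum_(s <- r m) f s + B) => n.
pose N := maxn m n; have mN : (m <= N)%N by exact: leq_maxl.
have nN : (n <= N)%N by exact: leq_maxr.
have split_sum (g : V -> R) k : (k <= N)%N ->
    \sum_(s <- r N) g s = \sum_(s <- r k) g s + \sum_(s <- r N | s \notin r k) g s.
  move=> kN; rewrite (bigID (mem (r k)))/=; congr (_ + _); rewrite -big_filter.
  apply: perm_big; apply: uniq_perm => [||s]; [by rewrite filter_uniq|by []|].
  rewrite mem_filter; case: (boolP (s \in r k)) => //= sk.
  exact: rr sk.
have small s : s \in r N -> s \notin r m -> f s <= f s `^ x.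
  move=> sN sm; apply: le_powR_of_lt1 => //.
  have QN : Q N <= sup (range Q) by apply: ub_le_sup; [case: hs|exists N].
  have : Q N - Q m < 1 by lra.
  apply: le_lt_trans; rewrite /Q (split_sum (fun s => f s `^ x) m mN) addrAC subrr add0r.
  rewrite -big_filter (bigD1_seq s)/= ?filter_uniq ?mem_filter ?sm//.
  by rewrite lerDl sumr_ge0// => t _; exact: powR_ge0.
apply: (@le_trans _ _ (\sum_(s <- r N) f s)).
  by rewrite (split_sum f n nN) lerDl sumr_ge0// => s _; exact: ltW.
rewrite (split_sum f m mN) lerD2l (le_trans _ (hB N))//.
rewrite (split_sum (fun s => f s `^ x) m mN).
apply: (@le_trans _ _ (\sum_(s <- r N | s \notin r m) f s `^ x)).
  by rewrite big_seq_cond [leRHS]big_seq_cond ler_sum// => s /andP[sN sm]; exact: small.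
by rewrite lerDr sumr_ge0// => s _; exact: powR_ge0.
Qed.

Lemma eventually_lt_of_limn_esup (R : realType) (u : nat -> \bar R) (l : \bar R) :
  (limn_esup u < l)%E -> exists n0, forall n, (n0 <= n)%N -> (u n < l)%E.
Proof.
move=> /ereal_inf_lt[_ [B [n0 _ hB] <-] hl]; exists n0 => n hn.
by apply: le_lt_trans hl; apply: ereal_sup_ubound; exists n => //; exact: hB.
Qed.

Section Criteria.
Variables (R : realType) (V : choiceType) (adj : rel V) (o : V).
Hypothesis (Htree : is_tree adj) (Hlf : locally_finite_graph adj).

Notation dep := (depth adj o).
Notation lev := (lev adj o).
Notation tball := (tball adj o).
Notation cinf := (@cutset_inf R V adj o).

Lemma cutset_sum_ge0 (mu : R) Pi : 0 <= mu -> 0 <= \sum_(s \in Pi) mu ^+ dep s.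
Proof.
move=> mu0; rewrite fsumr_ge0// => s _; exact: exprn_ge0.
Qed.

Lemma cutset_inf_ge0 mu : 0 <= mu -> (0 <= cinf mu)%E.
Proof.
by move=> mu0; apply: le_ereal_inf_tmp => _ [Pi _ <-]; rewrite lee_fin cutset_sum_ge0.
Qed.

Lemma cutset_lower_bound mu : 0 <= mu -> cinf mu <> 0%E ->
  exists2 c, 0 < c & forall Pi, cutset adj o Pi -> c <= \sum_(s \in Pi) mu ^+ dep s.
Proof.
move=> mu0 ne; have i0 : (0 < cinf mu)%E.
  by rewrite lt_neqAle cutset_inf_ge0// andbT eq_sym; exact/eqP.
have [c c0 hc] : exists2 c : R, 0 < c & (c%:E <= cinf mu)%E.
  move: i0; case: (cinf mu) => [r|_|//]; last by exists 1; rewrite ?leey.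
  by rewrite lte_fin => r0; exists r.
exists c => // Pi cPi; rewrite -lee_fin; apply: (le_trans hc).
by apply: ereal_inf_lbound; exists Pi.
Qed.

Lemma cutset_inf_eq0_le (mu nu : R) : 0 <= mu <= nu -> cinf nu = 0%E -> cinf mu = 0%E.
Proof.
move=> /andP[mu0 munu] nu_eq0; apply/eqP; rewrite eq_le cutset_inf_ge0// andbT -nu_eq0.
apply: le_ereal_inf_tmp => _ [Pi cPi <-].
apply: (@le_trans _ _ (\sum_(s \in Pi) mu ^+ dep s)%:E).
  by apply: ereal_inf_lbound; exists Pi.
have Pfin : finite_set Pi by case: cPi.
rewrite lee_fin !fsbig_finite// ler_sum// => s _.
by rewrite lerXn2r ?nnegrE// (le_trans mu0).
Qed.

Lemma level_cutset n : cutset adj o [set` lev n.+1].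
Proof.
move: (lev n.+1) (mem_lev o Htree Hlf n.+1) => l ml; split.
- exact: finite_seq.
- by rewrite /= ml depth_root.
- move=> x x0 xa xi; exists n.+1 => /=; rewrite ml; apply/eqP.
  have xc := ray_child Htree Hlf x0 xa xi.
  by elim: n.+1 => [|k IH]; rewrite ?x0 ?depth_root// (ch_depth Htree Hlf (xc k)) IH.
- move=> s t /=; rewrite !ml => /eqP sn /eqP tn; rewrite /tlt negb_and negbK.
  rewrite /tle inE; case: (eqVneq s o) => [so|_]; first by move: sn; rewrite so depth_root.
  case: (boolP (s \in spath adj o t)) => //= st.
  by rewrite (spath_mem_anc Htree st) sn tn subnn.
Qed.

(** Levels are cutsets, so a positive infimum would make every level contribute at least a fixed
    amount to the sum. *)
Lemma cutset_inf_eq0_of_summable (mu B : R) : 0 <= mu ->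
  (forall n, \sum_(s <- tball n) mu ^+ dep s <= B) -> cinf mu = 0%E.
Proof.
move=> mu0 hB; apply/eqP; rewrite eq_le cutset_inf_ge0// andbT.
apply/lee_addgt0Pr => e e0; rewrite add0e leNgt; apply/negP => he.
have big n : n%:R * e <= \sum_(s <- tball n) mu ^+ dep s.
  elim: n => [|n IH]; first by rewrite mul0r sumr_ge0// => s _; exact: exprn_ge0.
  rewrite -[tball n.+1]/(tball n ++ lev n.+1) big_cat/= -natr1 mulrDl mul1r lerD//.
  rewrite -lee_fin; apply: (le_trans (ltW he)).
  apply: ereal_inf_lbound; exists [set` lev n.+1]; first exact: level_cutset.
  by rewrite -(@fsbig_seq _ _ _ _ (lev n.+1) _ (lev_uniq o Htree Hlf n.+1)).
have := le_trans (big (Num.bound (B / e))) (hB _).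
rewrite leNgt => /negP; apply; rewrite -ltr_pdivrMr//.
by apply: le_lt_trans (archi_boundP _); rewrite ?ler_norm// divr_ge0 ?(ltW e0)// (le_trans _ (hB 0%N))// sumr_ge0// => s _; exact: exprn_ge0.
Qed.

Lemma ball_sums_of_esum (mu : R) : 0 <= mu ->
  (\esum_(s in [set: V]) (mu ^+ dep s)%:E < +oo)%E ->
  exists B, forall n, \sum_(s <- tball n) mu ^+ dep s <= B.
Proof.
move=> mu0 h; exists (fine (\esum_(s in [set: V]) (mu ^+ dep s)%:E)) => n.
rewrite -lee_fin fineK; last first.
  by rewrite ge0_fin_numE ?esum_ge0// => s _; rewrite lee_fin exprn_ge0.
rewrite -sumEFin; apply: ereal_sup_ubound; exists [set` tball n].
  by split => //; exact: finite_seq.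
by rewrite -(@fsbig_seq _ _ _ _ (tball n) _ (ball_uniq o Htree Hlf n)).
Qed.

Lemma level_cardE n : level_card adj o n = size (lev n).
Proof.
rewrite /level_card; apply/perm_size/uniq_perm; rewrite ?fset_uniq ?lev_uniq// => s.
have e : [set s | dep s = n] = [set` lev n].
  by apply/seteqP; split => t /=; rewrite mem_lev// => /eqP.
rewrite e in_fset_set; last exact: finite_seq.
by apply/idP/idP => [/set_mem|h]; last exact/mem_set.
Qed.

(** Root test, with [rho] strictly between the growth rate and [mu^-1]. *)
Lemma ball_sums_of_growth (mu : R) : 0 < mu ->
  (mu%:E * limn_esup (fun n : nat =>
     ((level_card adj o n)%:R `^ n%:R^-1 : R)%:E) < 1)%E ->
  exists B, forall n, \sum_(s <- tball n) mu ^+ dep s <= B.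
Proof.
move=> mu0; set L := limn_esup _ => hL.
have [rho [rho0 Lrho mrho]] : exists rho : R, [/\ 0 < rho, (L < rho%:E)%E & mu * rho < 1].
  have h2 : mu * (mu^-1 / 2) < 1 by rewrite mulrA mulfV ?gt_eqF//; lra.
  have mi : 0 < mu^-1 by rewrite invr_gt0.
  move: hL; case: L => [l| |].
  - rewrite -EFinM lte_fin => hl; have hl' : l < mu^-1.
      by rewrite -[X in _ < X]div1r ltr_pdivlMr// mulrC.
    have [l0|l0] := leP l 0.
      by exists (mu^-1 / 2); split=> //; rewrite ?lte_fin; lra.
    exists ((l + mu^-1) / 2); rewrite lte_fin; split; [lra|lra|].
    by rewrite mulrC -ltr_pdivlMr// div1r; lra.
  - by rewrite gt0_muley// lte_fin.
  - by move=> _; exists (mu^-1 / 2); split=> //; [lra|exact: ltNyr].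
have [n0 hn0] := eventually_lt_of_limn_esup Lrho.
have x0 : 0 <= mu * rho by rewrite mulr_ge0 ?ltW.
have levE i : \sum_(s <- lev i) mu ^+ dep s = (size (lev i))%:R * mu ^+ i.
  rewrite (eq_big_seq (fun=> mu ^+ i)); last by move=> s; rewrite mem_lev// => /eqP ->.
  by rewrite big_const_seq count_predT iter_addr_0 mulr_natl.
(* Level 0 is kept out of the tail: with exponent [0^-1 = 0] the root does not recover the size of
   the level. *)
pose N := n0.+1.
have lev_le i : (N <= i)%N -> \sum_(s <- lev i) mu ^+ dep s <= (mu * rho) ^+ i.
  move=> Ni; rewrite levE exprMn mulrC ler_wpM2l ?exprn_ge0 ?(ltW mu0)//.
  have := hn0 i (ltnW Ni); rewrite lte_fin level_cardE => h.
  have i0 : i%:R != 0 :> R by rewrite pnatr_eq0; case: i Ni {h}.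
  rewrite -powR_mulrn ?(ltW rho0)// -[leLHS](@powRr1 R)//.
  rewrite -[X in _ `^ X <= _](mulVf i0) powRrM.
  by rewrite ge0_ler_powR ?nnegrE ?powR_ge0 ?(ltW rho0) ?(ltW h).
have S0 i : 0 <= \sum_(s <- lev i) mu ^+ dep s.
  by rewrite sumr_ge0// => s _; rewrite exprn_ge0// ltW.
exists (\sum_(0 <= i < N) \sum_(s <- lev i) mu ^+ dep s + (mu * rho) ^+ N / (1 - mu * rho)) => n.
rewrite sum_ball//.
have [nN|Nn] := leqP n.+1 N.
  rewrite -[leLHS]addr0 lerD//; last by rewrite divr_ge0 ?exprn_ge0// subr_ge0 ltW.
  by rewrite [leRHS](big_cat_nat (leq0n _) nN)//= lerDl sumr_ge0.
rewrite (big_cat_nat (leq0n _) (ltnW Nn))//= lerD2l.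
apply: (le_trans _ (geometric_tail N n.+1 x0 mrho)).
by rewrite big_nat [leRHS]big_nat ler_sum// => i /andP[+ _]; exact: lev_le.
Qed.

End Criteria.

Section Conclusions.
Context d (T : measurableType d) (R : realType) (P : probability T R).
Variables (V : choiceType) (adj : rel V) (o : V).
Hypothesis (Htree : is_tree adj) (Hlf : locally_finite_graph adj).
Variables (q : V -> V -> {RV P >-> R}) (a : V -> {RV P >-> R}) (A : {RV P >-> R}).
Hypothesis Henv : random_environment adj o q a A.
Hypothesis HA : {ae P, forall w, 0 < A w}.

Notation dep := (depth adj o).
Notation tball := (tball adj o).
Notation X := (edge_ratio adj o q a).
Notation nice := (nice adj o q a).
Notation walk w := (fun s t => q s t w).
Notation C w := (path_weight adj o (X^~ w)).
Notation cinf := (@cutset_inf R V adj o).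
Let p := min_moment A.
Let p0 : 0 < p. Proof. exact: min_moment_gt0. Qed.

Lemma ae_transient : (1 < p%:E * branching_number R adj o)%E ->
  {ae P, forall w, [/\ transient (walk w), positive_conductance adj o (C w) &
    admits_flow adj o (C w)]}.
Proof.
move=> hbr; have [lam [lam0 lambr plam]] :
    exists lam, [/\ 0 < lam, (lam%:E < branching_number R adj o)%E & 1 < p * lam].
  have pi : 0 < p^-1 by rewrite invr_gt0.
  move: hbr; case: (branching_number R adj o) => [b| |].
  - rewrite -EFinM lte_fin mulrC -ltr_pdivrMr// div1r => hb.
    exists ((b + p^-1) / 2); rewrite lte_fin; split; [lra|lra|].
    by rewrite mulrC -ltr_pdivrMr// div1r; lra.
  - move=> _; exists (2 * p^-1); split; rewrite ?ltry//; first by lra.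
    by rewrite mulrCA mulfV ?gt_eqF//; lra.
  - by rewrite gt0_muleNy// lte_fin.
(* An infimum 0 would put [lam] into the set whose infimum is the branching number, although [lam]
   is smaller than that number. *)
have ne : cinf lam^-1 <> 0%E.
  move=> h; move: lambr; rewrite ltNge => /negP; apply.
  by apply: ereal_inf_lbound; exists lam.
have lami0 : 0 <= lam^-1 by rewrite invr_ge0 ltW.
have [c c0 hc] := cutset_lower_bound lami0 ne.
apply: filterS2 (ae_nice Htree Hlf Henv HA) (ae_lower Htree Hlf Henv HA lam0 plam c0 hc).
move=> w nw /(_ nw)[e e0 he]; have [Hw _] := nw.
apply: (conductance_conclusions Htree Hlf Hw (X := X^~ w) _ _ e0 he).
- by move=> s so; exact: edge_ratio_gt0.
- by move=> t t2; rewrite edge_ratioE.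
Qed.

Lemma ae_recurrent : cinf p = 0%E ->
  {ae P, forall w, [/\ recurrent (walk w), zero_conductance adj o (C w) &
    ~ admits_flow adj o (C w)]}.
Proof.
move=> hinf; have [x x01 hx] := min_moment_attained HA.
have [bad [ubad hbad]] := irregular_list Htree Hlf Henv.
apply: filterS2 (ae_nice Htree Hlf Henv HA)
  (ae_cutsets Htree Hlf Henv HA x01 hx ubad hbad hinf) => w nw hw.
have nf := no_flow_of_cutsets Htree Hlf hw; have [Hw _] := nw.
have [||//] := no_flow_conclusions Htree Hlf Hw (X := X^~ w) _ _ nf.
- by move=> s so; exact: edge_ratio_gt0.
- by move=> t t2; rewrite edge_ratioE.
Qed.

Lemma cutset_inf_eq0_of_branching : (p%:E * branching_number R adj o < 1)%E -> cinf p = 0%E.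
Proof.
move=> hbr; have : (branching_number R adj o < (p^-1)%:E)%E.
  move: hbr; case: (branching_number R adj o) => [b| |].
  - by rewrite -EFinM !lte_fin -[p^-1]div1r ltr_pdivlMr// mulrC.
  - by rewrite gt0_muley// lte_fin.
  - by rewrite ltNyr.
move=> /ereal_inf_lt[_ [lam [lam0 hlam] <-]]; rewrite lte_fin => lamp.
apply: cutset_inf_eq0_le hlam; rewrite (ltW p0)/=.
by rewrite -[p]invrK lef_pV2 ?posrE ?invr_gt0// ltW.
Qed.

Lemma ae_positive_recurrent B : (forall n, \sum_(s <- tball n) p ^+ dep s <= B) ->
  {ae P, forall w, positive_recurrent (walk w)}.
Proof.
move=> hB; have [x x01 hx] := min_moment_attained HA.
have [bad [ubad hbad]] := irregular_list Htree Hlf Henv.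
have hinf := cutset_inf_eq0_of_summable Htree Hlf (ltW p0) hB.
apply: filterS2 (filterI (ae_nice Htree Hlf Henv HA) (ae_recurrent hinf))
  (ae_ball_sums Htree Henv HA x01 hx hbad hB) => w [nw [rec _ _]] [M hM].
split=> //; have [Hw _] := nw.
(* A return time involves the walk, not the auxiliary variables of level 1. *)
pose Y t := if t \in ch adj o o then q o t w else X t w.
have Y0 t : t != o -> 0 < Y t.
  rewrite /Y; case: ifP => [to _|_]; last exact: edge_ratio_gt0.
  by apply: (q_gt0 Hlf Hw); rewrite mem_nb// (adjE o Htree) -!mem_ch// to.
have Y2 t : (1 < dep t)%N -> Y t = X t w.
  by rewrite /Y; case: ifP => // /(ch_depth Htree Hlf) ->; rewrite depth_root.
pose k := irregular_factor x bad Y.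
have k0 : 0 <= k by rewrite (le_trans ler01)// irregular_factor_ge1.
have pw n : \sum_(s <- tball n) path_weight adj o Y s `^ x <= k * M.
  apply: (@le_trans _ _ (\sum_(s <- tball n) k * regular_power adj o q a A x s w)).
    rewrite ler_sum// => s _; apply: path_weight_power_le => // t rt.
    by rewrite Y2// (regular_depth rt).
  by rewrite -mulr_sumr ler_wpM2l.
have [|||B' hB'] := sum_bounded_of_power (f := path_weight adj o Y) x01 _ _ _ pw.
- by move=> n; exact: ball_uniq.
- by move=> m n mn s; rewrite !mem_ball// => /leq_trans; exact.
- by move=> s; exact: path_weight_gt0.
apply: (mean_return_of_summable Htree Hlf Hw Y0 _ _ hB').
- by move=> t t2; rewrite Y2// edge_ratioE.
- by move=> t to; rewrite /Y to.
Qed.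

End Conclusions.

Theorem theorem1 (R : realType) (d : measure_display) (T : measurableType d)
    (P : probability T R) (V : choiceType) (adj : rel V) (o : V)
    (q : V -> V -> {RV P >-> R}) (a : V -> {RV P >-> R}) (A : {RV P >-> R}) :
  is_tree adj -> locally_finite_graph adj -> infinite_set [set: V] ->
  random_environment adj o q a A ->
  {ae P, forall w, 0 < A w} ->
  let p := min_moment A in
  let br := branching_number R adj o in
  let walk := fun (w : T) (s t : V) => q s t w in
  let C := env_conductance adj o (fun s t => q s t) (fun s => a s) in
  let conclusion2 :=
    [/\ {ae P, forall w, recurrent (walk w)},
        {ae P, forall w, zero_conductance adj o (C w)} &
        {ae P, forall w, ~ admits_flow adj o (C w)}] in
  let conclusion3 := {ae P, forall w, positive_recurrent (walk w)} in
  [/\ (1 < p%:E * br)%E ->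
        [/\ {ae P, forall w, transient (walk w)},
            {ae P, forall w, positive_conductance adj o (C w)} &
            {ae P, forall w, admits_flow adj o (C w)}],
      (p%:E * br < 1)%E -> conclusion2,
      cutset_inf adj o p = 0%E -> conclusion2,
      (p%:E * limn_esup (fun n : nat =>
         ((level_card adj o n)%:R `^ n%:R^-1 : R)%:E) < 1)%E -> conclusion3 &
      (\esum_(s in [set: V]) (p ^+ depth adj o s)%:E < +oo)%E -> conclusion3].
Proof.
move=> Htree Hlf _ Henv HA p br walk C conclusion2 conclusion3.
have c2 : cutset_inf adj o p = 0%E -> conclusion2.
  by move=> /(ae_recurrent Htree Hlf Henv HA) h; split; apply: filterS h => w [].
split=> //.
- by move=> /(ae_transient Htree Hlf Henv HA) h; split; apply: filterS h => w [].
- by move=> h; apply: c2; exact: cutset_inf_eq0_of_branching h.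
- move=> /(ball_sums_of_growth Htree Hlf (min_moment_gt0 HA))[B hB].
  exact: (ae_positive_recurrent Htree Hlf Henv HA hB).
- move=> /(ball_sums_of_esum Htree Hlf (ltW (min_moment_gt0 HA)))[B hB].
  exact: (ae_positive_recurrent Htree Hlf Henv HA hB).
Qed.
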